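(* Let $k$ be an algebraically closed field of characteristic $p>0$, let $\mathcal{G}$ be a finite group scheme over $k$, and let $M$ be a finite-dimensional $\mathcal{G}$-module of constant rank. If $\dim_k M\le\mathrm{rk}_{au}(\mathcal{G})$, then $\mathrm{rk}(M)=0$.
   Context: $k\mathcal{G}=k[\mathcal{G}]^\ast$ is the algebra of measures of $\mathcal{G}$; $\mathcal{G}$-modules are $k\mathcal{G}$-modules; for $u\in k\mathcal{G}$, $u_M$ is the operator $m\mapsto um$ on $M$. Let $\mathfrak{A}_p=k[T]/(T^p)$ and $t=T+(T^p)$. A $p$-point of $\mathcal{G}$ is an algebra homomorphism $\alpha:\mathfrak{A}_p\to k\mathcal{G}$ such that $k\mathcal{G}$ is projective as a left $\mathfrak{A}_p$-module via $\alpha$, and $\mathrm{im}\,\alpha\subseteq k\mathcal{U}$ for some abelian unipotent subgroup scheme $\mathcal{U}\subseteq\mathcal{G}$. $\mathrm{Pt}(\mathcal{G})$ is the set of $p$-points. Two $p$-points $\alpha,\beta$ are equivalent if for every finite-dimensional $\mathcal{G}$-module $N$, $\alpha^\ast(N)$ is projective if and only if $\beta^\ast(N)$ is projective. $\mathrm{P}(\mathcal{G})$ is the set of equivalence classes; it is a noetherian topological space whose closed sets are the sets $\mathrm{P}(\mathcal{G})_N=\{[\alpha] : \alpha^\ast(N)\text{ not projective}\}$, $N$ a finite-dimensional $\mathcal{G}$-module. The empty space has dimension $-1$. The abelian unipotent rank is $\mathrm{rk}_{au}(\mathcal{G})=\max\{\dim\mathrm{P}(\mathcal{U})+1 : \mathcal{U}\subseteq\mathcal{G}\text{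 abelian unipotent subgroup}\}$. (For a finite group $G$ this is the $p$-rank of $G$.) $\mathrm{rk}(M)=\max\{\mathrm{rk}(\alpha(t)_M) : \alpha\in\mathrm{Pt}(\mathcal{G})\}$ (with $\max\emptyset=0$), and $M$ has constant rank if $\mathrm{rk}(\alpha(t)_M)=\mathrm{rk}(M)$ for all $\alpha\in\mathrm{Pt}(\mathcal{G})$. *)

(* Defs.v *)
From HB Require Import structures.
From mathcomp Require Import all_boot all_order all_algebra all_field.
From mathcomp Require Import boolp classical_sets.

Set Implicit Arguments.
Unset Strict Implicit.
Unset Printing Implicit Defensive.

Import GRing.Theory VectorInternalTheory.
Local Open Scope ring_scope.

(* The tensor product U (x) V of finite-dimensional spaces, in coordinates with
   respect to the bases [vbase U] and [vbase V].  [tlift f] is the linear map on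
   U (x) V induced by a bilinear f: see [tlift_tens] and [tens_ext]. *)
Section Tensor.
Variable k : fieldType.
Implicit Types U V W X : vectType k.

Definition tensor U V : Type := 'M[k]_(dim U, dim V).
HB.instance Definition _ U V := Vector.copy (tensor U V) 'M[k]_(dim U, dim V).

Definition tens U V (u : U) (v : V) : tensor U V := (v2r u)^T *m v2r v.

Definition vbase U (i : 'I_(dim U)) : U := r2v (delta_mx 0 i).

Definition tlift U V W (f : U -> V -> W) (t : tensor U V) : W :=
  \sum_i \sum_j (t : 'M_(_, _)) i j *: f (vbase i) (vbase j).

Definition tmap U V U' V' (f : U -> U') (g : V -> V') :
    tensor U V -> tensor U' V' :=
  tlift (fun u v => tens (f u) (g v)).

Definition tassoc U V W : tensor (tensor U V) W -> tensor U (tensor V W) :=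
  tlift (fun t w => tlift (fun u v => tens u (tens v w)) t).

Definition tswap U V : tensor U V -> tensor V U :=
  tlift (fun u v => tens v u).

Lemma vbase_sum U (u : U) : u = \sum_i v2r u 0 i *: vbase i.
Proof.
rewrite -[LHS]v2rK {1}[v2r u]row_sum_delta linear_sum /=.
by apply: eq_bigr => i _; rewrite linearZ.
Qed.

Lemma tensE U V (u : U) (v : V) i j :
  (tens u v : 'M_(_, _)) i j = v2r u 0 i * v2r v 0 j.
Proof. by rewrite mxE big_ord1 mxE. Qed.

Lemma tens_linearl U V (v : V) : linear (fun u : U => tens u v).
Proof.
move=> a u u'; apply/matrixP => i j.
by rewrite tensE linearP /= !mxE !big_ord1 !mxE mulrDl mulrA.
Qed.

Lemma tens_linearr U V (u : U) : linear (tens u : V -> _).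
Proof.
move=> a v v'; apply/matrixP => i j.
by rewrite tensE linearP /= !mxE !big_ord1 !mxE mulrDr mulrCA.
Qed.

Lemma tlift_is_linear U V W (f : U -> V -> W) : linear (tlift f).
Proof.
move=> a s t; rewrite /tlift scaler_sumr -big_split; apply: eq_bigr => i _ /=.
rewrite scaler_sumr -big_split; apply: eq_bigr => j _ /=.
by rewrite !mxE scalerDl scalerA.
Qed.
HB.instance Definition _ U V W (f : U -> V -> W) :=
  GRing.isLinear.Build k (tensor U V) W _ (tlift f) (tlift_is_linear f).

Lemma tlift_comp U V W X (g : {linear W -> X}) (f : U -> V -> W) t :
  g (tlift f t) = tlift (fun u v => g (f u v)) t.
Proof.
rewrite /tlift linear_sum; apply: eq_bigr => i _.
by rewrite linear_sum; apply: eq_bigr => j _; rewrite linearZ.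
Qed.

Lemma eq_tlift U V W (f g : U -> V -> W) :
  (forall u v, f u v = g u v) -> tlift f =1 tlift g.
Proof.
by move=> e t; apply: eq_bigr => i _; apply: eq_bigr => j _; rewrite e.
Qed.

Lemma linear_vbase U W (g : U -> W) (u : U) :
  linear g -> g u = \sum_i v2r u 0 i *: g (vbase i).
Proof.
move=> lg; pose gl := HB.pack_for {linear U -> W} g
  (GRing.isLinear.Build k U W _ g lg).
rewrite [in LHS](vbase_sum u) -[LHS]/(gl _) linear_sum.
by apply: eq_bigr => i _; rewrite linearZ.
Qed.

Lemma tlift_tens U V W (f : U -> V -> W) (u : U) (v : V) :
    (forall v, linear (fun u => f u v)) -> (forall u, linear (f u)) ->
  tlift f (tens u v) = f u v.
Proof.
move=> lf rf; rewrite (linear_vbase u (lf v)); apply: eq_bigr => i _.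
rewrite (linear_vbase v (rf _)) scaler_sumr; apply: eq_bigr => j _.
by rewrite scalerA tensE.
Qed.

Lemma tens_ext U V (t : tensor U V) : t = tlift (@tens U V) t.
Proof.
apply/matrixP => i j; rewrite summxE (bigD1 i) //= [X in _ + X]big1 ?addr0.
  rewrite summxE (bigD1 j) //= big1 ?addr0.
    by rewrite mxE tensE !r2vK !mxE !eqxx !mulr1.
  move=> j' /negPf j'j; rewrite mxE tensE !r2vK !mxE !eqxx /= (eq_sym j) j'j.
  by rewrite !mulr0.
move=> i' /negPf i'i; rewrite summxE big1 // => j' _.
by rewrite mxE tensE !r2vK !mxE !eqxx /= (eq_sym i) i'i mul0r mulr0.
Qed.

Lemma tmap_tens U V U' V' (f : {linear U -> U'}) (g : {linear V -> V'}) u v :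
  tmap f g (tens u v) = tens (f u) (g v).
Proof.
by rewrite [LHS](tlift_tens (f := fun u v => tens (f u) (g v))) //
  => [w|w] a x y; rewrite linearP (tens_linearl, tens_linearr).
Qed.

Lemma tswap_tens U V (u : U) (v : V) : tswap (tens u v) = tens v u.
Proof.
by rewrite [LHS](tlift_tens (f := fun u v => tens v u)) //
  => [w|w] a x y; rewrite (tens_linearl, tens_linearr).
Qed.

End Tensor.

(* The product of the algebra A (x) A: (a (x) b) (c (x) d) = ac (x) bd. *)
Definition tens_mul (k : fieldType) (A : falgType k) (s t : tensor A A) :
    tensor A A :=
  tlift (fun a b => tlift (fun c d => tens (a * c) (b * d)) t) s.

Lemma tens_mul_tens (k : fieldType) (A : falgType k) (a b c d : A) :
  tens_mul (tens a b) (tens c d) = tens (a * c) (b * d).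
Proof.
pose f a b (t : tensor A A) := tlift (fun c d => tens (a * c) (b * d)) t.
have fE x y : f x y (tens c d) = tens (x * c) (y * d).
  by rewrite [LHS](tlift_tens (f := fun c d => tens (x * c) (y * d))) //
    => [w|w] e r s; rewrite mulrDr -scalerAr (tens_linearl, tens_linearr).
rewrite [LHS](tlift_tens (f := fun a b => f a b (tens c d))) //
  => [w|w] e r s; rewrite !fE mulrDl -scalerAl.
  exact: tens_linearl.
exact: tens_linearr.
Qed.

(* A finite group scheme over k is given by its coordinate ring k[G], a
   finite-dimensional commutative Hopf algebra. *)
Record finGroupScheme (k : fieldType) := FinGroupScheme {
  coord :> falgType k;
  coordC : commutative ( *%R : coord -> coord -> coord);
  comul : {linear coord -> tensor coord coord};
  counit : {lrmorphism coord -> k^o};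
  antipode : {linear coord -> coord};
  comul1 : comul 1 = tens 1 1;
  comulM : forall a b : coord, comul (a * b) = tens_mul (comul a) (comul b);
  comulA : forall a : coord,
    tassoc (tmap comul id (comul a)) = tmap id comul (comul a);
  counitl : forall a : coord, tlift (fun b c => counit b *: c) (comul a) = a;
  counitr : forall a : coord, tlift (fun b c => counit c *: b) (comul a) = a;
  antipodel : forall a : coord,
    tlift (fun b c => antipode b * c) (comul a) = (counit a)%:A;
  antipoder : forall a : coord,
    tlift (fun b c => b * antipode c) (comul a) = (counit a)%:A
}.

(* The algebra of measures kG = k[G]^*: the dual space, with the convolution
   product (u v)(a) = (u (x) v)(comul a) and unit the counit of k[G]. *)
Section Measures.
Variables (k : fieldType) (G : finGroupScheme k).

Definition measure : Type := 'Hom(coord G, k^o).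
HB.instance Definition _ := Vector.copy measure 'Hom(coord G, k^o).

Implicit Types u v w : measure.

Definition measure_ev u : coord G -> k^o := fun_of_lfun u.

Definition convol u v : measure :=
  linfun (tlift (fun a b => measure_ev u a * measure_ev v b) \o comul G).

Definition convol1 : measure := linfun (counit G).

Lemma measureP u v : measure_ev u =1 measure_ev v -> u = v.
Proof. by move=> e; apply/lfunP. Qed.

Lemma convolE u v a : measure_ev (convol u v) a =
  tlift (fun b c => measure_ev u b * measure_ev v c) (comul G a).
Proof. by rewrite /measure_ev lfunE. Qed.

Lemma convol1E a : measure_ev convol1 a = counit G a.
Proof. by rewrite /measure_ev lfunE. Qed.

HB.instance Definition _ u := GRing.Linear.copy (measure_ev u) (fun_of_lfun u).

Lemma convolA : associative convol.
Proof.
move=> u v w; apply: measureP => a; rewrite !convolE.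
pose M x (t : tensor G G) : k^o := measure_ev u x *
  tlift (fun b c => measure_ev v b * measure_ev w c) t.
have Ml t : linear (M^~ t).
  by move=> c x y; rewrite /M linearP mulrDl scalerAl.
have Mr x : linear (M x).
  by move=> c s t; rewrite /M linearP mulrDr scalerAr.
have := congr1 (tlift M) (comulA a); rewrite /tmap /tassoc !tlift_comp => e.
transitivity (tlift (fun x y => tlift M (tens x (comul G y))) (comul G a)).
  by apply: eq_tlift => x y; rewrite tlift_tens // convolE.
rewrite -e; apply: eq_tlift => x y.
pose N (t : tensor G G) z : tensor G (tensor G G) :=
  tlift (fun b c => tens b (tens c z)) t.
have Nl z : linear (N^~ z) by move=> c s t; rewrite /N linearP.
have Nr t : linear (N t).
  move=> c z z'; rewrite /N /tlift scaler_sumr -big_split; apply: eq_bigr => i _ /=.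
  rewrite scaler_sumr -big_split; apply: eq_bigr => j _ /=.
  by rewrite !tens_linearr scalerDr !scalerA mulrC.
transitivity (tlift M (N (comul G x) y)).
  apply: (tlift_tens (f := fun t z => tlift M (N t z))) => [z|t] c r r'.
    by rewrite Nl linearP.
  by rewrite Nr linearP.
have -> c : measure_ev (convol u v) x * c =
    tlift (fun b d => measure_ev u b * measure_ev v d * c : k^o) (comul G x).
  rewrite convolE /tlift mulr_suml; apply: eq_bigr => i _.
  by rewrite mulr_suml; apply: eq_bigr => j _; rewrite -scalerAl.
rewrite /N tlift_comp; apply: eq_tlift => b c.
rewrite [LHS](tlift_tens (f := M)) // /M tlift_tens ?mulrA // => d r s z.
  by rewrite linearP mulrDl scalerAl.
by rewrite linearP mulrDr scalerAr.
Qed.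

Lemma convol1l : left_id convol1 convol.
Proof.
move=> u; apply: measureP => a; rewrite convolE.
rewrite -[in RHS](counitl a) tlift_comp; apply: eq_tlift => b c.
by rewrite convol1E linearZ.
Qed.

Lemma convol1r : right_id convol1 convol.
Proof.
move=> u; apply: measureP => a; rewrite convolE.
rewrite -[in RHS](counitr a) tlift_comp; apply: eq_tlift => b c.
by rewrite convol1E linearZ mulrC.
Qed.

Lemma measure_evD u v a : measure_ev (u + v) a = measure_ev u a + measure_ev v a.
Proof. exact: add_lfunE. Qed.

Lemma measure_evZ c u a : measure_ev (c *: u) a = c *: measure_ev u a.
Proof. exact: scale_lfunE. Qed.

Lemma convolDl : left_distributive convol +%R.
Proof.
move=> u v w; apply: measureP => a; rewrite measure_evD !convolE /tlift.
rewrite -big_split; apply: eq_bigr => i _; rewrite -big_split.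
by apply: eq_bigr => j _; rewrite measure_evD mulrDl scalerDr.
Qed.

Lemma convolDr : right_distributive convol +%R.
Proof.
move=> u v w; apply: measureP => a; rewrite measure_evD !convolE /tlift.
rewrite -big_split; apply: eq_bigr => i _; rewrite -big_split.
by apply: eq_bigr => j _; rewrite measure_evD mulrDr scalerDr.
Qed.

Lemma convol1_neq0 : convol1 != 0.
Proof.
apply/eqP => /(congr1 (measure_ev^~ 1)); rewrite convol1E rmorph1.
by rewrite /measure_ev zero_lfunE => /eqP; rewrite oner_eq0.
Qed.

HB.instance Definition _ := GRing.Zmodule_isNzRing.Build measure
  convolA convol1l convol1r convolDl convolDr convol1_neq0.

Lemma convolZl c u v : c *: (u * v) = (c *: u) * v.
Proof.
apply: measureP => a; rewrite measure_evZ !convolE /tlift scaler_sumr.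
apply: eq_bigr => i _; rewrite scaler_sumr; apply: eq_bigr => j _.
by rewrite measure_evZ -scalerAl !scalerA [c * _]mulrC.
Qed.
HB.instance Definition _ := GRing.Lmodule_isLalgebra.Build k measure convolZl.

Lemma convolZr c u v : c *: (u * v) = u * (c *: v).
Proof.
apply: measureP => a; rewrite measure_evZ !convolE /tlift scaler_sumr.
apply: eq_bigr => i _; rewrite scaler_sumr; apply: eq_bigr => j _.
by rewrite measure_evZ -scalerAr !scalerA [c * _]mulrC.
Qed.
HB.instance Definition _ := GRing.Lalgebra_isAlgebra.Build k measure convolZr.
HB.instance Definition _ := Algebra_isFalgebra.Build k measure.

End Measures.

Arguments measure {k} G.

(* Finite-dimensional left modules over a k-algebra. *)
Record fdmod (k : fieldType) (A : algType k) := Fdmod {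
  fdmod_sort :> vectType k;
  act : {linear A -> 'End(fdmod_sort)};
  act1 : act 1 = \1%VF;
  actM : forall a b : A, act (a * b) = (act a \o act b)%VF
}.

(* M as a module over the ring A, rather than over k. *)
Definition lmod (k : fieldType) (A : algType k) (M : fdmod A) : Type := M.

Section Lmod.
Variables (k : fieldType) (A : algType k) (M : fdmod A).

HB.instance Definition _ := GRing.Zmodule.copy (lmod M) (fdmod_sort M).

Definition lmod_scale (a : A) (m : lmod M) : lmod M := act M a m.

Fact lmod_scaleA a b m : lmod_scale a (lmod_scale b m) = lmod_scale (a * b) m.
Proof. by rewrite /lmod_scale actM comp_lfunE. Qed.

Fact lmod_scale1 : left_id 1 lmod_scale.
Proof. by move=> m; rewrite /lmod_scale act1 id_lfunE. Qed.

Fact lmod_scaleDr : right_distributive lmod_scale +%R.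
Proof. by move=> a m n; rewrite /lmod_scale linearD. Qed.

Fact lmod_scaleDl m : {morph lmod_scale^~ m : a b / a + b}.
Proof. by move=> a b; rewrite /lmod_scale linearD add_lfunE. Qed.

HB.instance Definition _ := GRing.Zmodule_isLmodule.Build A (lmod M)
  lmod_scaleA lmod_scale1 lmod_scaleDr lmod_scaleDl.

End Lmod.

(* The left regular module A. *)
Fact regmod_actM (k : fieldType) (A : falgType k) (a b : A) :
  amull (a * b) = (amull a \o amull b)%VF.
Proof. by apply/lfunP => c; rewrite comp_lfunE !lfunE /= mulrA. Qed.

Definition regmod (k : fieldType) (A : falgType k) : fdmod A :=
  @Fdmod k A A (@amull k A) (@amull1 k A) (@regmod_actM k A).

Section Pullback.
Variables (k : fieldType) (A B : algType k).
Variables (f : {lrmorphism B -> A}) (M : fdmod A).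

Fact pullback_act1 : act M (f 1) = \1%VF.
Proof. by rewrite rmorph1 act1. Qed.

Fact pullback_actM a b :
  act M (f (a * b)) = (act M (f a) \o act M (f b))%VF.
Proof. by rewrite rmorphM actM. Qed.

Definition pullback : fdmod B :=
  @Fdmod k B M (act M \o f) pullback_act1 pullback_actM.

End Pullback.

(* Projectivity, by the lifting property against arbitrary (not only finite-
   dimensional) modules. *)
Definition projective (R : nzRingType) (P : lmodType R) : Prop :=
  forall (X Y : lmodType R) (g : {linear X -> Y}) (f : {linear P -> Y}),
    (forall y, exists x, g x = y) ->
    exists h : {linear P -> X}, forall m, g (h m) = f m.

Definition proj_fdmod (k : fieldType) (A : algType k) (M : fdmod A) : Prop :=
  projective (lmod M).

Section GroupSchemes.
Variable k : fieldType.

Definition gmod (G : finGroupScheme k) := fdmod (measure G).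

(* A (closed) subgroup scheme of G, given by its own coordinate ring and the
   restriction homomorphism k[G] -> k[U], a surjection of Hopf algebras. *)
Record subgroupScheme (G : finGroupScheme k) := SubgroupScheme {
  sub_scheme :> finGroupScheme k;
  res : {lrmorphism coord G -> coord sub_scheme};
  res_surj : forall b : sub_scheme, exists a : G, res a = b;
  res_comul : forall a : G, comul sub_scheme (res a) = tmap res res (comul G a);
  res_counit : forall a : G, counit sub_scheme (res a) = counit G a
}.

(* The embedding kU -> kG, dual to the restriction k[G] -> k[U]. *)
Definition measure_incl (G : finGroupScheme k) (U : subgroupScheme G)
    (u : measure U) : measure G :=
  ((u : 'Hom(_, _)) \o linfun (res U))%VF.

(* Commutativity of the group law is cocommutativity of k[G]. *)
Definition abelian_scheme (G : finGroupScheme k) : Prop :=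
  forall a : G, tswap (comul G a) = comul G a.

(* Every nonzero module has a nonzero fixed vector; here u acts on a fixed
   vector as the scalar u(1), the value at u of the counit of kG. *)
Definition unipotent_scheme (G : finGroupScheme k) : Prop :=
  forall M : gmod G, (exists m : M, m != 0) ->
  exists2 m : M, m != 0 & forall u : measure G, act M u m = measure_ev u 1 *: m.

Definition is_au_subgroup (G : finGroupScheme k) (U : subgroupScheme G) :=
  abelian_scheme U /\ unipotent_scheme U.

End GroupSchemes.

(* The maximum of S, and 0 if S is empty or unbounded. *)
Definition natmax (S : set nat) : nat :=
  xget 0%N [set n | S n /\ forall m, S m -> (m <= n)%N].

(* Krull dimension of a space given by its family of closed sets: a chain of n
   irreducible closed sets has length n - 1, and the empty chain always exists,
   so that the empty space gets dimension -1. *)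
Section Dimension.
Local Open Scope classical_set_scope.
Variables (T : Type) (closed : set (set T)).

Definition irreducible_set (Z : set T) : Prop :=
  Z !=set0 /\ forall A B, closed A -> closed B ->
    Z `<=` A `|` B -> Z `<=` A \/ Z `<=` B.

Definition irr_chain (n : nat) (c : 'I_n -> set T) : Prop :=
  (forall i, closed (c i) /\ irreducible_set (c i)) /\
  (forall i j : 'I_n, (i < j)%N -> c i `<` c j).

Definition topdim : int :=
  (natmax [set n | exists c : 'I_n -> set T, irr_chain c])%:Z - 1.

End Dimension.

Section PPoints.
Local Open Scope classical_set_scope.
Variables (k : fieldType) (p : nat).

(* k[T]/(T^p), provided that p > 0: [{poly %/ 1}] would be k[T]/(T). *)
Definition trunc_poly := {poly %/ ('X^p : {poly k})}.
HB.instance Definition _ := GRing.ComAlgebra.on trunc_poly.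

Definition trunc_t : trunc_poly := 'qX.

Section OneGroup.
Variable G : finGroupScheme k.

Record ppoint := PPoint {
  ppoint_hom :> {lrmorphism trunc_poly -> measure G};
  ppoint_proj : proj_fdmod (pullback ppoint_hom (regmod (measure G)));
  ppoint_factor : exists U : subgroupScheme G, is_au_subgroup U /\
    forall a, exists u : measure U, ppoint_hom a = measure_incl u
}.

Definition ppoint_equiv (a b : ppoint) : Prop :=
  forall N : gmod G, proj_fdmod (pullback a N) <-> proj_fdmod (pullback b N).

Definition ppoint_class (a : ppoint) : set ppoint := [set b | ppoint_equiv a b].

Definition Pspace : Type := {c : set ppoint | exists a, c = ppoint_class a}.

Definition Psupp (N : gmod G) : set Pspace :=
  [set c | exists a, sval c = ppoint_class a /\ ~ proj_fdmod (pullback a N)].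

Definition Pclosed : set (set Pspace) := fun Z => exists N, Z = Psupp N.

Definition dimP : int := topdim Pclosed.

Definition oprank (M : gmod G) (a : ppoint) : nat :=
  \dim (limg (act M (a trunc_t))).

Definition rk (M : gmod G) : nat := natmax (range (oprank M)).

Definition constant_rank (M : gmod G) : Prop :=
  forall a : ppoint, oprank M a = rk M.

End OneGroup.

Definition rk_au (G : finGroupScheme k) : nat :=
  natmax [set n | exists U : subgroupScheme G,
                    is_au_subgroup U /\ n%:Z = dimP U + 1].

End PPoints.

(* Main.v *)
(* A p-point of an abelian unipotent subgroup U is determined up to equivalence by
   a line in the span of elements y_1, ..., y_n of kU: kU is generated by x_1, ...,
   x_n subject to x_i^(p^f_i) = 0, y_i = x_i^(p^(f_i - 1)), every u with u^p = 0 is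
   a sum of multiples w_i y_i, and perturbing w_i by a nilpotent does not change
   projectivity.  Projectivity of N at such an element x is the exactness
   ker x = im x^(p-1) on N.

   Closed sets of P(U) give subsets of k^n, and homogeneous functions vanish on
   them compatibly with irreducibility, because every hypersurface is the support
   of a module (an extension of powers of the augmentation ideal and of k).  Hence
   a chain of r irreducible closed sets has r <= n by comparing Hilbert functions,
   and rk_au <= n for a suitable U.

   For l in k^n nonzero, kG is free over k[x_l], x_l = sum l_i y_i, so that x_l is a
   p-point of G and acts on M with rank rk(M).  The x_l act by commuting nilpotent
   operators depending linearly on l; if dim M <= n and the rank is constant on
   nonzero l, all of them vanish (induction on a subspace X of M modulo which one
   works, with a dimension count for functionals phi o A_l). *)

Require Import Defs.
From HB Require Import structures.
From mathcomp Require Import all_boot all_order all_algebra all_field.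
From mathcomp Require Import boolp classical_sets.

Set Implicit Arguments.
Unset Strict Implicit.
Unset Printing Implicit Defensive.

Import GRing.Theory VectorInternalTheory.
Local Open Scope ring_scope.

(** Three obstacles shape the development. Since closed sets are supports of modules, bounding dim
    P(U) needs modules with prescribed support. Exactness at x_l of an extension of I^N by k^N, I
    the augmentation ideal, is invertibility of a Frobenius-twisted linear pencil, so a form g must
    first be encoded in the determinant of a linear pencil. This is possible only together with an
    auxiliary linear form h; the locus obtained is hg = 0, and h is chosen so as not to vanish at
    the points in question. The truncated presentation of kU comes from derivations. As kU is
    commutative, it is the coordinate ring of the Cartier dual of U; primitive elements of k[U] act
    on kU as invariant vector fields, which realise every functional on the cotangent space. They
    show that the top monomial in well chosen generators is nonzero. Freeness of kG over k[x_l]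
    enters as exactness of x_l on kG. It is carried over from kU through functions on G averaged by
    an integral L of kU: the constant 1 is such an average. *)

(** * Constant rank for linear spaces of commuting nilpotent operators *)

Section VectorGeneralities.
Variable k : fieldType.
Implicit Types V W : vectType k.

(** A subspace of maximal dimension contained in [P] is all of [P], since a further vector of [P]
    would enlarge it. *)
Lemma vspace_of_pred V (P : V -> Prop) :
    P 0 -> (forall a u v, P u -> P v -> P (a *: u + v)) ->
  exists U : {vspace V}, forall u, u \in U <-> P u.
Proof.
move=> P0 PD.
pose S n := `[< exists U : {vspace V}, \dim U = n /\ forall u, u \in U -> P u >].
have ex : exists n, S n.
  exists 0%N; apply/asboolP; exists 0%VS; split; first exact: dimv0.
  by move=> u; rewrite memv0 => /eqP ->.
have bnd n : S n -> (n <= \dim {:V})%N.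
  by move=> /asboolP[U [<- _]]; rewrite dimvS ?subvf.
case: (ex_maxnP ex bnd) => n /asboolP[U [dU UP]] nmax; exists U => u; split; first exact: UP.
move=> Pu; case: (boolP (u \in U)) => // uU; exfalso.
have : S (\dim (<[u]> + U)).
  apply/asboolP; exists (<[u]> + U)%VS; split=> // w /memv_addP[x /vlineP[a ->] [y yU ->]].
  by apply: PD => //; apply: UP.
move=> /nmax; rewrite leqNgt => /negP; apply.
rewrite dimv_disjoint_sum ?dim_vline; last first.
  apply/eqP; rewrite -subv0; apply/subvP => w /memv_capP[/vlineP[a ->] aU].
  have [->|a0] := eqVneq a 0; first by rewrite scale0r mem0v.
  by case/negP: uU; rewrite -[u](scalerK a0) memvZ.
by rewrite dU; case: eqP uU => [->|//]; rewrite mem0v.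
Qed.

Lemma functional_separating V (X : {vspace V}) y : y \notin X ->
  exists2 phi : 'Hom(V, k^o), (X <= lker phi)%VS & phi y = 1.
Proof.
move=> yX; pose c m := m - projv X m.
have cl : linear c by move=> a u v; rewrite /c linearP scalerBr opprD addrACA.
pose cL := HB.pack_for {linear V -> V} c (GRing.isLinear.Build k V V _ c cl).
have cX m : c m \in (X^C)%VS by apply: memv_projC.
have : c y != 0.
  by apply: contra yX; rewrite /c subr_eq0 => /eqP ->; apply: memv_proj.
rewrite (coord_vbasis (cX y)) => /eqP ne0.
have [i ci] : exists i, coord (vbasis X^C) i (c y) != 0.
  apply/existsP; apply: contraT; rewrite negb_exists => /forallP h.
  by case: ne0; apply: big1 => i _; move: (h i); rewrite negbK => /eqP ->; rewrite scale0r.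
pose f (m : V) : k^o := (coord (vbasis X^C) i (c y))^-1 *: (coord (vbasis X^C) i (cL m) : k^o).
have fl : linear f.
  by move=> a u v; rewrite /f linearP linearP scalerDr !scalerA mulrC.
pose fL := HB.pack_for {linear V -> k^o} f (GRing.isLinear.Build k V k^o _ f fl).
exists (linfun fL).
  apply/subvP => x xX; rewrite memv_ker lfunE /= /f /=.
  have -> : c x = 0 by rewrite /c projv_id ?subrr.
  by rewrite linear0 scaler0.
by rewrite lfunE /= /f /= -[_ *: _]/(_ * _) mulVf.
Qed.

(** [F] embeds [L] into the functionals vanishing on [X], and such a functional is determined by its
    values on a complement of [X]. *)
Lemma annihilator_dim V W (F : 'Hom(W, 'Hom(V, k^o))) (L : {vspace W}) (X : {vspace V}) :
    (forall l, l \in L -> (X <= lker (F l))%VS) ->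
    (forall l, l \in L -> F l = 0 -> l = 0) ->
  (\dim L + \dim X <= \dim {:V})%N.
Proof.
move=> FX Finj.
have dX := dimv_compl X.
have dXle : (\dim X <= \dim {:V})%N by rewrite dimvS ?subvf.
suff : (\dim L <= \dim X^C)%N by rewrite dX -(leq_add2r (\dim X)) subnK.
pose n := \dim (X^C)%VS; pose b := vbasis (X^C)%VS.
pose ev (l : W) : 'rV[k]_n := \row_i F l b`_i.
have evl : linear ev.
  by move=> a u v; apply/rowP => i; rewrite !mxE linearP add_lfunE scale_lfunE.
pose evL := HB.pack_for {linear W -> 'rV[k]_n} ev (GRing.isLinear.Build k W _ _ ev evl).
rewrite -(@limg_dim_eq _ _ _ (linfun evL)).
  by apply: leq_trans (dimvS (subvf _)) _; rewrite dimvf /dim /= mul1n.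
apply/eqP; rewrite -subv0; apply/subvP => l /memv_capP[lL]; rewrite memv_ker memv0 lfunE /=.
move=> /eqP e0; apply/eqP/Finj => //; apply/lfunP => v; rewrite zero_lfunE.
have /memv_addP[x xX [y yX ->]] : v \in (X + X^C)%VS by rewrite addv_complf memvf.
rewrite linearD /= (eqP (_ : F l x == 0)) ?add0r; last first.
  by rewrite -memv_ker (subvP (FX _ lL)).
rewrite (coord_vbasis yX) linear_sum big1 // => i _; rewrite linearZ /=.
by move/rowP: e0 => /(_ i); rewrite !mxE => ->; rewrite scaler0.
Qed.

End VectorGeneralities.

Section ConstantRank.
Variable k : closedFieldType.
Implicit Types V M W : vectType k.

Lemma nonzero_nonroot (q : {poly k}) : q != 0 -> exists2 t : k, t != 0 & ~~ root q t.
Proof.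
move=> q0; have : q * 'X != 0 by rewrite mulf_neq0 ?polyX_eq0.
move=> /closed_nonrootP[t].
by rewrite rootM negb_or rootX => /andP[qt t0]; exists t.
Qed.

(* [1 + t E] is singular only when [- t^-1] is an eigenvalue of [E]. *)
Lemma perturbed_id_injective V (E : 'End(V)) :
  exists2 t : k, t != 0 & forall v, v + t *: E v = 0 -> v = 0.
Proof.
pose A : 'M[k]_(dim V) := lin1_mx (v2r \o E \o r2v).
have [s s0 sA] := nonzero_nonroot (monic_neq0 (char_poly_monic (- A))).
exists s^-1; first by rewrite invr_eq0.
move=> v ev; apply/eqP; apply: contraNT sA => v0.
rewrite -eigenvalue_root_char; apply/eigenvalueP.
have v20 : v2r v != 0 by rewrite -(linear0 v2r) (inj_eq (can_inj v2rK)).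
exists (v2r v) => //.
rewrite mulmxN mul_rV_lin1 /= v2rK -linearN -linearZ /=; congr v2r.
by rewrite -[RHS]subr0 -(scaler0 _ s) -ev scalerDr scalerA mulfV // scale1r opprD addNKr.
Qed.

(** Work modulo [X], and let [K] be a complement of the kernel of [a']. Since [a'] kills [z] and
    [b' z] is outside its image, the map [L0] equal to [a'] on [K] and to [b'] on [z] is injective,
    of rank one more than [a']. After rescaling [z] by [t^-1], the map [a' + t *: b'] on [K + <[z]>]
    is [L0] plus [t] times a fixed operator, which stays injective for some nonzero [t]. *)
Lemma rank_increase V M (a b : 'Hom(V, M)) (X : {vspace M}) z :
    a z \in X -> b z \notin (limg a + X)%VS ->
  exists2 t : k, t != 0 & (\dim (limg a + X) < \dim (limg (a + t *: b)%R + X))%N.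
Proof.
move=> az bz.
pose q : 'End(M) := (\1 - projv X)%VF.
have qE m : q m = m - projv X m by rewrite add_lfunE id_lfunE opp_lfunE.
have q0 m : q m = 0 -> m \in X by rewrite qE => /eqP; rewrite subr_eq0 => /eqP ->; apply: memv_proj.
have qX m : m \in X -> q m = 0 by move=> mX; rewrite qE projv_id ?subrr.
have dimq U : \dim (U + X) = (\dim (q @: U) + \dim X)%N.
  rewrite -(limg_ker_dim q (U + X)) addnC; congr (_ + _)%N.
    congr (\dim _); rewrite limgD; apply/addv_idPl.
    by apply/subvP => ? /memv_imgP[x xX ->]; rewrite qX ?mem0v.
  congr (\dim _); apply/eqP; rewrite eqEsubv; apply/andP; split; apply/subvP => m.
    by move=> /memv_capP[_]; rewrite memv_ker => /eqP /q0.
  by move=> mX; rewrite memv_cap memv_ker qX // eqxx andbT (subvP (addvSr _ _)).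
pose a' := (q \o a)%VF; pose b' := (q \o b)%VF.
have a'z : a' z = 0 by rewrite comp_lfunE qX.
have b'z : b' z \notin limg a'.
  apply: contra bz => /memv_imgP[v _]; rewrite !comp_lfunE => e.
  rewrite -[b z](subrK (a v)) addrC memv_add ?memv_img ?memvf //.
  by apply: q0; rewrite linearB /= e subrr.
suff [t t0 ht] : exists2 t : k, t != 0 & (\dim (limg a') < \dim (limg (a' + t *: b')%R))%N.
  exists t => //; rewrite !dimq ltn_add2r.
  have -> : (q @: limg (a + t *: b)%R = limg (a' + t *: b')%R)%VS.
    by rewrite -limg_comp comp_lfunDr -comp_lfunZr.
  by rewrite -limg_comp.
pose K := (fullv :\: lker a')%VS.
have imK : limg a' = (a' @: K)%VS by rewrite -limg_ker_compl.
have Kz : (K :&: <[z]> = 0)%VS.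
  apply/eqP; rewrite -subv0; apply/subvP => v /memv_capP[vK vz].
  rewrite -(capv_diff fullv (lker a')) memv_cap vK memv_ker.
  by have /vlineP[c ->] := vz; rewrite linearZ /= a'z scaler0 eqxx.
pose U := (K + <[z]>)%VS.
pose pK := daddv_pi K <[z]>; pose pz := daddv_pi <[z]> K.
pose L0 : 'Hom(V, M) := ((a' \o pK) + (b' \o pz))%VF.
have pU u : u \in U -> pK u + pz u = u by move=> uU; apply: daddv_pi_add.
have pKK u : pK u \in K by apply: memv_pi.
have pzz u : exists c, pz u = c *: z by apply/vlineP/memv_pi.
have z0 : z != 0 by apply: contraNneq b'z => ->; rewrite linear0 mem0v.
have L0E u : L0 u = a' (pK u) + b' (pz u) by rewrite /L0 add_lfunE !comp_lfunE.
have L0inj u : u \in U -> L0 u = 0 -> u = 0.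
  move=> uU; rewrite L0E; have [c ec] := pzz u; rewrite ec.
  have [c0|c0] := eqVneq c 0.
    rewrite c0 scale0r linear0 addr0 => e; rewrite -(pU u uU) ec c0 scale0r addr0.
    apply/eqP; rewrite -memv0 -(capv_diff fullv (lker a')) memv_cap pKK memv_ker.
    by rewrite e eqxx.
  move=> e; case/negP: b'z; apply/memv_imgP; exists (- c^-1 *: pK u); rewrite ?memvf //.
  apply: (scalerI c0); rewrite linearZ /= scalerA mulrN mulfV // scaleN1r.
  by apply/eqP; rewrite -addr_eq0 addrC -linearZ /= e.
pose L0' : 'Hom(V, M) := (L0 \o projv U)%VF.
pose R : 'Hom(M, V) := (projv U \o L0'^-1)%VF.
have RK u : u \in U -> R (L0 u) = u.
  move=> uU; apply/eqP; rewrite -subr_eq0; apply/eqP.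
  have L0'u : L0' u = L0 u by rewrite /L0' comp_lfunE projv_id.
  apply: L0inj; first by rewrite /R comp_lfunE memvB ?memv_proj.
  have e : L0' (L0'^-1%VF (L0' u)) = L0' u by rewrite limg_lfunVK ?memv_img ?memvf.
  rewrite L0'u in e.
  by rewrite linearB /= /R comp_lfunE -[L0 (projv _ _)]comp_lfunE -/L0' e subrr.
(* [R] is a left inverse of [L0] on [U], so that composing the perturbed map with [R] gives the
   identity plus [t] times an endomorphism. *)
have [t t0 tP] := perturbed_id_injective (R \o b' \o pK)%VF.
exists t => //.
pose Lt : 'Hom(V, M) := (L0 + t *: (b' \o pK))%VF.
have LtE u : Lt u = L0 u + t *: b' (pK u) by rewrite /Lt add_lfunE scale_lfunE comp_lfunE.
have /limg_dim_eq dLt : (U :&: lker Lt = 0)%VS.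
  apply/eqP; rewrite -subv0; apply/subvP => u /memv_capP[uU].
  rewrite memv_ker memv0 LtE => /eqP /(congr1 R).
  rewrite linear0 linearD linearZ /= RK // => e; apply/eqP/tP.
  by rewrite comp_lfunE [(R \o _)%VF _]comp_lfunE.
have dU : \dim U = (\dim (limg a')).+1.
  rewrite dimv_disjoint_sum // dim_vline z0 addn1; congr _.+1.
  by rewrite imK limg_dim_eq // capv_diff.
rewrite -dU -dLt; apply/dimvS/subvP => w /memv_imgP[u uU ->].
have [c ec] := pzz u.
apply/memv_imgP; exists (pK u + (t^-1 * c) *: z); rewrite ?memvf //.
rewrite LtE L0E add_lfunE scale_lfunE ec !linearD !linearZ /= a'z scaler0 addr0.
by rewrite scalerA mulrAC mulVf // mul1r -addrA [X in _ + X]addrC.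
Qed.

(** Commuting nilpotent operators on a nonzero quotient have a common kernel. To a vector that
    serves for the other operators, apply [b] as often as possible without entering [S]; by
    commutation the others still send the result into [S]. *)
Lemma common_annihilated_vector (M : vectType k) (As : seq 'End(M)) (S : {vspace M}) :
    {in As &, forall a b : 'End(M), forall m, a (b m) = b (a m)} ->
    (forall a, a \in As -> exists N, forall m, iter N a m = 0) ->
    (forall a, a \in As -> (a @: S <= S)%VS) -> ~~ (fullv <= S)%VS ->
  exists2 x, x \notin S & forall a, a \in As -> a x \in S.
Proof.
elim: As => [_ _ _ /subvPn[x _ xS]|b As IH comm nil stab S1]; first by exists x.
have bS i m : m \in S -> iter i b m \in S.
  by elim: i => //= i IHi /IHi h; rewrite (subvP (stab b _)) ?mem_head ?memv_img.
have [||||x xS xAs] // := IH _.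
- by move=> a c aA cA; apply: comm; rewrite inE ?aA ?cA orbT.
- by move=> a aA; apply: nil; rewrite inE aA orbT.
- by move=> a aA; apply: stab; rewrite inE aA orbT.
have [N bN] := nil b (mem_head _ _).
have ex : exists i, iter i b x \in S by exists N; rewrite bN mem0v.
case: (ex_minnP ex) => -[|i]; first by rewrite /= (negPf xS).
move=> iS imin; exists (iter i b x).
  by apply/negP => /imin; rewrite ltnn.
move=> a; rewrite inE => /predU1P[->//|aA].
have -> : a (iter i b x) = iter i b (a x).
  elim: (i) => //= j <-; apply: comm; rewrite !inE ?eqxx ?aA ?orbT //.
exact/bS/xAs.
Qed.

Section Relative.
Variables (M W : vectType k) (A : 'Hom(W, 'End(M))).
Hypothesis Acomm : forall l l' m, A l (A l' m) = A l' (A l m).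
Hypothesis Anil : forall l, exists N, forall m, iter N (A l) m = 0.

(* The statement for [M / X], phrased inside [M] so that the induction does not
   change the ambient spaces. *)
Lemma constant_rank_relative n (X : {vspace M}) (L : {vspace W}) c :
    (forall l, l \in L -> (A l @: X <= X)%VS) ->
    (\dim {:M} <= \dim L + \dim X)%N -> (\dim {:M} < n + \dim X)%N ->
    (forall l, l \in L -> l != 0 -> \dim (limg (A l) + X) = (c + \dim X)%N) ->
  forall l, l \in L -> (limg (A l) <= X)%VS.
Proof.
elim: n X L c => [|n IH] X L c stab dimL dimn rankA.
  by move: dimn; rewrite add0n ltnNge dimvS ?subvf.
have [S SP] : exists S : {vspace M}, forall m,
    m \in S <-> forall l, l \in L -> A l m \in X.
  apply: vspace_of_pred => [l _|a u v Pu Pv l lL]; first by rewrite linear0 mem0v.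
  by rewrite linearP memvD ?memvZ ?Pu ?Pv.
have SA m l : m \in S -> l \in L -> A l m \in X by move=> /SP h; apply: h.
case: (boolP (fullv <= S)%VS) => [/subvP fS l lL|S1].
  by apply/subvP => _ /memv_imgP[m _ ->]; apply: SA lL; apply: fS; rewrite memvf.
exfalso.
have XS : (X <= S)%VS.
  apply/subvP => x xX; apply/SP => l lL; apply: (subvP (stab l lL)).
  exact: memv_img.
have [x xS xL] : exists2 x, x \notin S & forall l, l \in L -> A l x \in S.
  have [|_ /mapP[l _ ->]|_ /mapP[l lL ->]||x xS xA] :=
      @common_annihilated_vector M (map A (vbasis L)) S.
  - by move=> _ _ /mapP[l _ ->] /mapP[l' _ ->]; apply: Acomm.
  - exact: Anil.
  - apply/subvP => _ /memv_imgP[m /SP mS ->]; apply: (subvP XS).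
    exact/mS/vbasis_mem.
  - exact: S1.
  exists x => // l lL; rewrite (coord_vbasis lL) linear_sum sum_lfunE memv_suml // => i _.
  rewrite linearZ scale_lfunE memvZ // xA // map_f // mem_nth // size_tuple //.
have evl : linear (fun l => A l x).
  by move=> a u v; rewrite linearP add_lfunE scale_lfunE.
pose ev := linfun (HB.pack_for {linear W -> M} (fun l => A l x)
  (GRing.isLinear.Build k W M _ _ evl)).
have evE l : ev l = A l x by rewrite lfunE.
pose Y := (ev @: L + X)%VS.
have YS : (Y <= S)%VS.
  rewrite subv_add XS andbT; apply/subvP => _ /memv_imgP[l lL ->].
  by rewrite evE xL.
pose Lx := (L :&: ev @^-1: X)%VS.
have LxP l : l \in Lx -> l \in L /\ A l x \in X.
  by rewrite memv_cap -memv_preim evE => /andP[].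
(* Rank and nullity of [l |-> A l x] as a map from [L] to [M / X], with kernel [Lx] and image
   [Y / X]. *)
have dimLx : (\dim L + \dim X <= \dim Lx + \dim Y)%N.
  pose q := ((\1 - projv X) \o ev)%VF.
  have qE l : q l = ev l - projv X (ev l) by rewrite comp_lfunE add_lfunE id_lfunE opp_lfunE.
  have -> : Lx = (L :&: lker q)%VS.
    apply/vspaceP => l; rewrite !memv_cap -memv_preim memv_ker qE subr_eq0; congr (_ && _).
    by apply/idP/eqP => [/projv_id ->//|->]; apply: memv_proj.
  rewrite -(limg_ker_dim q L) -addnA leq_add2l -dimv_disjoint_sum.
    apply: dimvS; rewrite subv_add addvSr andbT; apply/subvP => _ /memv_imgP[l lL ->].
    by rewrite qE memvB ?(subvP (addvSr _ _) _ (memv_proj _ _)) // (subvP (addvSl _ _)) // memv_img.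
  apply/eqP; rewrite -subv0; apply/subvP => _ /memv_capP[/memv_imgP[l lL ->]].
  rewrite qE memv0 => h; rewrite -(projv_id h) linearB /=.
  by rewrite projv_proj subrr.
have YX : (X <= Y)%VS by apply: addvSr.
(* Were some [A l' x] outside, a combination [t *: l' + l] would have larger rank modulo [X] than
   [l], against constancy of the rank. *)
have rankLx l : l \in Lx -> l != 0 -> (Y <= limg (A l) + X)%VS.
  move=> /LxP[lL lx] l0; rewrite subv_add addvSr andbT.
  apply/subvP => _ /memv_imgP[l' l'L ->]; rewrite evE; apply: contraT => h.
  have [t t0] := rank_increase lx h.
  have -> : A l + t *: A l' = A (t *: l' + l) by rewrite linearP addrC.
  have mem : t *: l' + l \in L by rewrite memvD ?memvZ.
  rewrite (rankA l) //; have [->|ne0] := eqVneq (t *: l' + l) 0.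
    by rewrite linear0 lim0g add0v ltnNge leq_addl.
  by rewrite rankA // ltnn.
have rankY l : l \in Lx -> l != 0 -> (limg (A l) + Y = limg (A l) + X)%VS.
  move=> lLx l0; apply/eqP; rewrite eqEsubv; apply/andP; split; last exact: addvS.
  by rewrite subv_add addvSl rankLx.
have dXY : (\dim X < \dim Y)%N.
  rewrite ltn_neqAle (dimv_leqif_eq YX) dimvS // andbT; apply: contra xS => /eqP XY.
  apply/SP => l lL; rewrite XY (subvP (addvSl _ _)) // -evE memv_img //.
have dSM : (\dim S < \dim {:M})%N.
  by rewrite ltn_neqAle dimvS ?subvf // andbT; apply: contra S1; rewrite (dimv_leqif_sup (subvf S)).
have YM : (\dim Y < \dim {:M})%N by apply: leq_ltn_trans (dimvS YS) dSM.
have [l1 l1L l10] : exists2 l, l \in Lx & l != 0.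
  have : Lx != 0%VS.
    rewrite -dimv_eq0 -lt0n -(ltn_add2r (\dim Y)) add0n (leq_trans YM) //.
    exact: leq_trans dimL dimLx.
  by rewrite -vpick0; exists (vpick Lx); rewrite ?memv_pick.
pose c' := (\dim (limg (A l1) + Y) - \dim Y)%N.
have IHY : forall l, l \in Lx -> (limg (A l) <= Y)%VS.
  apply: (IH Y Lx c').
  - move=> l /LxP[lL _]; apply/subvP => _ /memv_imgP[y yY ->].
    by apply: (subvP YX); apply: SA lL; apply: (subvP YS).
  - exact: leq_trans dimL dimLx.
  - by rewrite (leq_trans dimn) // addSnnS leq_add2l.
  - move=> l lLx l0; rewrite /c' subnK ?dimvS ?addvSr // !rankY //.
    by rewrite !rankA // ?(proj1 (LxP _ lLx)) ?(proj1 (LxP _ l1L)).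
have [phi phiX [y yY phiy]] : exists2 phi : 'Hom(M, k^o), (X <= lker phi)%VS
    & exists2 y, y \in Y & phi y != 0.
  have /subvPn[y yY yX] : ~~ (Y <= X)%VS.
    by apply: contraTN dXY => /dimvS; rewrite -leqNgt.
  have [phi phiX phiy] := functional_separating yX.
  by exists phi => //; exists y => //; rewrite phiy oner_eq0.
have Fl : linear (fun l => (phi \o A l)%VF).
  by move=> a u v; rewrite linearP comp_lfunDr -comp_lfunZr.
pose F := linfun (HB.pack_for {linear W -> 'Hom(M, k^o)} (fun l => (phi \o A l)%VF)
  (GRing.isLinear.Build k W _ _ _ Fl)).
have FE l : F l = (phi \o A l)%VF by rewrite lfunE.
(* For [l] in [Lx] the functional [phi \o A l] kills [S] and [x], and for [l != 0] it is nonzero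
   because [Y] lies in the image of [A l] plus [X]. The bound gives [dim Lx + dim S < dim M], which
   contradicts [dim M <= dim Lx + dim Y] and [Y <= S]. *)
have : (\dim Lx + \dim (S + <[x]>) <= \dim {:M})%N.
  apply: (annihilator_dim (F := F)) => l lLx; have [lL lx] := LxP l lLx; rewrite FE.
    rewrite subv_add; apply/andP; split; apply/subvP => m.
      by move=> /SP mS; rewrite memv_ker comp_lfunE -memv_ker (subvP phiX) ?mS.
    case/vlineP=> a ->; rewrite memv_ker linearZ /= comp_lfunE.
    by rewrite (eqP (_ : phi (A l x) == 0)) ?scaler0 // -memv_ker (subvP phiX).
  move=> e; apply/eqP; apply: contraTT phiy => l0; rewrite negbK.
  have /memv_addP[_ /memv_imgP[m _ ->] [z zX ->]] := subvP (rankLx l lLx l0) _ yY.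
  rewrite linearD /= -comp_lfunE e zero_lfunE add0r -memv_ker.
  exact: (subvP phiX).
rewrite dimv_disjoint_sum; last first.
  apply/eqP; rewrite -subv0; apply/subvP => w /memv_capP[wS /vlineP[a e]].
  have [a0|a0] := eqVneq a 0; first by rewrite e a0 scale0r mem0v.
  by case/negP: xS; rewrite -[x](scalerK a0) -e memvZ.
rewrite dim_vline; have -> : (x != 0) by apply: contraNneq xS => ->; apply: mem0v.
rewrite addnA addn1 => h; have := leq_trans (leq_trans dimL dimLx) (leq_add (leqnn _) (dimvS YS)).
by rewrite leqNgt h.
Qed.

End Relative.

Lemma constant_rank_commuting_nilpotent (M W : vectType k) (A : 'Hom(W, 'End(M))) c :
    (forall l l' m, A l (A l' m) = A l' (A l m)) ->
    (forall l, exists N, forall m, iter N (A l) m = 0) ->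
    (\dim {:M} <= \dim {:W})%N ->
    (forall l, l != 0 -> \dim (limg (A l)) = c) ->
  forall l, A l = 0.
Proof.
move=> comm nil dimMW rankA l.
have : (limg (A l) <= 0)%VS.
  apply: (@constant_rank_relative M W A comm nil (\dim {:M}).+1 0%VS fullv c);
    rewrite ?dimv0 ?addn0 ?memvf //.
    by move=> *; rewrite limg0.
  by move=> l' _ l'0; rewrite addv0 rankA.
rewrite subv0 => /eqP e; apply/lfunP => m; rewrite zero_lfunE; apply/eqP.
by rewrite -memv0 -e memv_img ?memvf.
Qed.

End ConstantRank.

(** * Projectivity over truncated polynomials as exactness *)

Section Exactness.
Variables (k : fieldType) (A : algType k) (p : nat).
Hypothesis p_gt0 : (0 < p)%N.
Implicit Types (N : fdmod A) (x a b : A).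

(** When [x ^+ p = 0] the image of [x ^+ p.-1] lies in the kernel of [x], so this says that the two
    coincide. *)
Definition exact_at N x := forall m : N, act N x m = 0 ->
  exists m' : N, m = act N (x ^+ p.-1) m'.

Lemma actMv N a b (m : N) : act N (a * b) m = act N a (act N b m).
Proof. by rewrite actM comp_lfunE. Qed.

Lemma act1v N (m : N) : act N 1 m = m.
Proof. by rewrite act1 id_lfunE. Qed.

Lemma actDv N a b (m : N) : act N (a + b) m = act N a m + act N b m.
Proof. by rewrite linearD add_lfunE. Qed.

Lemma actZv N c a (m : N) : act N (c *: a) m = c *: act N a m.
Proof. by rewrite linearZ scale_lfunE. Qed.

Lemma act0v N (m : N) : act N 0 m = 0.
Proof. by rewrite linear0 zero_lfunE. Qed.

(** The trace map of Higman's criterion: [x ^+ i] and [x ^+ (p.-1 - i)] are dual bases of the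
    symmetric algebra k[x]/(x^p), so the sum commutes with [x] whatever [h] is. *)
Definition homotopy N x (h : 'End(N)) : 'End(N) :=
  \sum_(i < p) (act N (x ^+ i) \o (h \o act N (x ^+ (p.-1 - i))))%VF.

Lemma homotopyE N x (h : 'End(N)) m : homotopy x h m =
  \sum_(i < p) act N (x ^+ i) (h (act N (x ^+ (p.-1 - i)) m)).
Proof. by rewrite sum_lfunE; apply: eq_bigr => i _; rewrite !comp_lfunE. Qed.

Section Nilpotent.
Variables (N : fdmod A) (x : A).
Hypothesis xp : x ^+ p = 0.

Lemma homotopyC (h : 'End(N)) m :
  homotopy x h (act N x m) = act N x (homotopy x h m).
Proof.
rewrite !homotopyE linear_sum /=; case: p p_gt0 xp => // q _ xq.
rewrite big_ord_recl [in RHS]big_ord_recr /= subn0 subnn expr0 act1v.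
rewrite -!actMv -exprSr -exprS xq !act0v linear0 add0r addr0.
apply: eq_bigr => i _; rewrite -!actMv -exprSr -exprS /bump /= add1n.
by rewrite subnSK ?ltn_ord.
Qed.

Lemma homotopy_ker (h : 'End(N)) m : act N x m = 0 ->
  homotopy x h m = act N (x ^+ p.-1) (h m).
Proof.
move=> xm; rewrite homotopyE; case: p p_gt0 => // q _.
rewrite big_ord_recr /= big1 ?add0r ?subnn ?act1v // => i _.
by rewrite -(subnSK (ltn_ord i)) exprSr actMv xm !linear0.
Qed.

Lemma homotopyXC (h : 'End(N)) i m :
  homotopy x h (act N (x ^+ i) m) = act N (x ^+ i) (homotopy x h m).
Proof. by elim: i => [|i IH]; rewrite ?act1v // !exprS !actMv homotopyC IH. Qed.

Lemma homotopy_inv_comm (h : 'End(N)) i m : lker (homotopy x h) == 0%VS ->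
  (homotopy x h)^-1%VF (act N (x ^+ i) m) =
    act N (x ^+ i) ((homotopy x h)^-1%VF m).
Proof.
move=> inj; move/lker0P: (inj); apply.
by rewrite lker0_lfunVK // homotopyXC lker0_lfunVK.
Qed.

Lemma exact_of_homotopy (h : 'End(N)) :
  lker (homotopy x h) == 0%VS -> exact_at N x.
Proof.
move=> inj m xm; exists ((homotopy x h)^-1%VF (h m)).
by rewrite -homotopy_inv_comm // -homotopy_ker // lker0_lfunK.
Qed.

(** With [h] a pseudo-inverse of [x ^+ p.-1], the trace is the identity on the kernel of [x]. The
    kernel of the trace is stable under the nilpotent [x], so if nonzero it would meet the kernel of
    [x]. *)
Lemma homotopy_of_exact : exact_at N x ->
  exists h : 'End(N), lker (homotopy x h) == 0%VS.
Proof.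
move=> ex; exists (act N (x ^+ p.-1))^-1%VF; set h := (_^-1)%VF.
have fix_ker m : act N x m = 0 -> homotopy x h m = m.
  move=> xm; rewrite homotopy_ker // limg_lfunVK //.
  by have [m' ->] := ex m xm; rewrite memv_img ?memvf.
apply/eqP/vspaceP => m; rewrite memv0 memv_ker.
apply/eqP/eqP => [Tm|->]; last exact: linear0.
have exj : exists j, act N (x ^+ j) m == 0 by exists p; rewrite xp act0v.
case: (ex_minnP exj) => -[|j]; first by rewrite act1v => /eqP.
rewrite exprS actMv => /eqP /fix_ker; rewrite homotopyXC Tm linear0 => e jmin.
by have := jmin j; rewrite -e eqxx ltnn => /(_ isT).
Qed.

End Nilpotent.
End Exactness.

Section TruncatedPolynomials.
Variables (k : fieldType) (p : nat).
Hypothesis p_gt1 : (1 < p)%N.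
Local Notation R := (trunc_poly k p).
Local Notation t := (trunc_t k p).
Local Notation inR := (in_qpoly ('X^p : {poly k})).

Let p_gt0 : (0 < p)%N := ltnW p_gt1.

Lemma mk_monic_Xp : mk_monic ('X^p : {poly k}) = 'X^p.
Proof. by rewrite mk_monic_Xn prednK. Qed.

Lemma in_qpoly_val (r : R) : inR (r : {poly k}) = r.
Proof. by apply/val_inj/in_qpoly_small/size_mk_monic. Qed.

Lemma trunc_tX i : t ^+ i = inR 'X^i.
Proof. by rewrite rmorphXn. Qed.

Lemma trunc_tp : t ^+ p = 0.
Proof.
by rewrite trunc_tX; apply/val_inj => /=; rewrite mk_monic_Xp Pdiv.RingMonic.rmodpp ?monicXn.
Qed.

Lemma trunc_t_ker (r : R) : t * r = 0 -> exists s, r = t ^+ p.-1 * s.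
Proof.
rewrite -[r]in_qpoly_val; move: (r : {poly k}) => q.
rewrite -rmorphM => /(congr1 val) /=; rewrite mk_monic_Xp => e.
have := Pdiv.RingMonic.rdivp_eq (monicXn k p) ('X * q); rewrite e addr0.
set s := Pdiv.CommonRing.rdivp _ _ => Xq.
have {Xq} -> : q = s * 'X^(p.-1).
  by apply: (@mulfI _ 'X); rewrite ?polyX_eq0 // Xq mulrCA -exprS prednK.
by exists (inR s); rewrite rmorphM /= mulrC -trunc_tX.
Qed.

Lemma trunc_poly_ind (P : R -> Prop) :
    (forall c : k, P c%:A) -> (forall r c, P r -> P (r * t + c%:A)) ->
  forall r, P r.
Proof.
move=> Pc PX r; rewrite -[r]in_qpoly_val; elim/poly_ind: (r : {poly k}) => [|q c IH].
  by have := Pc 0; rewrite scale0r rmorph0.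
by rewrite rmorphD rmorphM /= -[c%:P]alg_polyC linearZ rmorph1; apply: PX.
Qed.

Section Evaluation.
Variables (A : algType k) (x : A).
Hypothesis xp : x ^+ p = 0.

Definition trunc_eval (r : R) : A := horner_alg x (r : {poly k}).

Lemma trunc_eval_in q : trunc_eval (inR q) = horner_alg x q.
Proof.
rewrite [in RHS](Pdiv.RingMonic.rdivp_eq (monic_mk_monic 'X^p) q).
have e : horner_alg x (mk_monic ('X^p : {poly k})) = 0.
  by rewrite mk_monic_Xp rmorphXn /= horner_algX.
have D a b c : horner_alg x (a * b + c) = horner_alg x a * horner_alg x b + horner_alg x c.
  by rewrite rmorphD rmorphM.
by rewrite D e mulr0 add0r.
Qed.

Lemma trunc_eval_linear : linear trunc_eval.
Proof.
move=> a r s; rewrite -[r]in_qpoly_val -[s]in_qpoly_val -in_qpolyZ -in_qpolyD.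
by rewrite !trunc_eval_in linearP /= mulr_algl.
Qed.

Lemma trunc_eval_monoid : monoid_morphism trunc_eval.
Proof.
split=> [|r s]; first by rewrite -(rmorph1 inR) trunc_eval_in rmorph1.
by rewrite -[r]in_qpoly_val -[s]in_qpoly_val -rmorphM !trunc_eval_in rmorphM.
Qed.

Definition trunc_eval_morph : {lrmorphism R -> A} :=
  HB.pack_for {lrmorphism R -> A} trunc_eval
    (GRing.isLinear.Build k R A _ trunc_eval trunc_eval_linear)
    (GRing.isMonoidMorphism.Build R A trunc_eval trunc_eval_monoid).

Lemma trunc_eval_t : trunc_eval_morph t = x.
Proof. by rewrite /= trunc_eval_in horner_algX. Qed.

End Evaluation.

Variables (A : algType k) (f : {lrmorphism R -> A}) (N : fdmod A).
Local Notation x := (f t).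
Local Notation P := (lmod (pullback f N)).

Lemma lrmorph_tp : x ^+ p = 0.
Proof. by rewrite -rmorphXn trunc_tp rmorph0. Qed.

Lemma trunc_scaleE (r : R) (m : P) : r *: m = act N (f r) (m : N).
Proof. by []. Qed.

Lemma trunc_scaleC c (m : P) : (c%:A : R) *: m = (c *: (m : N) : N).
Proof.
by rewrite trunc_scaleE linearZ rmorph1 actZv act1v.
Qed.

Lemma trunc_scaletX i (m : P) : (t ^+ i) *: m = act N (x ^+ i) (m : N).
Proof. by rewrite trunc_scaleE rmorphXn. Qed.

(** A section of a finite free cover embeds the module into a free one, where exactness is checked
    on coordinates. *)
Lemma exact_of_projective : proj_fdmod (pullback f N) -> exact_at p N x.
Proof.
move=> proj.
pose g (v : 'rV[R]_(dim N)) : P := \sum_i v 0 i *: (vbase i : P).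
have gl : linear g.
  move=> a u v; rewrite /g scaler_sumr -big_split; apply: eq_bigr => i _ /=.
  by rewrite !mxE scalerDl scalerA.
pose gL := HB.pack_for {linear 'rV[R]_(dim N) -> P} g (GRing.isLinear.Build R _ _ _ g gl).
have gsurj y : exists v, gL v = y.
  exists (\row_i (v2r (y : N) 0 i)%:A); rewrite /= /g [RHS](vbase_sum (y : N)).
  by apply: eq_bigr => i _; rewrite mxE trunc_scaleC.
have [h hP] := proj _ _ gL (HB.pack_for {linear P -> P} (@id P)
   (GRing.isLinear.Build R P P _ (@id P) (fun a u v => erefl))) gsurj.
move=> m xm.
have tm : t *: (m : P) = 0 by rewrite -[t]expr1 trunc_scaletX.
have e0 : t *: h m = 0 by rewrite -linearZ tm linear0.
have /boolp.choice[s sE] : forall i, exists s, h m 0 i = t ^+ p.-1 * s.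
  by move=> i; apply: trunc_t_ker; move/rowP: e0 => /(_ i); rewrite !mxE.
exists (g (\row_i s i)); rewrite -trunc_scaletX -[LHS]hP.
rewrite -[LHS]/(gL _) -[X in _ *: X]/(gL _) -linearZ /=; congr g.
by apply/rowP => i; rewrite !mxE.
Qed.

(** Higman averaging. A lift [u0] of [u] that is only [k]-linear is defined on a basis of [N];
    averaging [u0 \o h \o T^-1] over the dual bases makes it linear over k[T]/(T^p). It still lifts
    [u], since the same average of [h \o T^-1] is the identity. *)
Lemma projective_of_exact : exact_at p N x -> proj_fdmod (pullback f N).
Proof.
move=> /(homotopy_of_exact p_gt0 lrmorph_tp)[h hinj] X Y g u gsurj.
pose T := homotopy p x h.
have /boolp.choice[b bE] i : exists b, g b = u (vbase i : P).
  exact: gsurj.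
pose u0 (m : P) : X := \sum_i (v2r (m : N) 0 i)%:A *: b i.
have u0D (m m' : P) : u0 (m + m') = u0 m + u0 m'.
  rewrite /u0 -big_split; apply: eq_bigr => i _ /=.
  by rewrite linearD mxE scalerDl scalerDl.
have u0Z c (m : P) : u0 (c%:A *: m) = c%:A *: u0 m.
  rewrite /u0 scaler_sumr trunc_scaleC; apply: eq_bigr => i _ /=.
  by rewrite linearZ mxE scalerA -scalerAl mul1r scalerA.
have gu0 (m : P) : g (u0 m) = u m.
  rewrite [in RHS](vbase_sum (m : N)) linear_sum linear_sum; apply: eq_bigr => i _ /=.
  by rewrite linearZ bE -trunc_scaleC [RHS]linearZ.
pose w (m : P) : P := h (T^-1%VF (m : N)).
have wD (m m' : P) : w (m + m') = w m + w m' by rewrite /w !linearD.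
have wZ c (m : P) : w (c%:A *: m) = c%:A *: w m.
  by rewrite /w !trunc_scaleC !linearZ.
pose F (m : P) : X := \sum_(i < p) t ^+ i *: u0 (w (t ^+ (p.-1 - i) *: m)).
have FD (m m' : P) : F (m + m') = F m + F m'.
  rewrite /F -big_split; apply: eq_bigr => i _ /=.
  by rewrite scalerDr wD u0D scalerDr.
have FZ c (m : P) : F (c%:A *: m) = c%:A *: F m.
  rewrite /F scaler_sumr; apply: eq_bigr => i _ /=.
  have -> : t ^+ (p.-1 - i) *: (c%:A *: m) = c%:A *: (t ^+ (p.-1 - i) *: m).
    by rewrite !scalerA mulrC.
  by rewrite wZ u0Z !scalerA mulrC.
have Ft (m : P) : F (t *: m) = t *: F m.
  (* [F (t *: m)] sums [G] over [0, ..., p-1] and [t *: F m] over [1, ..., p]; the end terms vanish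
     because [t ^+ p = 0]. *)
  pose G i := t ^+ i *: u0 (w (t ^+ (p - i) *: m)).
  have w0 : w 0 = 0 by rewrite /w !linear0.
  have u00 : u0 0 = 0 by have := u0Z 0 0; rewrite !scale0r.
  have G0 : G 0 = 0 by rewrite /G subn0 trunc_tp scale0r w0 u00 scaler0.
  have Gp : G p = 0 by rewrite /G trunc_tp scale0r.
  transitivity (\sum_(i < p) G i).
    apply: eq_bigr => i _; rewrite scalerA -exprSr /G.
    by congr (_ *: u0 (w (_ ^+ _ *: _))); rewrite -subSn ?prednK // -ltnS prednK.
  transitivity (\sum_(i < p.+1) G i); first by rewrite big_ord_recr /= Gp addr0.
  rewrite big_ord_recl G0 add0r /F scaler_sumr; apply: eq_bigr => i _.
  by rewrite scalerA -exprS /G lift0 -[p.-1]subn1 -subnDA add1n.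
have Fl : linear F.
  suff FR r m : F (r *: m) = r *: F m by move=> r m m'; rewrite FD FR.
  elim/trunc_poly_ind: r m => [c|r c IH] m; first exact: FZ.
  by rewrite !scalerDl FD FZ -!scalerA IH Ft.
pose FL := HB.pack_for {linear P -> X} F (GRing.isLinear.Build R P X _ F Fl).
exists FL => m; rewrite /= /F linear_sum.
under eq_bigr do rewrite linearZ gu0 -linearZ.
rewrite -linear_sum; congr (u _); rewrite -[RHS](lker0_lfunVK hinj) homotopyE.
apply: eq_bigr => i _; rewrite !trunc_scaletX; congr (act N _ (h _)).
by rewrite -homotopy_inv_comm // lrmorph_tp.
Qed.

End TruncatedPolynomials.

(** * Exactness under perturbation by a nilpotent multiple *)

Section Perturbation.
Variables (k : fieldType) (p : nat) (A : algType k).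
Hypothesis pchar_k : p \in [pchar k].
Hypothesis cA : commutative ( *%R : A -> A -> A).
Variable N : fdmod A.
Variables (u v w : A).
Hypotheses (up : u ^+ p = 0) (vp : v ^+ p = 0).
Variable K : nat.
Hypothesis wK : w ^+ K = 0.

Let p_gt0 : (0 < p)%N. Proof. exact/prime_gt0/(pcharf_prime pchar_k). Qed.

Let actC a b (m : N) : act N a (act N b m) = act N b (act N a m).
Proof. by rewrite -!actMv cA. Qed.

(* [f : nat -> N] is the power series [sum_j s^j f_j]; [pert] multiplies it by
   [u + s v], and setting [s = w] turns [u + s v] into [u + v w]. *)
Let sh (f : nat -> N) j : N := if j is i.+1 then f i else 0.
Let pert (f : nat -> N) j : N := act N u (f j) + act N v (sh f j).
Let X : {poly A} := u%:P + v%:P * 'X.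

Let shB f g : sh (f \- g) = sh f \- sh g.
Proof. by apply/boolp.funext => -[|j] //=; rewrite subrr. Qed.

Let pertB f g : pert (f \- g) = pert f \- pert g.
Proof.
by apply/boolp.funext => j; rewrite /pert shB /= !linearB opprD addrACA.
Qed.

Let pertXB n f g : iter n pert (f \- g) = iter n pert f \- iter n pert g.
Proof. by elim: n => //= n ->; rewrite pertB. Qed.

Let pertXE n f j : iter n pert f j = \sum_(i < j.+1) act N (X ^+ n)`_i (f (j - i)%N).
Proof.
elim: n f j => [|n IH] f j.
  rewrite big_ord_recl expr0 coef1 eqxx act1v subn0 big1 ?addr0 // => i _.
  by rewrite coef1 /= act0v.
have cX i : (X ^+ n.+1)`_i = u * (X ^+ n)`_i + (if i is l.+1 then v * (X ^+ n)`_l else 0).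
  rewrite exprS mulrDl coefD coefCM -mulrA coefCM -commr_polyX coefMX.
  by case: i => [|i] //=; rewrite mulr0.
rewrite iterS {1}/pert IH linear_sum.
under [RHS]eq_bigr do rewrite cX actDv actMv.
rewrite big_split /=; congr (_ + _); rewrite big_ord_recl act0v add0r.
case: j => [|j] /=; first by rewrite linear0 big_ord0.
by rewrite IH linear_sum; apply: eq_bigr => i _; rewrite /= -actMv.
Qed.

Let pert_p f : iter p pert f = fun=> 0.
Proof.
apply/boolp.funext => j; rewrite pertXE.
have pA : p \in [pchar {poly A}] by rewrite pchar_poly pchar_lalg.
have cuv : GRing.comm u%:P (v%:P * 'X).
  by rewrite /GRing.comm mulrA -polyCM cA polyCM -!mulrA commr_polyX.
have -> : X ^+ p = 0.
  rewrite -(pFrobenius_autE pA) pFrobenius_autD_comm // !pFrobenius_autE.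
  rewrite exprMn_comm; last by rewrite /GRing.comm commr_polyX.
  by rewrite -!polyC_exp up vp mul0r addr0.
by rewrite big1 // => i _; rewrite coef0 act0v.
Qed.

Let vanish n (f : nat -> N) := forall j, (j < n)%N -> f j = 0.

Let vanish_pert n f : vanish n f -> vanish n (pert f).
Proof.
move=> f0 j jn; rewrite /pert f0 // linear0 add0r.
by case: j jn => [|j] jn; rewrite /= ?linear0 // f0 ?linear0 // ltnW.
Qed.

Let vanish_pertX n i f : vanish n f -> vanish n (iter i pert f).
Proof. by move=> f0; elim: i => //= i IH; apply: vanish_pert. Qed.

Hypothesis u_exact : exact_at p N u.

(** Lifts exactness from the constant term [u] to [u + s v] modulo [s ^ n]: the first coefficient of
    the error is killed by [u], so it is removed by changing one coefficient of [q]. *)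
Let series_exact n f : vanish n (pert f) ->
  exists q, vanish n (f \- iter p.-1 pert q).
Proof.
elim: n => [|n IH] f0; first by exists f.
have [|q qf] := IH; first by move=> j jn; apply: f0; apply: ltnW.
set g := f \- iter p.-1 pert q in qf.
have : act N u (g n) = 0.
  have -> : act N u (g n) = pert g n.
    rewrite /pert; case: (n) qf => [|j] qf /=; first by rewrite linear0 addr0.
    by rewrite (qf j) // linear0 addr0.
  by rewrite /g pertB -iterS prednK // pert_p /= f0 // subr0.
move=> /u_exact[a ga].
pose d j : N := if j == n then - a else 0.
exists (q \- d) => j; rewrite ltnS => jn.
rewrite pertXB /= opprB addrCA -/(g j) addrC.
rewrite leq_eqVlt in jn; case/predU1P: jn => [->|jn].
  rewrite -[f n - _]/(g n) ga pertXE big_ord_recl big1 ?addr0 => [|i _].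
    rewrite subn0 /d eqxx.
    have -> : (X ^+ p.-1)`_0 = u ^+ p.-1.
      elim: (p.-1) => [|i IHi]; first by rewrite coef1.
      by rewrite !exprS mulrDl coefD coefCM IHi -mulrA coefCM -commr_polyX coefMX mulr0 addr0.
    by rewrite linearN subrr.
  by rewrite /d ifN ?linear0 // neq_ltn ltn_subrL lift0 /= (leq_ltn_trans _ (ltn_ord i)) ?ltn0Sn.
have d0 : vanish n d by move=> i i_n; rewrite /d ifN // ltn_eqF.
by rewrite -[f j - _]/(g j) qf // (vanish_pertX _ d0) // addr0.
Qed.

(** If the power [i.+1] of [pert] kills [f], then its power [i] sends [f] to [iter p.-1 pert q];
    subtracting [iter (p.-1 - i) pert q], itself in the image of [pert], lowers the exponent. *)
Let series_coexact n i f : (i < p)%N -> vanish n (iter i pert f) ->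
  exists q, vanish n (f \- pert q).
Proof.
elim: i f => [|i IH] f ip f0.
  exists (fun=> 0) => j jn /=; rewrite (f0 : vanish n f) // sub0r /pert linear0 add0r.
  by case: j jn => [|j] _ /=; rewrite linear0 oppr0.
have [q qP] := series_exact f0.
have [|g gP] := IH (f \- iter (p.-1 - i) pert q) (ltnW ip).
  rewrite pertXB -iterD subnKC //; by rewrite -ltnS prednK // ltnW.
exists (g \- (\0 \- iter (p.-1 - i.+1) pert q)) => j jn.
rewrite !pertB /= -[in pert (iter _ _ _)]iterS subnSK ?(leq_trans ip) //; last first.
  by rewrite -ltnS prednK.
have -> : pert \0 j = 0 by rewrite /pert linear0 add0r; case: (j) => [|l]; rewrite /= linear0.
by rewrite sub0r opprK opprD [- _ - _]addrC addrA; apply: gP.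
Qed.

Let specialise (f : nat -> N) := \sum_(j < K) act N (w ^+ j) (f j).

Let specialiseB f g : specialise (f \- g) = specialise f - specialise g.
Proof. by rewrite /specialise -sumrB; apply: eq_bigr => i _; rewrite linearB. Qed.

Let specialise_sh f : specialise (sh f) = act N w (specialise f).
Proof.
rewrite /specialise linear_sum /=; case: K wK => [|n] wn; first by rewrite !big_ord0.
rewrite big_ord_recl [RHS]big_ord_recr /= linear0 add0r -actMv -exprS wn act0v addr0.
by apply: eq_bigr => i _; rewrite -actMv -exprS.
Qed.

Let specialise_act a f : specialise (fun j => act N a (f j)) = act N a (specialise f).
Proof. by rewrite /specialise linear_sum; apply: eq_bigr => i _; rewrite actC. Qed.

Let specialise_pert f : specialise (pert f) = act N (u + v * w) (specialise f).
Proof.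
have -> : pert f = (fun j => act N u (f j)) \- (\0 \- (fun j => act N v (sh f j))).
  by apply/boolp.funext => j /=; rewrite sub0r opprK.
rewrite !specialiseB !specialise_act specialise_sh actDv actMv.
by rewrite {2}/specialise big1 ?sub0r ?opprK // => i _; rewrite linear0.
Qed.

Let specialise_pertX n f : specialise (iter n pert f) = act N ((u + v * w) ^+ n) (specialise f).
Proof. by elim: n => [|n IH]; rewrite ?act1v //= specialise_pert IH exprS actMv. Qed.

Let specialise_vanish f : vanish K f -> specialise f = 0.
Proof. by move=> f0; apply: big1 => i _; rewrite f0 ?linear0. Qed.

(* multiplication by [s - w] *)
Let sw (f : nat -> N) := sh f \- (fun j => act N w (f j)).

Let swB f g : sw (f \- g) = sw f \- sw g.
Proof.
apply/boolp.funext => j; rewrite /sw shB /= linearB !opprB addrACA [RHS]addrACA.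
by congr (_ + _); rewrite addrC.
Qed.

Let pert_sw f : pert (sw f) = sw (pert f).
Proof.
apply/boolp.funext => -[|j] /=; rewrite /pert /sw /=.
  by rewrite !linear0 !sub0r !addr0 !linearN /= actC.
rewrite (linearD (act N w)) !linearB /= opprD addrACA.
by rewrite !(actC w).
Qed.

Let pertX_sw n f : iter n pert (sw f) = sw (iter n pert f).
Proof. by elim: n => //= n ->; rewrite pert_sw. Qed.

Let sw_inj f : sw f = \0 -> f = \0.
Proof.
move=> f0; have fS j : f j = act N w (f j.+1).
  by apply/eqP; rewrite -subr_eq0; apply/eqP; move/(congr1 (fun g => g j.+1)): f0.
apply/boolp.funext => j; have -> : f j = act N (w ^+ K) (f (j + K)%N).
  elim: K => [|n IH]; first by rewrite act1v addn0.
  by rewrite IH exprSr actMv addnS -fS.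
by rewrite wK act0v.
Qed.

(** [N] is the quotient of the series by [s - w], which acts injectively. As [u + v w] kills [m],
    [pert] sends the constant series [m] to [s - w] times the constant series [v m]; hence
    [iter p.-1 pert] kills [v m]. Modulo [s ^ K], [v m] is then some [pert q], so [m - (s - w) q] is
    killed by [pert] and equals some [iter p.-1 pert q']. Setting [s = w] gives the preimage of
    [m]. *)
Lemma exact_perturbed : exact_at p N (u + v * w).
Proof.
move=> m xm.
pose c (a : N) j : N := if j is 0 then a else 0.
have Xc : pert (c m) = sw (c (act N v m)).
  apply/boolp.funext => -[|[|j]]; rewrite /pert /sw /= ?linear0 ?addr0 ?add0r ?subr0 //.
  by apply/eqP; rewrite -addr_eq0 -actMv cA -actDv; apply/eqP.
have vc : iter p.-1 pert (c (act N v m)) = \0.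
  by apply: sw_inj; rewrite -pertX_sw -Xc -iterSr prednK // pert_p.
have [||q qP] := @series_coexact K p.-1 (c (act N v m)).
- by rewrite prednK.
- by rewrite vc.
have [|q' q'P] := @series_exact K (c m \- sw q).
  rewrite pertB Xc pert_sw => j jK.
  rewrite -swB; set r := _ \- _ in qP *; rewrite /sw /= qP // linear0 subr0.
  by case: j jK => [|j] jK //; apply: qP; apply: ltnW.
exists (specialise q'); rewrite -specialise_pertX.
have := specialise_vanish q'P; rewrite !specialiseB specialise_sh specialise_act subrr subr0.
move=> /eqP; rewrite subr_eq0 => /eqP <-.
rewrite /specialise; case: K wK => [w0|n _].
  have A0 : (1 : A) = 0 by rewrite -w0 expr0.
  by rewrite big_ord0 -[m]act1v A0 act0v.
by rewrite big_ord_recl expr0 act1v big1 ?addr0 // => i _; rewrite linear0.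
Qed.

End Perturbation.

(** * Truncated presentations of local algebras *)

(* A copy of [A] that knows that [A] is commutative. *)
Definition com_falg (k : fieldType) (A : falgType k)
  (cA : commutative ( *%R : A -> A -> A)) : Type := A.

HB.instance Definition _ (k : fieldType) (A : falgType k)
    (cA : commutative ( *%R : A -> A -> A)) :=
  Falgebra.copy (com_falg cA) A.
HB.instance Definition _ (k : fieldType) (A : falgType k)
    (cA : commutative ( *%R : A -> A -> A)) :=
  GRing.PzRing_hasCommutativeMul.Build (com_falg cA) cA.

Section AdaptedGenerators.
Variables (k : closedFieldType) (p : nat) (A0 : falgType k).
Hypothesis pchar_k : p \in [pchar k].
Hypothesis cA : commutative ( *%R : A0 -> A0 -> A0).
Local Notation A := (com_falg cA).
Variable eps : {lrmorphism A -> k^o}.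
Hypothesis nilp : forall u : A, eps u = 0 -> exists n, u ^+ n = 0.
Implicit Types (u v : A).

Let p_pr : prime p := pcharf_prime pchar_k.

Lemma frobD e u v : (u + v) ^+ (p ^ e) = u ^+ (p ^ e) + v ^+ (p ^ e).
Proof.
have pA : p \in [pchar A] by rewrite pchar_lalg.
elim: e => // e IH; rewrite expnSr !exprM IH.
by rewrite -!(pFrobenius_autE pA) pFrobenius_autD_comm //; apply: mulrC.
Qed.

Lemma frob_sum e (I : Type) (r : seq I) (P : pred I) (F : I -> A) :
  (\sum_(i <- r | P i) F i) ^+ (p ^ e) = \sum_(i <- r | P i) F i ^+ (p ^ e).
Proof.
apply: (big_morph (fun u : A => u ^+ (p ^ e)) (frobD e)).
by rewrite expr0n expn_eq0 eqn0Ngt prime_gt0.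
Qed.

Let aug : {vspace A} := lker (linfun eps).

Lemma augP u : (u \in aug) = (eps u == 0).
Proof. by rewrite memv_ker lfunE. Qed.

Lemma frob_ker_exists e : exists V : {vspace A}, forall u, u \in V <-> u ^+ (p ^ e) = 0.
Proof.
apply: vspace_of_pred => [|a u v u0 v0].
  by rewrite expr0n expn_eq0 eqn0Ngt prime_gt0.
by rewrite frobD exprZn u0 v0 scaler0 addr0.
Qed.

Let K e : {vspace A} := projT1 (boolp.cid (frob_ker_exists e)).
Let KP e u : u \in K e <-> u ^+ (p ^ e) = 0.
Proof. exact: (projT2 (boolp.cid (frob_ker_exists e))). Qed.

Let aug2 : {vspace A} := (aug * aug)%VS.

(* Generators adapted to the filtration of [aug / aug ^ 2] by the images of the
   kernels [K e] of the iterated Frobenius. *)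
Lemma adapted_list e : exists s : seq (A * nat),
  [/\ forall xf, xf \in s -> (0 < xf.2 <= e)%N /\ xf.1 ^+ (p ^ xf.2) = 0,
      forall e', (e' <= e)%N ->
        (K e' <= aug2 + <<[seq xf.1 | xf <- s & (xf.2 <= e')%N]>>)%VS &
      free (vbasis aug2 ++ map fst s)].
Proof.
elim: e => [|e [s [sP sK sfree]]].
  exists [::]; split=> // [e'|]; last by rewrite cats0 (basis_free (vbasisP _)).
  rewrite leqn0 => /eqP ->; apply/subvP => u /KP; rewrite expr1 => ->.
  exact: mem0v.
pose V := (aug2 + <<map fst s>>)%VS; pose W := (K e.+1 :\: V)%VS.
exists (s ++ [seq (x, e.+1) | x <- vbasis W]); split=> [xf|e'|].
- rewrite mem_cat => /orP[/sP[/andP[-> h] ->]|/mapP[x xW ->]] /=.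
    by split=> //; apply: leqW.
  split=> //; apply/KP; exact/(subvP (diffvSl _ V))/vbasis_mem.
- rewrite leq_eqVlt => /predU1P[-> |e'e]; last first.
    by apply: subv_trans (sK _ e'e) _; rewrite addvS // filter_cat map_cat span_cat addvSl.
  rewrite (_ : filter _ _ = s ++ [seq (x, e.+1) | x <- vbasis W]); last first.
    apply/all_filterP/allP => xf; rewrite mem_cat => /orP[/sP[/andP[_ h] _]|/mapP[x _ ->//]].
    exact: leqW.
  rewrite map_cat span_cat -map_comp map_id_in // addvA -/V.
  by rewrite (span_basis (vbasisP W)) addvC addv_diff addvSl.
rewrite map_cat -map_comp map_id_in // catA cat_free sfree (basis_free (vbasisP _)) /=.
rewrite span_cat !(span_basis (vbasisP _)) -/V; apply/directv_addP.
by rewrite capvC capv_diff.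
Qed.

Lemma aug_frob_nilpotent : exists e, (aug <= K e)%VS.
Proof.
have /boolp.choice[d dP] (i : 'I_(\dim aug)) : exists n, (vbasis aug)`_i ^+ n = 0.
  apply: nilp; apply/eqP; rewrite -augP vbasis_mem // mem_nth // size_tuple //.
exists (\sum_i d i)%N; apply/subvP => u uM; rewrite (coord_vbasis uM).
apply: memv_suml => i _; apply/memvZ/KP.
have le : (d i <= p ^ (\sum_j d j))%N.
  rewrite (leq_trans _ (ltnW (ltn_expl _ (prime_gt1 p_pr)))) //.
  by rewrite (bigD1 i) //= leq_addr.
by rewrite -(subnK le) exprD dP mulr0.
Qed.

(** The last property of [g i] is what the adapted choice buys: the kernel of the [p ^ e]-th power
    lies in [aug2] plus the span of generators of height at most [e]. It makes the derivations that
    lift the [g i] preserve these kernels. *)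
Lemma adapted_generators : exists n (x : 'I_n -> A) (f : 'I_n -> nat)
    (g : 'I_n -> 'Hom(A, k^o)),
  [/\ forall i, (0 < f i)%N /\ x i ^+ (p ^ f i) = 0,
      (aug <= aug * aug + \sum_i <[x i]>)%VS &
      forall i, [/\ g i 1 = 0,
        forall u v, eps u = 0 -> eps v = 0 -> g i (u * v) = 0,
        forall j, g i (x j) = (i == j)%:R &
        forall e u, (e < f i)%N -> u ^+ (p ^ e) = 0 -> g i u = 0]].
Proof.
have [E augE] := aug_frob_nilpotent.
have [s [sP sK sfree]] := adapted_list E.
pose n := size s; pose xf (i : 'I_n) := nth (0, 0%N) s i.
have xfs i : xf i \in s by rewrite mem_nth.
have x_aug i : (xf i).1 \in aug.
  rewrite augP; have [_ /(congr1 eps)] := sP _ (xfs i).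
  by rewrite rmorphXn rmorph0 => /eqP; rewrite expf_eq0 => /andP[].
have aug2S : (aug2 <= aug)%VS.
  by apply/prodvP => u v; rewrite !augP => /eqP u0 _; rewrite rmorphM /= u0 mul0r.
have free1 : free (1 :: vbasis aug2 ++ map fst s).
  rewrite free_cons sfree andbT; apply/negP => h.
  suff : 1 \in aug by rewrite augP rmorph1 oner_eq0.
  move: h; apply/subvP; rewrite span_cat subv_add (span_basis (vbasisP _)) aug2S.
  apply/span_subvP => _ /mapP[y ys ->]; rewrite -[y](nth_index (0, 0%N) ys).
  have ly : (index y s < n)%N by rewrite index_mem.
  exact: (x_aug (Ordinal ly)).
have /boolp.choice[g gP] (i : 'I_n) : exists g : 'Hom(A, k^o),
    [/\ g 1 = 0, forall u, u \in aug2 -> g u = 0 & forall j, g (xf j).1 = (i == j)%:R].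
  pose vals := (0 : k^o) :: nseq (\dim aug2) 0 ++ [seq (i == j)%:R : k^o | j <- enum 'I_n].
  have [h hP] := linear_of_free (1 :: vbasis aug2 ++ map fst s) vals.
  have sz : size vals = size (1 :: vbasis aug2 ++ map fst s).
    by rewrite /= !size_cat size_nseq !size_map size_tuple -enumT size_enum_ord.
  have {hP} [h1] := hP free1 sz.
  rewrite map_cat => /eqP; rewrite eqseq_cat ?size_map ?size_nseq ?size_tuple //.
  move=> /andP[/eqP h2 /eqP h3]; exists (linfun h); split=> [|u u2|j]; rewrite lfunE //=.
    rewrite (coord_vbasis u2) linear_sum big1 // => l _; rewrite linearZ /=.
    have -> : h (vbasis aug2)`_l = 0; last by rewrite scaler0.
    by rewrite -(nth_map _ 0) ?size_tuple // h2 nth_nseq ltn_ord.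
  have -> : h (xf j).1 = nth 0 (map h (map fst s)) j.
    by rewrite (nth_map 0) ?size_map // (nth_map (0, 0%N)).
  by rewrite h3 (nth_map j) ?size_enum_ord // nth_ord_enum.
exists n, (fun i => (xf i).1), (fun i => (xf i).2), g; split=> [i||i].
- by have [/andP[]] := sP _ (xfs i).
- apply: subv_trans (subv_trans augE (sK E (leqnn _))) _; apply: addvS => //.
  apply/span_subvP => _ /mapP[y + ->]; rewrite mem_filter => /andP[_ ys].
  have ly : (index y s < n)%N by rewrite index_mem.
  apply: (subvP (sumv_sup (Ordinal ly) _ (subvv _))) => //.
  by rewrite /xf /= nth_index // memv_line.
have [g1 g2 gx] := gP i; split=> // [u v u0 v0|e u ei /KP uK].
  by apply: g2; apply: memv_mul; rewrite augP ?u0 ?v0.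
have [/andP[_ iE] _] := sP _ (xfs i).
have /memv_addP[a /g2 a0 [b bS ->]] := subvP (sK e (leq_trans (ltnW ei) iE)) _ uK.
rewrite linearD /= a0 add0r; apply/eqP; rewrite -memv_ker.
move: b bS; apply/subvP/span_subvP => _ /mapP[y + ->].
rewrite mem_filter => /andP[ye ys]; rewrite memv_ker.
have ly : (index y s < n)%N by rewrite index_mem.
have -> : y = xf (Ordinal ly) by rewrite /xf /= nth_index.
rewrite gx; have [ii|_] := eqVneq i (Ordinal ly); last exact: eqxx.
move: ei; rewrite ii /xf /= nth_index //.
by rewrite ltnNge ye.
Qed.

End AdaptedGenerators.

(** * Nonvanishing of the top monomial *)

Section TopMonomial.
Variables (k : closedFieldType) (p : nat) (A0 : falgType k).
Hypothesis pchar_k : p \in [pchar k].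
Hypothesis cA : commutative ( *%R : A0 -> A0 -> A0).
Local Notation A := (com_falg cA).
Variable eps : {lrmorphism A -> k^o}.
Hypothesis nilp : forall u : A, eps u = 0 -> exists n, u ^+ n = 0.
Implicit Types (u v : A).

Let p_pr : prime p := pcharf_prime pchar_k.
Let p_gt0 : (0 < p)%N := prime_gt0 p_pr.

Lemma aug_unit u : eps u != 0 -> exists c, c * u = 1.
Proof.
move=> u0; pose w : A := 1 - (eps u)^-1 *: u.
have [|n wn] := nilp (u := w).
  rewrite /w linearB /= linearZ rmorph1 /=.
  by rewrite -[_ *: _]/(_ * _) mulVf ?subrr.
exists ((eps u)^-1 *: \sum_(i < n) w ^+ i).
rewrite -scalerAl scalerAr.
have -> : (eps u)^-1 *: u = 1 - w by rewrite /w subKr.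
by rewrite mulrC -opprB mulNr -subrX1 wn sub0r opprK.
Qed.

Definition derivation (D : 'End(A)) := forall u v, D (u * v) = D u * v + u * D v.

Lemma derivationX D u n : derivation D -> D (u ^+ n) = (u ^+ n.-1 * D u) *+ n.
Proof.
move=> DD; elim: n => [|[|n] IH].
- rewrite expr0 mulr0n; have := DD 1 1; rewrite !mulr1 !mul1r => /eqP.
  by rewrite -subr_eq0 opprD addNKr oppr_eq0 => /eqP.
- by rewrite expr1 expr0 mul1r mulr1n.
rewrite exprS DD IH /= [RHS]mulrS mulrC; congr (_ + _).
by rewrite mulrnAr mulrA -exprS.
Qed.

Lemma derivation_frob D u : derivation D -> D (u ^+ p) = 0.
Proof.
move=> DD; have pA : p \in [pchar A] by rewrite pchar_lalg.
by rewrite derivationX // -mulr_natl (pcharf0 pA) mul0r.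
Qed.

(* Gaussian elimination on the matrix [D i (x j)] produces a derivation with
   [D (x i0) = 1], which lowers the exponent of [x i0]. *)
Lemma derivations_top n (x : 'I_n -> A) (P : A -> Prop) :
    (forall u v, P u -> P v -> P (u + v)) -> (forall u v, P v -> P (u * v)) ->
  forall (S : {set 'I_n}) (D : 'I_n -> 'End(A)) z,
    {in S, forall i, derivation (D i) /\ (forall u, P u -> P (D i u))} ->
    {in S &, forall i j, eps (D i (x j)) = (i == j)%:R} ->
    {in S, forall i, D i z = 0} ->
  P (z * \prod_(i in S) x i ^+ p.-1) -> P z.
Proof.
move=> PD PM S; have [m] := ubnP #|S|.
elim: m S => // m IH S Sm D z DP Dx Dz.
have [->|[i0 i0S]] := set_0Vmem S; first by rewrite big_set0 mulr1.
have [|c cD] := aug_unit (u := D i0 (x i0)).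
  by rewrite Dx // eqxx oner_eq0.
have [D0d D0P] := DP _ i0S.
pose D0 : 'End(A) := (amull c \o D i0)%VF.
have D0E u : D0 u = c * D i0 u by rewrite comp_lfunE lfunE.
have D0x : D0 (x i0) = 1 by rewrite D0E.
have D0D : derivation D0.
  move=> u v; rewrite !D0E D0d mulrDr; congr (_ + _); first by rewrite mulrA.
  by rewrite mulrCA.
pose D' j : 'End(A) := (D j - (amull (D j (x i0)) \o D0))%VF.
have D'E j u : D' j u = D j u - D j (x i0) * D0 u.
  by rewrite add_lfunE opp_lfunE comp_lfunE [amull _ _]lfunE.
have zx q : (q < p)%N -> P (z * x i0 ^+ q) -> P z.
  elim: q => [|q IHq] qp; first by rewrite expr0 mulr1.
  move=> Pzx; apply: IHq; first exact: ltnW.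
  have : P (D0 (z * x i0 ^+ q.+1)) by rewrite D0E; apply/PM/D0P.
  rewrite D0D D0E Dz // mulr0 mul0r add0r derivationX // D0x mulr1 /= mulrnAr.
  have q0 : q.+1%:R != 0 :> k.
    by rewrite -(dvdn_pcharf pchar_k) gtnNdvd.
  move=> /(PM (q.+1%:R^-1)%:A).
  by rewrite -[z * _ *+ _]scaler_nat -scalerAl mul1r scalerA mulVf // scale1r.
rewrite (big_setD1 i0) //= mulrA => Pz; apply: (zx p.-1); first by rewrite prednK.
apply: (IH (S :\ i0) _ D' _ _ _ _ Pz).
- by move: Sm; rewrite (cardsD1 i0) i0S add1n ltnS.
- move=> j; rewrite !inE => /andP[ji jS]; have [DjD DjP] := DP _ jS; split=> [u v|u Pu].
    rewrite !D'E DjD D0D mulrDr mulrBl mulrBr opprD addrACA; congr (_ - _ + (_ - _)).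
      by rewrite mulrA.
    by rewrite mulrCA.
  by rewrite D'E -mulNr; apply: PD; [apply: DjP | rewrite D0E; apply/PM/PM/D0P].
- move=> j l; rewrite !inE => /andP[ji jS] /andP[_ lS].
  by rewrite D'E rmorphB rmorphM /= !Dx // (negPf ji) mul0r subr0.
- move=> j; rewrite !inE => /andP[ji jS]; have [DjD DjP] := DP _ jS.
  have D'D : derivation (D' j).
    move=> u v; rewrite !D'E DjD D0D mulrDr mulrBl mulrBr opprD addrACA; congr (_ - _ + (_ - _)).
      by rewrite mulrA.
    by rewrite mulrCA.
  rewrite D'D derivationX // !D'E D0x mulr1 subrr mulr0 mul0rn mulr0 addr0.
  by rewrite D0E !Dz // !mulr0 subr0 mul0r.
Qed.

(** Every tangent vector extends to a vector field that respects the kernels of iterated Frobenius;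
    [measure_derivations] provides this for algebras of measures. *)
Hypothesis derivations : forall g : 'Hom(A, k^o),
  g 1 = 0 -> (forall u v, eps u = 0 -> eps v = 0 -> g (u * v) = 0) ->
  exists D : 'End(A), [/\ derivation D, forall u, eps (D u) = g u &
    forall e, (forall u, u ^+ (p ^ e) = 0 -> g u = 0) ->
      forall u, u ^+ (p ^ e) = 0 -> D u ^+ (p ^ e) = 0].

(* Downward induction on [e]: the derivations preserve the kernel of
   [u |-> u ^+ (p ^ e)], so they cancel the factors [x i ^+ p.-1]. *)
Lemma top_monomial_neq0 n (x : 'I_n -> A) (f : 'I_n -> nat) (g : 'I_n -> 'Hom(A, k^o)) :
    (forall i, [/\ g i 1 = 0,
        forall u v, eps u = 0 -> eps v = 0 -> g i (u * v) = 0,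
        forall j, g i (x j) = (i == j)%:R &
        forall e u, (e < f i)%N -> u ^+ (p ^ e) = 0 -> g i u = 0]) ->
  \prod_i x i ^+ (p ^ f i).-1 != 0.
Proof.
move=> gP.
have /boolp.choice[D DP] i : exists D : 'End(A), [/\ derivation D, forall u, eps (D u) = g i u &
    forall e, (e < f i)%N -> forall u, u ^+ (p ^ e) = 0 -> D u ^+ (p ^ e) = 0].
  have [g1 g2 gx gf] := gP i; have [D [D1 D2 D3]] := derivations g1 g2.
  by exists D; split=> // e ei; apply: D3 => u; apply: gf.
pose top e := \prod_i x i ^+ (p ^ (f i - e)).-1.
suff topP e : top e ^+ (p ^ e) != 0.
  have := topP 0%N; rewrite expr1 /top.
  by under eq_bigr do rewrite subn0.
pose E := (\sum_i f i)%N.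
have [l] := ubnP (E - e); elim: l e => // l IH e le.
have [Ee|eE] := leqP E e.
  rewrite /top big1 ?expr1n ?oner_eq0 // => i _.
  have -> : (f i - e = 0)%N by apply/eqP; rewrite subn_eq0 (leq_trans _ Ee) // /E (bigD1 i) //= leq_addr.
  by rewrite expn0 expr0.
have topS : top e.+1 ^+ (p ^ e.+1) != 0.
  by apply: IH; rewrite -ltnS (leq_trans _ le) // ltnS subnS prednK // subn_gt0.
apply: contra_neq topS; pose S := [set i | (e < f i)%N].
(* From [p^(a+1) - 1 = p (p^a - 1) + (p - 1)]. The first factor is a [p]-th power, hence killed by
   all derivations, and [derivations_top] strips off the second. *)
have -> : top e = top e.+1 ^+ p * \prod_(i in S) x i ^+ p.-1.
  rewrite /top -prodrXl [X in _ * X]big_mkcond -big_split /=; apply: eq_bigr => i _.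
  rewrite inE; case: ltnP => fe.
    rewrite -exprM -exprD; congr (_ ^+ _).
    rewrite -[(f i - e)%N]prednK ?subn_gt0 // -subnS expnS.
    have := expn_gt0 p (f i - e.+1); rewrite p_gt0 /=.
    case: (p ^ _)%N => // q _; case: (p) p_gt0 => // p' _.
    by rewrite mulnC mulSn addSn /= mulnC addnC mulnC.
  have -> : (f i - e = 0)%N by apply/eqP.
  have -> : (f i - e.+1 = 0)%N by apply/eqP; rewrite subn_eq0 leqW.
  by rewrite expn0 expr0 expr1n mulr1.
move=> t0; rewrite expnS exprM.
apply: (@derivations_top n x (fun u => u ^+ (p ^ e) = 0) _ _ S D) t0.
- by move=> u v u0 v0; rewrite (frobD pchar_k) u0 v0 addr0.
- by move=> u v v0; rewrite exprMn v0 mulr0.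
- by move=> i; rewrite inE => ei; have [D1 _ D3] := DP i; split=> // u; apply: D3.
- by move=> i j _ _; have [_ -> _] := DP i; have [_ _ ->] := gP i.
- by move=> i _; have [D1 _ _] := DP i; apply: derivation_frob.
Qed.

End TopMonomial.

(** * Monomial bases of truncated polynomial algebras *)

Section TruncatedMonomials.
Variables (k : fieldType) (A0 : falgType k).
Hypothesis cA : commutative ( *%R : A0 -> A0 -> A0).
Local Notation A := (com_falg cA).
Variables (n : nat) (x : 'I_n -> A) (q : 'I_n -> nat).
Hypothesis q_gt0 : forall i, (0 < q i)%N.
Hypothesis xq : forall i, x i ^+ q i = 0.
Hypothesis top_neq0 : \prod_i x i ^+ (q i).-1 != 0.
Hypothesis generated : forall V : {vspace A}, 1 \in V ->
  (forall i u, u \in V -> x i * u \in V) -> V = fullv.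

Local Notation exps := {ffun 'I_n -> nat}.
Implicit Types (a b : exps) (u v : A).

Definition mon a : A := \prod_i x i ^+ a i.
Definition inbox a : bool := [forall i, (a i < q i)%N].
Definition eadd a b : exps := [ffun i => a i + b i]%N.
Definition esub a b : exps := [ffun i => a i - b i]%N.
Definition esingle i m : exps := [ffun j => if j == i then m else 0%N].
Definition etop : exps := [ffun i => (q i).-1].
Definition ezero : exps := [ffun=> 0%N].

Lemma monD a b : mon (eadd a b) = mon a * mon b.
Proof. by rewrite -big_split; apply: eq_bigr => i _; rewrite ffunE exprD. Qed.

Lemma mon0 : mon ezero = 1.
Proof. by apply: big1 => i _; rewrite ffunE. Qed.

Lemma mon_single i m : mon (esingle i m) = x i ^+ m.
Proof.
rewrite /mon (bigD1 i) //= ffunE eqxx big1 ?mulr1 // => j /negPf ji.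
by rewrite ffunE ji.
Qed.

Lemma mon_out a : ~~ inbox a -> mon a = 0.
Proof.
rewrite negb_forall => /existsP[i]; rewrite -leqNgt => qa.
by rewrite /mon (bigD1 i) //= -(subnK qa) exprD xq mulr0 mul0r.
Qed.

Lemma mon_top_neq0 : mon etop != 0.
Proof. by rewrite /mon; under eq_bigr do rewrite ffunE. Qed.

Lemma inboxP a : reflect (forall i, (a i < q i)%N) (inbox a).
Proof. exact: forallP. Qed.

Lemma etop_in : inbox etop.
Proof. by apply/inboxP => i; rewrite ffunE prednK. Qed.

Lemma ezero_in : inbox ezero.
Proof. by apply/inboxP => i; rewrite ffunE. Qed.

Let Q := (\sum_i q i)%N.
Definition box : seq exps :=
  undup (filter inbox [seq [ffun i => nat_of_ord (b i)] | b : {ffun 'I_n -> 'I_Q}]).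

Lemma mem_box a : (a \in box) = inbox a.
Proof.
rewrite mem_undup mem_filter; apply: andb_idr => ab.
have aQ i : (a i < Q)%N.
  by rewrite (leq_trans (inboxP _ ab i)) // /Q (bigD1 i) //= leq_addr.
apply/mapP; exists [ffun i => Ordinal (aQ i)]; first by rewrite mem_enum.
by apply/ffunP => i; rewrite !ffunE.
Qed.

(** Take [a] of least degree among the terms left and multiply by the complementary monomial: [a]
    becomes the top monomial, while every other remaining term leaves the box and dies. *)
Lemma mon_independent (c : exps -> k) :
  \sum_(a <- box) c a *: mon a = 0 -> forall a, inbox a -> c a = 0.
Proof.
move=> c0; pose deg a := (\sum_i a i)%N.
suff H m a : (deg a < m)%N -> inbox a -> c a = 0 by move=> a; apply: (H (deg a).+1).
elim: m a => // m IH a am ab.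
have /(congr1 ( *%R (mon (esub etop a)))) := c0.
rewrite mulr0 mulr_sumr (bigD1_seq a) ?mem_box ?undup_uniq //= big1_seq ?addr0.
  rewrite -scalerAr -monD => /eqP; rewrite scaler_eq0 => /orP[/eqP //|].
  have -> : eadd (esub etop a) a = etop.
    by apply/ffunP => i; rewrite !ffunE subnK // -ltnS prednK // (inboxP _ ab).
  by rewrite (negPf mon_top_neq0).
move=> b /andP[ba]; rewrite mem_box => bb; rewrite -scalerAr -monD.
have [bm|mb] := ltnP (deg b) m; first by rewrite IH // scale0r.
rewrite mon_out ?scaler0 //; apply: contra ba => /inboxP h.
have le i : (b i <= a i)%N.
  have := h i; rewrite !ffunE -ltnS => hh.
  have ai : (a i <= (q i).-1)%N by rewrite -ltnS prednK // (inboxP _ ab).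
  rewrite -(leq_add2l ((q i).-1 - a i)) subnK // -ltnS prednK //.
have eqd : deg b = deg a.
  by apply/eqP; rewrite eqn_leq leq_sum //= (leq_trans _ mb).
apply/eqP/ffunP => i; apply/eqP; rewrite eqn_leq le /=.
move/eqP: eqd; rewrite /deg (bigD1 i) //= [X in _ == X](bigD1 i) //=.
apply: contraTT; rewrite -ltnNge => lt; rewrite neq_ltn; apply/orP; left.
by rewrite -addSn leq_add // leq_sum.
Qed.

Lemma mon_free : free (map mon box).
Proof.
pose X := map_tuple mon (in_tuple box).
have XE (i : 'I_(size box)) : X`_i = mon (nth ezero box i) by rewrite (nth_map ezero).
apply/(@freeP _ _ _ X) => c c0 i.
pose c' a := if insub (index a box) is Some j then c j else 0.
have c'E (j : 'I_(size box)) : c' (nth ezero box j) = c j.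
  by rewrite /c' index_uniq ?undup_uniq // valK.
rewrite -c'E; apply: mon_independent; last by rewrite -mem_box mem_nth.
rewrite (big_nth ezero) big_mkord -[RHS]c0; apply: eq_bigr => j _.
by rewrite c'E XE.
Qed.

Lemma mon_span (V : {vspace A}) : (forall a, inbox a -> mon a \in V) -> V = fullv.
Proof.
move=> monV; apply/eqP; rewrite eqEsubv subvf.
rewrite -(generated (V := <<map mon box>>%VS)).
- by apply/span_subvP => _ /mapP[a + ->]; rewrite mem_box; apply: monV.
- by rewrite -mon0 memv_span // map_f // mem_box ezero_in.
move=> i u; have -> : x i * u = amull (x i) u by rewrite lfunE.
move=> uV; have : amull (x i) u \in (amull (x i) @: <<map mon box>>)%VS by rewrite memv_img.
apply/subvP; rewrite limg_span; apply/span_subvP => _ /mapP[_ /mapP[a _ ->] ->].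
rewrite lfunE /= -[x i]expr1 -mon_single -monD.
case: (boolP (inbox (eadd (esingle i 1) a))) => h; last by rewrite mon_out // mem0v.
by rewrite memv_span // map_f // mem_box.
Qed.

Lemma mon_ind (P : A -> Prop) : (forall c u v, P u -> P v -> P (c *: u + v)) ->
  (forall a, inbox a -> P (mon a)) -> forall u, P u.
Proof.
move=> PD Pm; have P0 : P 0.
  by have := PD (-1) _ _ (Pm _ ezero_in) (Pm _ ezero_in); rewrite scaleN1r addNr.
have [V VP] := vspace_of_pred P0 PD.
by move=> u; apply/VP; rewrite (@mon_span V) ?memvf // => a /Pm /VP.
Qed.

Lemma mon_ext (W : lmodType k) (G : exps -> W) : (forall a, ~~ inbox a -> G a = 0) ->
  exists F : {linear A -> W}, forall a, F (mon a) = G a.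
Proof.
move=> G0; have [F FP] := linear_of_free (map mon box) (map G box).
exists F => a; case: (boolP (inbox a)) => h; last by rewrite mon_out // linear0 G0.
have {}FP := FP mon_free; rewrite !size_map in FP; have {}FP := FP erefl.
move: FP; rewrite -map_comp => /eq_in_map; apply.
by rewrite mem_box.
Qed.

Lemma coef_exists : exists c : exps -> {linear A -> k^o},
  forall a b, c a (mon b) = ((a == b) && inbox b)%:R.
Proof.
have /boolp.choice[c cP] a : exists F : {linear A -> k^o},
    forall b, F (mon b) = ((a == b) && inbox b)%:R.
  by apply: (mon_ext (G := fun b => ((a == b) && inbox b)%:R)) => b /negPf ->; rewrite andbF.
by exists c.
Qed.

Definition coef : exps -> {linear A -> k^o} := projT1 (boolp.cid coef_exists).

Lemma coefE a b : coef a (mon b) = ((a == b) && inbox b)%:R.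
Proof. exact: (projT2 (boolp.cid coef_exists)). Qed.

Lemma mon_expand u : u = \sum_(a <- box) coef a u *: mon a.
Proof.
elim/mon_ind: u => [c u v {1}-> {1}->|b bb].
  by rewrite scaler_sumr -big_split; apply: eq_bigr => a _; rewrite linearP /= scalerDl scalerA.
rewrite (bigD1_seq b) ?mem_box ?undup_uniq //= coefE eqxx bb scale1r big1 ?addr0 //.
by move=> a /negPf ab; rewrite coefE ab scale0r.
Qed.

Lemma coef_inj u : (forall a, inbox a -> coef a u = 0) -> u = 0.
Proof.
move=> h; rewrite (mon_expand u) big1_seq // => a; rewrite mem_box => /h ->.
by rewrite scale0r.
Qed.

End TruncatedMonomials.

Section TruncatedPowers.
Variables (k : closedFieldType) (p : nat) (A0 : falgType k).
Hypothesis pchar_k : p \in [pchar k].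
Hypothesis cA : commutative ( *%R : A0 -> A0 -> A0).
Local Notation A := (com_falg cA).
Variables (n : nat) (x : 'I_n -> A) (f : 'I_n -> nat).
Hypothesis f_gt0 : forall i, (0 < f i)%N.
Let q i := (p ^ f i)%N.
Hypothesis xq : forall i, x i ^+ q i = 0.
Hypothesis top_neq0 : \prod_i x i ^+ (q i).-1 != 0.
Hypothesis generated : forall V : {vspace A}, 1 \in V ->
  (forall i u, u \in V -> x i * u \in V) -> V = fullv.

Let p_gt1 : (1 < p)%N := prime_gt1 (pcharf_prime pchar_k).
Let q_gt0 i : (0 < q i)%N. Proof. by rewrite expn_gt0 (ltnW p_gt1). Qed.
Let r i := (p ^ (f i).-1)%N.
Let r_gt0 i : (0 < r i)%N. Proof. by rewrite expn_gt0 (ltnW p_gt1). Qed.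
Let qE i : q i = (p * r i)%N. Proof. by rewrite /q /r -expnS prednK. Qed.

Local Notation exps := {ffun 'I_n -> nat}.
Local Notation mon := (mon x).
Local Notation inbox := (inbox q).
Local Notation coef := (coef q_gt0 xq top_neq0).
Local Notation mon_ind := (mon_ind q_gt0 xq generated).
Local Notation mon_ext := (mon_ext q_gt0 xq top_neq0).

Definition ygen i : A := x i ^+ r i.
Local Notation y := ygen.

Lemma ygen_p i : y i ^+ p = 0.
Proof. by rewrite -exprM mulnC -qE xq. Qed.

Lemma ygen_mon i a : y i * mon a = mon (eadd (esingle i (r i)) a).
Proof. by rewrite monD mon_single. Qed.

(** In [u ^+ p] the coefficient [c] at exponent [a] becomes [c ^+ p] at exponent [p a]. So [c = 0]
    unless [p a] leaves the box, and then some [a i >= r i], that is, [y i] divides the monomial. *)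
Lemma frob_kernel_generated (u : A) : u ^+ p = 0 ->
  exists w : 'I_n -> A, u = \sum_i w i * y i.
Proof.
move=> up; pose P (v : A) := exists w : 'I_n -> A, v = \sum_i w i * y i.
rewrite (mon_expand q_gt0 xq top_neq0 generated u) -/(P _) big_seq.
apply: (big_ind P) => [|_ _ [w ->] [w' ->]|a].
- by exists (fun=> 0); rewrite big1 // => i _; rewrite mul0r.
- by exists (fun i => w i + w' i); rewrite -big_split; apply: eq_bigr => i _; rewrite mulrDl.
rewrite mem_box // => ab; pose pa (b : exps) : exps := [ffun i => p * b i]%N.
case: (boolP (inbox (pa a))) => [pab|].
  have : coef (pa a) (u ^+ p) = coef a u ^+ p.
    rewrite {1}(mon_expand q_gt0 xq top_neq0 generated u) -[X in _ ^+ X]expn1.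
    rewrite (frob_sum pchar_k) linear_sum expn1 (bigD1_seq a) ?mem_box ?undup_uniq //=.
    have monp b : mon b ^+ p = mon (pa b).
      by rewrite -prodrXl; apply: eq_bigr => i _; rewrite ffunE mulnC exprM.
    rewrite exprZn monp linearZ /= coefE eqxx pab -[_ *: _]/(_ * _) mulr1 big1 ?addr0 // => b ba.
    rewrite exprZn monp linearZ /= coefE; case: eqP => [/ffunP e|_]; last by rewrite scaler0.
    case/eqP: ba; apply/ffunP => i; have := e i; rewrite !ffunE => /eqP.
    by rewrite eqn_mul2l (gtn_eqF (ltnW p_gt1)) => /eqP.
  rewrite up linear0 => /esym/eqP; rewrite expf_eq0 => /andP[_ /eqP ->].
  by exists (fun=> 0); rewrite scale0r big1 // => i _; rewrite mul0r.
rewrite negb_forall => /existsP[i]; rewrite ffunE -leqNgt qE leq_pmul2l ?(ltnW p_gt1) // => ri.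
exists (fun j => if j == i then coef a u *: mon (esub a (esingle i (r i))) else 0).
rewrite (bigD1 i) //= eqxx big1 ?addr0 => [|j /negPf ->]; last by rewrite mul0r.
rewrite -scalerAl mulrC ygen_mon; congr (_ *: mon _); apply/ffunP => j.
by rewrite !ffunE; case: eqP => [->|_]; rewrite ?subn0 // subnKC.
Qed.

(** Differentiation in [y i]: the algebra is free over k[y_i] on the monomials with [a i < r i], and
    [a i %/ r i] is the exponent of [y i] in a monomial. *)
Lemma ygen_lowering i : exists D : {linear A -> A},
  forall j u, D (y j * u) = y j * D u + (i == j)%:R *: u.
Proof.
pose G (a : exps) : A := if inbox a then (a i %/ r i)%:R *: mon (esub a (esingle i (r i))) else 0.
have [|D DE] := mon_ext (G := G); first by move=> a /negPf; rewrite /G => ->.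
exists D => j; elim/mon_ind => [c u v Du Dv|a ab].
  rewrite mulrDr linearD -scalerAr linearZ Du Dv linearP mulrDr -scalerAr /=.
  by rewrite !scalerDr !scalerA [_ * c]mulrC -!addrA; congr (_ + _); rewrite addrCA.
rewrite ygen_mon !DE /G ab -scalerAr ygen_mon.
have [<-{j}|ij] := eqVneq i j.
  rewrite scale1r [in X in if X then _ else _](_ : inbox _ = (a i + r i < q i)%N); last first.
    apply/forallP/idP => [/(_ i)|h j]; first by rewrite !ffunE eqxx addnC.
    by rewrite !ffunE; case: eqP => [->|_]; rewrite ?(inboxP _ _ ab) // addnC.
  have e1 : esub (eadd (esingle i (r i)) a) (esingle i (r i)) = a.
    by apply/ffunP => j; rewrite !ffunE addKn.
  have e2 : (r i <= a i)%N -> eadd (esingle i (r i)) (esub a (esingle i (r i))) = a.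
    move=> ra; apply/ffunP => j; rewrite !ffunE.
    by case: eqP => [->|_]; rewrite ?subn0 // subnKC.
  case: ltnP => h.
    rewrite e1 !ffunE eqxx divnDl // divnn r_gt0 natrD scalerDl scale1r addrC.
    case: (leqP (r i) (a i)) => ra; first by rewrite e2.
    by rewrite divn_small // !scale0r.
  (* Overflow: [y i] kills the monomial, [a i %/ r i] is [p.-1], and the right-hand side is [p]
     times the monomial. *)
  have ra : (r i <= a i)%N.
    rewrite -(leq_add2r (r i)) (leq_trans _ h) // qE addnn -mul2n leq_mul2r.
    by rewrite p_gt1 orbT.
  rewrite e2 // -{2}[mon a]scale1r -scalerDl.
  have -> : (a i %/ r i = p.-1)%N.
    apply/eqP; rewrite eqn_leq -ltnS prednK ?(ltnW p_gt1) // ltn_divLR // -qE (inboxP _ _ ab) /=.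
    by rewrite leq_divRL // -subn1 mulnBl mul1n -qE leq_subLR addnC.
  by rewrite natr1 prednK ?(ltnW p_gt1) // (pcharf0 pchar_k) scale0r.
rewrite scale0r addr0 !ffunE (negPf ij) add0n.
have -> : eadd (esingle j (r j)) (esub a (esingle i (r i))) =
    esub (eadd (esingle j (r j)) a) (esingle i (r i)).
  apply/ffunP => l; rewrite !ffunE; case: eqP => [->|_]; rewrite ?add0n //.
  by rewrite eq_sym (negPf ij) !subn0.
case: ifP => // /negbT h; rewrite [mon _](mon_out xq) ?scaler0 //.
apply: contra h => /inboxP h; apply/inboxP => l; have := h l; rewrite !ffunE.
have [->|li] := eqVneq l i; rewrite ?subn0 // (negPf ij) add0n => _.
exact: (inboxP _ _ ab).
Qed.

Section LinearCombination.
Variable l : 'rV[k]_n.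
Definition ypoint : A := \sum_i l 0 i *: y i.

Lemma ypoint_p : ypoint ^+ p = 0.
Proof.
rewrite -[p in LHS]expn1 (frob_sum pchar_k) expn1 big1 // => i _.
by rewrite exprZn ygen_p scaler0.
Qed.

Hypothesis l_neq0 : l != 0.

(* The commutator of [D] and [ypoint] is the nonzero scalar [l 0 i], so that
   [ypoint ^+ p.-1 * iter p.-1 D u] is a nonzero multiple of [u]. *)
Lemma ypoint_exact (u : A) : ypoint * u = 0 -> exists v, u = ypoint ^+ p.-1 * v.
Proof.
have /rV0Pn[i li] := l_neq0.
move=> zu; have [D DE] := ygen_lowering i.
have DzE v : D (ypoint * v) = ypoint * D v + l 0 i *: v.
  rewrite !mulr_suml linear_sum.
  transitivity (\sum_j ((l 0 j *: y j) * D v + (l 0 j * (i == j)%:R) *: v)).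
    by apply: eq_bigr => j _; rewrite -!scalerAl linearZ /= DE scalerDr scalerA.
  rewrite big_split; congr (_ + _); rewrite (bigD1 i) //= eqxx mulr1 big1 ?addr0 // => j.
  by rewrite eq_sym => /negPf ->; rewrite mulr0 scale0r.
have zD j : ypoint * iter j.+1 D u = - (j.+1%:R * l 0 i) *: iter j D u.
  elim: j => [|j IH].
    have := DzE u; rewrite zu linear0 => /esym/eqP; rewrite addr_eq0 => /eqP ->.
    by rewrite mul1r scaleNr.
  have := DzE (iter j.+1 D u); rewrite IH linearZ /= => /eqP.
  rewrite -subr_eq => /eqP <-; rewrite -scalerBl; congr (_ *: _).
  by rewrite -opprD -[X in _ + X]mul1r -mulrDl natr1.
have [c c0 cE] : exists2 c, c != 0 & ypoint ^+ p.-1 * iter p.-1 D u = c *: u.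
  have : (p.-1 < p)%N by rewrite prednK ?(ltnW p_gt1).
  elim: (p.-1) => [|j IH] jp; first by exists 1; rewrite ?oner_eq0 // mul1r scale1r.
  have [c c0 cE] := IH (ltnW jp); exists (- (j.+1%:R * l 0 i) * c).
    by rewrite mulf_neq0 // oppr_eq0 mulf_neq0 // -(dvdn_pcharf pchar_k) gtnNdvd.
  by rewrite exprSr -mulrA zD -scalerAr cE scalerA.
exists (c^-1 *: iter p.-1 D u).
by rewrite -scalerAr cE scalerA mulVf // scale1r.
Qed.

End LinearCombination.

Variable eps : {lrmorphism A -> k^o}.

Lemma eps_mon a : eps (mon a) = (a == ezero n)%:R.
Proof.
have ex i : eps (x i) = 0.
  have /(congr1 eps) := xq i; rewrite rmorphXn rmorph0 => /eqP.
  by rewrite expf_eq0 => /andP[_ /eqP].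
have [->|] := eqVneq a (ezero n); first by rewrite mon0 rmorph1.
move=> /eqP a0; have [i ai] : exists i, a i != 0%N.
  apply/existsP; apply: contra_notT a0; rewrite negb_exists => /forallP h.
  by apply/ffunP => i; rewrite ffunE; apply/eqP; rewrite -[_ == _]negbK.
rewrite /mon (bigD1 i) //= rmorphM rmorphXn /= ex expr0n (negPf ai).
by rewrite mul0r.
Qed.

(** [F] is the projection onto k[X]/(X^(q i)) killing the other generators. Its values are kept as
    polynomials because the extension modules use the coefficient in degree [q i] of a product of
    two of them. *)
Lemma truncation_exists i : exists F : {linear A -> {poly k}},
  [/\ forall u, (size (F u) <= q i)%N, F 1 = 1,
      forall u v, F (u * v) = take_poly (q i) (F u * F v),
      forall u, (F u)`_0 = eps u &
      forall j, F (y j) = if i == j then 'X^(r i) else 0].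
Proof.
pose sg (a : exps) := a == esingle i (a i).
pose G (a : exps) : {poly k} := if inbox a && sg a then 'X^(a i) else 0.
have [|F FE] := mon_ext (G := G); first by move=> a /negPf; rewrite /G => ->.
have sgP (a : exps) : reflect (forall j, j != i -> a j = 0%N) (sg a).
  apply: (iffP eqP) => [/ffunP h j /negPf ji|h]; first by rewrite h ffunE ji.
  by apply/ffunP => j; rewrite ffunE; case: eqP => [->//|/eqP /h].
have in_sg (a : exps) : sg a -> inbox a = (a i < q i)%N.
  move=> /sgP h; apply/inboxP/idP => [//|ai j].
  by have [->//|/h ->] := eqVneq j i.
have sgD (a b : exps) : sg (eadd a b) = sg a && sg b.
  apply/sgP/andP => [h|[/sgP ha /sgP hb] j ji]; last by rewrite ffunE ha // hb.
  by split; apply/sgP => j /h /eqP; rewrite ffunE addn_eq0 => /andP[/eqP ? /eqP ?].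
have takeL (m : nat) (c : k) (P R : {poly k}) :
    take_poly m (c *: P + R) = c *: take_poly m P + take_poly m R.
  by rewrite linearP.
exists F; split.
- elim/mon_ind => [c u v Fu Fv|a ab].
    rewrite linearP (leq_trans (size_polyD _ _)) // geq_max Fv andbT.
    exact: leq_trans (size_scale_leq _ _) Fu.
  by rewrite FE /G ab; case: ifP => _; rewrite ?size_poly0 // size_polyXn (inboxP _ _ ab).
- rewrite -(mon0 x) FE /G ezero_in // (_ : sg _); first by rewrite ffunE.
  by apply/sgP => j _; rewrite ffunE.
- move=> u; elim/mon_ind => [c v w Fv Fw|b bb].
    by rewrite mulrDr -scalerAr !linearP /= mulrDr -scalerAr takeL Fv Fw.
  elim/mon_ind: u => [c v w Fv Fw|a ab].
    by rewrite mulrDl -scalerAl !linearP /= mulrDl -scalerAl takeL Fv Fw.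
  rewrite -monD !FE /G ab bb /= sgD.
  have [sa|_] := boolP (sg a); last by rewrite andbF mul0r take_poly0r.
  have [sb|_] := boolP (sg b); last by rewrite ?andbF mulr0 take_poly0r.
  rewrite in_sg ?sgD ?sa // andbT ffunE -exprD.
  apply/polyP => j; rewrite coef_take_poly; case: ltnP => h.
    rewrite coefXn; case: ifP => // /negbT; rewrite -leqNgt => qj.
    by rewrite gtn_eqF // (leq_trans h).
  rewrite coef0 coefXn; case: eqP => [->|_]; first by rewrite ltnNge h.
  by rewrite if_same.
- elim/mon_ind => [c u v Fu Fv|a ab]; first by rewrite !linearP coefD coefZ Fu Fv.
  rewrite FE eps_mon /G ab /=; have [sa|/sgP sa] := boolP (sg a); last first.
    rewrite coef0; case: eqP => // a0; case: sa => j _.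
    by rewrite a0 ffunE.
  rewrite coefXn; congr (_ %:R); congr (nat_of_bool _); apply/eqP/eqP => [ai|->].
    apply/ffunP => j; rewrite ffunE; have [->//|/(sgP _ sa)] := eqVneq j i.
    by [].
  by rewrite ffunE.
move=> j; rewrite -[y j]mulr1 -(mon0 x) ygen_mon FE /G.
have -> : eadd (esingle j (r j)) (ezero n) = esingle j (r j).
  by apply/ffunP => l; rewrite !ffunE addn0.
have -> : inbox (esingle j (r j)).
  apply/inboxP => l; rewrite ffunE; case: eqP => [->|//].
  by rewrite qE ltn_Pmull.
have [<-|ij] := eqVneq i j.
  rewrite (_ : sg _) /= ?ffunE ?eqxx //.
  by apply/sgP => l /negPf li; rewrite ffunE li.
rewrite (_ : sg _ = false) //; apply/sgP => /(_ j); rewrite eq_sym ij ffunE eqxx => /(_ isT) /eqP.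
by rewrite gtn_eqF.
Qed.

(** [L] is the top monomial, which spans the socle, and [tr] reads off its coefficient; monomials
    with complementary exponents are dual to each other for [tr (u * v)]. *)
Lemma frobenius_form : exists (L : A) (tr : {linear A -> k^o}),
  [/\ L != 0, forall u, tr (L * u) = eps u, forall u, u * L = eps u *: L,
      forall h : {linear A -> k^o}, exists z, forall u, tr (u * z) = h u &
      forall z, (forall u, tr (u * z) = 0) -> z = 0].
Proof.
have topL a : inbox a -> a != ezero n -> mon a * mon (etop q) = 0.
  move=> ab a0; rewrite -monD (mon_out xq) //; apply: contra a0 => /inboxP h.
  apply/eqP/ffunP => i; rewrite ffunE; have := h i; rewrite !ffunE => {}h.
  by apply/eqP; rewrite -leqn0 -ltnS -(ltn_add2r (q i).-1) add1n prednK.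
have epsL u : u * mon (etop q) = eps u *: mon (etop q).
  elim/mon_ind: u => [c u v eu ev|a ab].
    by rewrite mulrDl -scalerAl eu ev linearP scalerDl scalerA.
  rewrite eps_mon; have [->|a0] := eqVneq a (ezero n); last by rewrite topL ?scale0r.
  by rewrite mon0 mul1r scale1r.
have trL : coef (etop q) (mon (etop q)) = 1 by rewrite coefE eqxx etop_in.
exists (mon (etop q)), (coef (etop q)); split=> //.
- exact: mon_top_neq0.
- by move=> u; rewrite mulrC epsL linearZ /= trL -[_ *: _]/(_ * _) mulr1.
- move=> h; pose z := \sum_(b <- box q) h (mon (esub (etop q) b)) *: mon b.
  exists z; elim/mon_ind => [c u v eu ev|a ab]; first by rewrite mulrDl -scalerAl !linearP eu ev.
  have ca : inbox (esub (etop q) a).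
    by apply/inboxP => i; rewrite !ffunE (leq_ltn_trans (leq_subr _ _)) ?prednK.
  have le i : (a i <= (q i).-1)%N by rewrite -ltnS prednK // (inboxP _ _ ab).
  rewrite mulr_sumr linear_sum (bigD1_seq (esub (etop q) a)) ?mem_box ?undup_uniq //=.
  have ea : eadd a (esub (etop q) a) = etop q.
    by apply/ffunP => i; rewrite !ffunE subnKC.
  have -> : esub (etop q) (esub (etop q) a) = a.
    by apply/ffunP => i; rewrite !ffunE subKn.
  rewrite -scalerAr -monD ea linearZ /= trL -[_ *: _]/(_ * _) mulr1 big1 ?addr0 // => b ba.
  rewrite -scalerAr -monD linearZ /= coefE; case: eqP => [e|_]; last by rewrite scaler0.
  case/eqP: ba; apply/ffunP => i; have /ffunP/(_ i) := e; rewrite !ffunE => ->.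
  by rewrite addKn.
move=> z h; apply: (coef_inj (q_gt0 := q_gt0) (xq := xq) (top_neq0 := top_neq0) generated) => a ab.
rewrite -(h (mon (esub (etop q) a))); elim/mon_ind: z {h} => [c u v eu ev|b bb].
  by rewrite mulrDr -scalerAr !linearP eu ev.
have le i : (a i <= (q i).-1)%N by rewrite -ltnS prednK // (inboxP _ _ ab).
rewrite -monD !coefE bb andbT; congr (nat_of_bool _)%:R.
apply/eqP/andP => [->|[/eqP e _]]; last first.
  apply/ffunP => i; have /ffunP/(_ i) := e; rewrite !ffunE => ei.
  by apply/eqP; rewrite -(eqn_add2l ((q i).-1 - a i)) -ei subnK.
have -> : eadd (esub (etop q) b) b = etop q.
  by apply/ffunP => i; rewrite !ffunE subnK // -ltnS prednK // (inboxP _ _ bb).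
by rewrite eqxx etop_in.
Qed.

End TruncatedPowers.

Section LocalStructure.
Variables (k : closedFieldType) (p : nat) (A0 : falgType k).
Hypothesis pchar_k : p \in [pchar k].
Hypothesis cA : commutative ( *%R : A0 -> A0 -> A0).
Local Notation A := (com_falg cA).
Variable eps : {lrmorphism A -> k^o}.
Hypothesis nilp : forall u : A, eps u = 0 -> exists n, u ^+ n = 0.

(** One element at a time: absorb the contributions of the other elements into [S']; then
    [T <= S' + b T] iterates to [T <= S' + b^N T], and [b^N = 0]. *)
Lemma nilpotent_nakayama (bs : seq A) (T S : {vspace A}) :
    (forall b, b \in bs -> exists n, b ^+ n = 0) ->
    (forall b u, b \in bs -> u \in S -> b * u \in S) ->
    (forall b u, b \in bs -> u \in T -> b * u \in T) ->
    (T <= S + \sum_(b <- bs) amull b @: T)%VS ->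
  (T <= S)%VS.
Proof.
elim: bs S => [|b bs IH] S nil Sst Tst; first by rewrite big_nil addv0.
rewrite big_cons addvA [(S + _)%VS]addvC -addvA addvC; set S' := (S + _)%VS => TS.
have amullE c (u : A) : amull c u = c * u by rewrite lfunE.
have S'st u : u \in S' -> b * u \in S'.
  move=> /memv_addP[s sS [t tT ->]]; rewrite mulrDr memv_add //.
    by apply: Sst => //; apply: mem_head.
  rewrite -amullE; have : amull b t \in (amull b @: (\sum_(c <- bs) amull c @: T))%VS.
    exact: memv_img.
  rewrite limg_sum; apply/subvP; rewrite !big_seq.
  elim/big_rec2: _ => [|c V1 V2 cbs V12]; first exact: subvv.
  rewrite addvS //; apply/subvP => _ /memv_imgP[_ /memv_imgP[w wT ->] ->].
  rewrite !amullE mulrCA -(amullE c) memv_img // Tst ?mem_head //.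
apply: IH => [c cbs|c u cbs|c u cbs|].
- by apply: nil; rewrite inE cbs orbT.
- by apply: Sst; rewrite inE cbs orbT.
- by apply: Tst; rewrite inE cbs orbT.
have [N bN] := nil b (mem_head _ _).
have step j u : u \in T -> exists2 t, t \in T & u - b ^+ j * t \in S'.
  elim: j => [|j IHj] uT; first by exists u; rewrite // mul1r subrr mem0v.
  have [t tT ut] := IHj uT.
  have /memv_addP[s sS' [_ /memv_imgP[t' t'T ->] et]] := subvP TS t tT.
  exists t' => //; rewrite amullE in et.
  have -> : u - b ^+ j.+1 * t' = (u - b ^+ j * t) + b ^+ j * s.
    by rewrite et mulrDr mulrA -exprSr opprD addrA addrAC subrK.
  rewrite memvD //; elim: (j) => [|i IHi]; first by rewrite mul1r.
  by rewrite exprS -mulrA S'st.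
by apply/subvP => u uT; have [t _] := step N u uT; rewrite bN mul0r subr0.
Qed.

(** Nakayama twice: the [x i] generate the augmentation ideal as an ideal, so the whole algebra is
    [V] plus the multiples of the [x i], and hence is [V]. *)
Lemma generated_of_cotangent n (x : 'I_n -> A) :
    (forall i, exists m, x i ^+ m = 0) ->
    (lker (linfun eps) <= lker (linfun eps) * lker (linfun eps) + \sum_i <[x i]>)%VS ->
  forall V : {vspace A}, 1 \in V ->
  (forall i u, u \in V -> x i * u \in V) -> V = fullv.
Proof.
set aug := lker _ => xnil aug2 V V1 Vst.
have augP u : (u \in aug) = (eps u == 0) by rewrite memv_ker lfunE.
pose W : {vspace A} := (\sum_i amull (x i) @: fullv)%VS.
have amullE c (u : A) : amull c u = c * u by rewrite lfunE.
have augW : (aug <= W)%VS.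
  apply: (@nilpotent_nakayama (vbasis aug)) => [b baug|b u _ /memv_sumP[w wi ->]|b u _|].
  - by apply: nilp; apply/eqP; rewrite -augP vbasis_mem.
  - rewrite mulr_sumr; apply: memv_sumr => i _.
    by have /memv_imgP[t _ ->] := wi i isT; rewrite amullE mulrCA -(amullE (x i)); apply: memv_img; apply: memvf.
  - by rewrite !augP rmorphM /= => /eqP ->; rewrite mulr0.
  apply: subv_trans aug2 _; rewrite addvC; apply: addvS.
    apply/subv_sumP => i _; apply: (sumv_sup i) => //.
    rewrite -memvE -[x i in X in X \in _]mulr1 -(amullE (x i)).
    by apply: memv_img; apply: memvf.
  apply/prodvP => b u baug uaug; rewrite (coord_vbasis baug) mulr_suml.
  apply: memv_suml => i _; rewrite -scalerAl; apply: memvZ.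
  have bi : (vbasis aug)`_i \in vbasis aug by rewrite mem_nth ?size_tuple.
  rewrite -amullE; move: (memv_img (amull (vbasis aug)`_i) uaug); apply/subvP.
  by rewrite (big_rem _ bi) /= addvSl.
apply/eqP; rewrite eqEsubv subvf /=.
apply: (@nilpotent_nakayama (map x (enum 'I_n))) => [_ /mapP[i _ ->]|_ u /mapP[i _ ->]|b u _ _|].
- exact: xnil.
- exact: Vst.
- exact: memvf.
apply/subvP => u _; rewrite -[u](subrK (eps u)%:A) addrC memv_add ?memvZ //.
rewrite big_map big_enum /=; apply: (subvP augW).
by rewrite augP linearB linearZ /= rmorph1 -[_ *: 1]/(_ * _) mulr1 subrr.
Qed.

Hypothesis derivations : forall g : 'Hom(A, k^o),
  g 1 = 0 -> (forall u v, eps u = 0 -> eps v = 0 -> g (u * v) = 0) ->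
  exists D : 'End(A), [/\ derivation D, forall u, eps (D u) = g u &
    forall e, (forall u, u ^+ (p ^ e) = 0 -> g u = 0) ->
      forall u, u ^+ (p ^ e) = 0 -> D u ^+ (p ^ e) = 0].

Lemma truncated_presentation : exists n (x : 'I_n -> A) (f : 'I_n -> nat),
  [/\ forall i, (0 < f i)%N, forall i, x i ^+ (p ^ f i) = 0,
      \prod_i x i ^+ (p ^ f i).-1 != 0 &
      forall V : {vspace A}, 1 \in V ->
        (forall i u, u \in V -> x i * u \in V) -> V = fullv].
Proof.
have [n [x [f [g [xP augP gP]]]]] := adapted_generators pchar_k nilp.
exists n, x, f; split=> [i|i||].
- by have [] := xP i.
- by have [] := xP i.
- exact: (top_monomial_neq0 pchar_k nilp derivations gP).
apply: generated_of_cotangent augP => i.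
by exists (p ^ f i)%N; have [] := xP i.
Qed.

End LocalStructure.

(** * Algebras of measures *)

Section Measure.
Variables (k : fieldType) (G : finGroupScheme k).
Implicit Types (a b c : G) (u v : measure G).

Definition shift a u : measure G :=
  ((u : 'Hom(G, k^o)) \o amull a)%VF.

Lemma shiftE a u b : measure_ev (shift a u) b = measure_ev u (a * b).
Proof. by rewrite /measure_ev comp_lfunE [amull a b]lfunE. Qed.

Lemma measure_ev0 a : measure_ev (0 : measure G) a = 0.
Proof. exact: zero_lfunE. Qed.

Lemma measure_ev_sum (I : Type) (r : seq I) (P : pred I) (F : I -> measure G) a :
  measure_ev (\sum_(i <- r | P i) F i) a = \sum_(i <- r | P i) measure_ev (F i) a.
Proof. exact: (big_morph (fun u => measure_ev u a) (fun u v => measure_evD u v a) (measure_ev0 a)). Qed.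

Lemma shift_linear a : linear (shift a).
Proof.
by move=> c u v; apply: measureP => b; rewrite !(shiftE, measure_evD, measure_evZ).
Qed.
HB.instance Definition _ a :=
  GRing.isLinear.Build k (measure G) (measure G) _ (shift a) (shift_linear a).

Lemma shift_linearl u : linear (shift^~ u).
Proof.
move=> c a b; apply: measureP => d.
by rewrite measure_evD measure_evZ !shiftE mulrDl -scalerAl linearP.
Qed.

Lemma shift1 u : shift 1 u = u.
Proof. by apply: measureP => b; rewrite shiftE mul1r. Qed.

Lemma shift_shift a b u : shift a (shift b u) = shift (a * b) u.
Proof. by apply: measureP => c; rewrite !shiftE mulrA (coordC b a). Qed.

Definition pairing u v (t : tensor G G) : k^o :=
  tlift (fun a b => measure_ev u a * measure_ev v b) t.

Lemma pairing_tens u v a b : pairing u v (tens a b) = measure_ev u a * measure_ev v b.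
Proof.
by rewrite [LHS]tlift_tens // => [c|c] d e f; rewrite linearP ?mulrDl ?mulrDr -?scalerAl -?scalerAr.
Qed.

Lemma pairing_linear u v : linear (pairing u v).
Proof. exact: tlift_is_linear. Qed.
HB.instance Definition _ u v :=
  GRing.isLinear.Build k (tensor G G) k^o _ (pairing u v) (pairing_linear u v).

Lemma measure_evM u v a : measure_ev (u * v) a = pairing u v (comul G a).
Proof. exact: convolE. Qed.

Lemma measure_ev1 a : measure_ev (1 : measure G) a = counit G a.
Proof. exact: convol1E. Qed.

Lemma shiftM a u v :
  shift a (u * v) = tlift (fun b c => shift b u * shift c v : measure G) (comul G a).
Proof.
apply: measureP => d; rewrite shiftE measure_evM comulM /tens_mul tlift_comp.
rewrite -[RHS]/(fun_of_lfun _ d).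
have evl : linear (fun u : measure G => measure_ev u d).
  by move=> e w w'; rewrite measure_evD measure_evZ.
pose ev := HB.pack_for {linear measure G -> k^o} (fun u : measure G => measure_ev u d)
  (GRing.isLinear.Build k (measure G) k^o _ _ evl).
rewrite -[RHS]/(ev _) tlift_comp; apply: eq_tlift => b c /=.
rewrite measure_evM [LHS]tlift_comp; apply: eq_tlift => e f.
by rewrite /= pairing_tens !shiftE.
Qed.

Definition ubase i : measure G :=
  linfun (fun b : G => v2r b 0 i : k^o).

Lemma ubaseE i b : measure_ev (ubase i) b = v2r b 0 i.
Proof.
have l : linear (fun b : G => v2r b 0 i : k^o) by move=> c a d; rewrite linearP !mxE.
pose f := HB.pack_for {linear G -> k^o} (fun b : G => v2r b 0 i : k^o)
  (GRing.isLinear.Build k G k^o _ _ l).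
by rewrite /measure_ev /ubase -[LHS]/(linfun f b) lfunE.
Qed.

Lemma ubase_vbase i j : measure_ev (ubase i) (vbase j) = (i == j)%:R.
Proof. by rewrite ubaseE r2vK mxE eqxx eq_sym. Qed.

Lemma measure_expand u : u = \sum_i measure_ev u (vbase i) *: ubase i.
Proof.
apply: measureP => a; rewrite measure_ev_sum {1}(vbase_sum a) linear_sum.
apply: eq_bigr => i _; rewrite measure_evZ ubaseE linearZ /=.
by rewrite -[LHS]/(_ * _) -[RHS]/(_ * _) mulrC.
Qed.

Lemma pairing_ubase i j t : pairing (ubase i) (ubase j) t = (t : 'M_(_, _)) i j.
Proof.
have E i' j' : measure_ev (ubase i) (vbase i') * measure_ev (ubase j) (vbase j') =
    ((i == i') && (j == j'))%:R by rewrite !ubase_vbase -natrM mulnb.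
rewrite /pairing /tlift (bigD1 i) //= [X in _ + X]big1 ?addr0 => [|i' ii].
  rewrite (bigD1 j) //= big1 ?addr0 => [|j' jj].
    by rewrite E !eqxx -[LHS]/(_ * _) mulr1.
  by rewrite E [j == j']eq_sym (negPf jj) andbF scaler0.
by rewrite big1 // => j' _; rewrite E [i == i']eq_sym (negPf ii) scaler0.
Qed.

Lemma tensor_separated (s t : tensor G G) :
  (forall u v, pairing u v s = pairing u v t) -> s = t.
Proof. by move=> h; apply/matrixP => i j; rewrite -!pairing_ubase. Qed.

Lemma measure_dual (g : {linear measure G -> k^o}) : exists a, forall u, measure_ev u a = g u.
Proof.
exists (\sum_i g (ubase i) *: vbase i) => u; rewrite {2}(measure_expand u) !linear_sum.
apply: eq_bigr => i _; rewrite !linearZ /= -[LHS]/(_ * _) -[RHS]/(_ * _); exact: mulrC.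
Qed.

Definition augmentation u : k^o := measure_ev u 1.

Lemma augmentation_linear : linear augmentation.
Proof. by move=> c u v; rewrite /augmentation measure_evD measure_evZ. Qed.

Lemma augmentation_monoid : monoid_morphism augmentation.
Proof.
split=> [|u v]; first by rewrite /augmentation measure_ev1 rmorph1.
by rewrite /augmentation measure_evM comul1 pairing_tens.
Qed.

HB.instance Definition _ :=
  GRing.isLinear.Build k (measure G) k^o _ augmentation augmentation_linear.
HB.instance Definition _ :=
  GRing.isMonoidMorphism.Build (measure G) k^o augmentation augmentation_monoid.

Lemma abelian_measure : abelian_scheme G -> commutative ( *%R : measure G -> measure G -> measure G).
Proof.
move=> ab u v; apply: measureP => a; rewrite !measure_evM -{1}(ab a) /tswap.
rewrite [LHS]tlift_comp; apply: eq_tlift => b c.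
by rewrite /= pairing_tens mulrC.
Qed.

(** Pairing [comul G a] with [u] and [v] gives [g (u * v)]; once both are split into scalar and
    augmentation parts, only the mixed terms survive. By [shiftM], primitivity makes [shift a] a
    derivation. *)
Lemma primitive_of_derivation (g : {linear measure G -> k^o}) a :
    (forall u, measure_ev u a = g u) -> g 1 = 0 ->
    (forall u v, augmentation u = 0 -> augmentation v = 0 -> g (u * v) = 0) ->
  comul G a = tens a 1 + tens 1 a.
Proof.
move=> ga g1 g2; apply: tensor_separated => u v.
rewrite -measure_evM ga linearD /= !pairing_tens !ga.
rewrite -[measure_ev u 1]/(augmentation u) -[measure_ev v 1]/(augmentation v).
pose r (w : measure G) : measure G := w - (augmentation w : k) *: (1 : measure G).
have rE w : w = (augmentation w : k) *: (1 : measure G) + r w by rewrite addrC subrK.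
have r0 w : augmentation (r w) = 0.
  by rewrite /r linearB linearZ rmorph1 /= -[_ *: _]/(_ * _) mulr1 subrr.
have gr w : g (r w) = g w by rewrite linearB linearZ /= g1 scaler0 subr0.
clearbody r.
have -> : u * v = (augmentation u : k) *: ((augmentation v : k) *: (1 : measure G))
    + (augmentation u : k) *: r v + ((augmentation v : k) *: r u + r u * r v).
  by rewrite {1}(rE u) {1}(rE v) mulrDl !mulrDr -!scalerAl -!scalerAr !mul1r mulr1.
have g2r : g (r u * r v) = 0 by apply: g2.
rewrite !linearD /= g2r addr0 !linearZ /= g1 !gr !scaler0 add0r addrC.
by congr (_ + _); apply: mulrC.
Qed.

End Measure.

Lemma frobD_comm (R : pzRingType) (p : nat) (x y : R) :
  prime p -> p%:R = 0 :> R -> GRing.comm x y -> (x + y) ^+ p = x ^+ p + y ^+ p.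
Proof.
move=> p_pr p0 cxy; rewrite exprDn_comm //; case: p p_pr p0 => // p p_pr p0.
rewrite big_ord_recr big_ord_recl /= subn0 subnn bin0 binn !mulr1n expr0 mulr1 mul1r.
rewrite big1 ?addr0 // => i _.
have /dvdnP[c ->] : (p.+1 %| 'C(p.+1, bump 0 i))%N.
  by rewrite prime_dvd_bin // /bump /= ltnS ltn_ord.
by rewrite mulrnA -mulr_natr p0 mulr0.
Qed.

Lemma frob_sum_comm (R : pzRingType) (p e : nat) (I : Type) (r : seq I) (F : I -> R) :
    prime p -> p%:R = 0 :> R -> (forall i j, GRing.comm (F i) (F j)) ->
  (\sum_(i <- r) F i) ^+ (p ^ e) = \sum_(i <- r) F i ^+ (p ^ e).
Proof.
move=> p_pr pR cF; have p_gt0 := prime_gt0 p_pr.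
elim: e => [|e IH].
  by rewrite expr1; apply: eq_bigr => i _; rewrite expr1.
rewrite expnSr exprM IH; elim: r {IH} => [|i r IHr].
  by rewrite !big_nil expr0n gtn_eqF.
rewrite !big_cons exprM -IHr frobD_comm //.
by apply: commr_sum => j _; apply/commrX/commr_sym/commrX.
Qed.

Lemma frob_root (k : closedFieldType) n (c : k) : (0 < n)%N -> exists d, d ^+ n = c.
Proof.
move=> n0; have [d dn] := solve_monicpoly (fun i => if i == 0%N then c else 0) n0.
exists d; rewrite dn; case: n n0 {dn} => // n _.
by rewrite big_ord_recl expr0 mulr1 big1 ?addr0 // => i _; rewrite mul0r.
Qed.

(** * Frobenius and the comultiplication of the algebra of measures *)

Section ComultiplicationFrobenius.
Variables (k : fieldType) (p : nat) (A0 : falgType k).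
Hypothesis pchar_k : p \in [pchar k].
Hypothesis cA : commutative ( *%R : A0 -> A0 -> A0).
Local Notation A := (com_falg cA).
(** In the application [s i] is the shift by the [i]-th basis function, [t] is the dual basis and
    [gamma] holds the structure constants of [comul]; then [u |-> sum_i s_i(u) (x) t_i] is the
    comultiplication of kG, dual to the product of k[G]. *)
Variables (N : nat) (s : 'I_N -> A -> A) (t : 'I_N -> A).
Variable gamma : 'I_N -> 'I_N -> 'I_N -> k.
Hypothesis s0 : forall l, s l 0 = 0.
Hypothesis sM : forall l u v,
  s l (u * v) = \sum_i \sum_j gamma l i j *: (s i u * s j v).
Hypothesis tM : forall i j, t i * t j = \sum_l gamma l i j *: t l.
Implicit Types u v w : A.

(* [A (x) A] is realised by matrices over [A], through the regular
   representation of the second factor; the hypotheses say that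
   [u |-> sum_i s_i(u) (x) t_i] is multiplicative. *)
Let d := dim A0.
Let rho v : 'M[k]_d := lin1_mx (v2r \o amulr (v : A0) \o r2v).
Let rhoA v : 'M[A]_d := map_mx (in_alg A) (rho v).
Let delta u : 'M[A]_d := \sum_i s i u *: rhoA (t i).

Let rhoE (w v : A) : v2r (w : A0) *m rho v = v2r (w * v : A0).
Proof. by rewrite mul_rV_lin1 /= v2rK lfunE. Qed.

Let rhoM u v : rho (u * v) = rho u *m rho v.
Proof.
apply/row_matrixP => i; rewrite !rowE mulmxA.
have -> : delta_mx 0 i = v2r (@vbase k A0 i) by rewrite r2vK.
by rewrite !rhoE mulrA.
Qed.

Let rhoP c u v : rho (c *: u + v) = c *: rho u + rho v.
Proof.
apply/row_matrixP => i; rewrite !rowE mulmxDr -scalemxAr.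
have -> : delta_mx 0 i = v2r (@vbase k A0 i) by rewrite r2vK.
by rewrite !rhoE mulrDr -scalerAr linearP.
Qed.

Let rhoAM u v : rhoA (u * v) = rhoA u *m rhoA v.
Proof. by rewrite /rhoA rhoM map_mxM. Qed.

Let rhoA_sum I (r : seq I) (c : I -> k) (w : I -> A) :
  rhoA (\sum_(i <- r) c i *: w i) = \sum_(i <- r) (c i)%:A *: rhoA (w i).
Proof.
elim: r => [|i r IH].
  rewrite !big_nil; have /eqP := rhoP 1 0 0; rewrite !scale1r addr0 -subr_eq subrr => /eqP e.
  by rewrite /rhoA -e map_mx0.
by rewrite !big_cons -IH /rhoA rhoP map_mxD map_mxZ.
Qed.

Let rhoC u v : rhoA u *m rhoA v = rhoA v *m rhoA u.
Proof. by rewrite -(rhoAM u v) -(rhoAM v u) mulrC. Qed.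

Let scale_mulmx (a b : A) (X Y : 'M[A]_d) : (a *: X) *m (b *: Y) = (a * b) *: (X *m Y).
Proof. by rewrite -scalemxAl -scalemxAr scalerA. Qed.

Let deltaM u v : delta (u * v) = delta u *m delta v.
Proof.
transitivity (\sum_l \sum_i \sum_j
    ((gamma l i j)%:A * (s i u * s j v)) *: rhoA (t l)).
  apply: eq_bigr => l _; rewrite sM scaler_suml; apply: eq_bigr => i _.
  by rewrite scaler_suml; apply: eq_bigr => j _; rewrite -scalerAl mul1r.
rewrite /delta mulmx_suml exchange_big; apply: eq_bigr => i _ /=.
rewrite mulmx_sumr exchange_big; apply: eq_bigr => j _ /=.
rewrite scale_mulmx -rhoAM tM rhoA_sum scaler_sumr.
by apply: eq_bigr => l _; rewrite scalerA mulrC.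
Qed.

Let delta_frob u e : delta (u ^+ (p ^ e)) =
  \sum_i s i u ^+ (p ^ e) *: rhoA (t i ^+ (p ^ e)).
Proof.
have p_pr := pcharf_prime pchar_k.
have q_gt0 : (0 < p ^ e)%N by rewrite expn_gt0 prime_gt0.
pose F i : 'M[A]_d := s i u *: rhoA (t i).
have F_comm i j : GRing.comm (F i) (F j).
  rewrite /GRing.comm; change (F i *m F j = F j *m F i).
  by rewrite /F !scale_mulmx rhoC mulrC.
have p0 : p%:R = 0 :> 'M[A]_d.
  have pA : p \in [pchar A] by rewrite pchar_lalg.
  rewrite -[LHS]/((1%:M : 'M[A]_d) *+ p) -raddfMn /=.
  by rewrite (pcharf0 pA) raddf0.
have -> : delta (u ^+ (p ^ e)) = (\sum_i F i) ^+ (p ^ e).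
  (* [delta] is multiplicative but possibly not unital, so powers are compared from exponent one
     upwards. *)
  rewrite -[(p ^ e)%N](prednK q_gt0); elim: (_.-1) => [|m IH]; first by rewrite !expr1.
  by rewrite exprSr deltaM IH [RHS]exprSr.
rewrite (@frob_sum_comm _ p e _ _ F p_pr p0 F_comm); apply: eq_bigr => i _.
have E m : F i ^+ m.+1 = s i u ^+ m.+1 *: rhoA (t i ^+ m.+1).
  elim: m => [|m IH]; first by rewrite !expr1.
  by rewrite exprSr IH (exprSr (s i u) m.+1) (exprSr (t i) m.+1) rhoAM -scale_mulmx.
by rewrite -[(p ^ e)%N](prednK q_gt0) E.
Qed.

Let rhoA_separated (c w : 'I_N -> A) (h : {linear A -> k^o}) :
  \sum_i c i *: rhoA (w i) = 0 -> \sum_i h (w i) *: c i = 0.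
Proof.
pose one : 'rV[A]_d := map_mx (in_alg A) (v2r (1 : A0)).
move=> e0; have e : \sum_i one *m (c i *: rhoA (w i)) = 0 by rewrite -mulmx_sumr e0 mulmx0.
have e' j : \sum_i v2r (w i : A0) 0 j *: c i = 0.
  move/matrixP: e => /(_ 0 j); rewrite [RHS]mxE summxE => e; rewrite -[RHS]e.
  apply: eq_bigr => i _; rewrite -scalemxAr -map_mxM (rhoE 1) mul1r [RHS]mxE [X in _ * X]mxE.
  by rewrite mulr_algr.
pose b (j : 'I_d) : A := @vbase k A0 j.
have hw i : h (w i) = \sum_j v2r (w i : A0) 0 j * h (b j).
  rewrite {1}(vbase_sum (w i : A0)) linear_sum.
  by apply: eq_bigr => j _; rewrite linearZ.
under eq_bigr do rewrite hw scaler_suml.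
rewrite exchange_big big1 // => j _.
by under eq_bigr do rewrite mulrC -scalerA; rewrite -scaler_sumr e' scaler0.
Qed.

(** [delta (u ^+ (p ^ e))] is zero and is computed factor by factor; apply [h] to the second
    factor. *)
Lemma comultiplication_frob e u (h : {linear A -> k^o}) :
  u ^+ (p ^ e) = 0 -> \sum_i h (t i ^+ (p ^ e)) *: s i u ^+ (p ^ e) = 0.
Proof.
move=> u0; apply: rhoA_separated; rewrite -delta_frob u0.
by rewrite /delta big1 // => i _; rewrite s0 scale0r.
Qed.

End ComultiplicationFrobenius.

Section MeasureDerivations.
Variables (k : closedFieldType) (p : nat).
Hypothesis pchar_k : p \in [pchar k].
Variable G : finGroupScheme k.
Hypothesis abG : abelian_scheme G.
Local Notation cA := (abelian_measure abG).
Local Notation A := (com_falg cA).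
Implicit Types u v w : A.

Let p_gt0 : (0 < p)%N := prime_gt0 (pcharf_prime pchar_k).
Let q_gt0 e : (0 < p ^ e)%N. Proof. by rewrite expn_gt0 p_gt0. Qed.

(* Frobenius twist of a functional killing the kernel of [u |-> u ^ (p ^ e)]. *)
Lemma twisted_functional (g : {linear A -> k^o}) e :
    (forall u, u ^+ (p ^ e) = 0 -> g u = 0) ->
  exists h : {linear A -> k^o}, forall u, h (u ^+ (p ^ e)) = g u ^+ (p ^ e).
Proof.
move=> gK; pose q := (p ^ e)%N.
(* The [p ^ e]-th powers are closed under scaling because scalars have [p ^ e]-th roots. *)
have [B BP] : exists B : {vspace A}, forall u, u \in B <-> exists v, u = v ^+ q.
  apply: vspace_of_pred => [|c _ _ [v ->] [w ->]].
    by exists 0; rewrite expr0n gtn_eqF ?q_gt0.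
  have [d dc] := frob_root c (q_gt0 e).
  by exists (d *: v + w); rewrite (frobD pchar_k) exprZn dc.
have /boolp.choice[b bE] (i : 'I_(\dim B)) : exists v, (vbasis B)`_i = v ^+ q.
  by apply/BP/vbasis_mem; rewrite mem_nth ?size_tuple.
pose h (u : A) : k^o := \sum_i coord (vbasis B) i u * g (b i) ^+ q.
have hl : linear h.
  move=> c u v; rewrite /h scaler_sumr -big_split; apply: eq_bigr => i _ /=.
  by rewrite linearP mulrDl -mulrA.
exists (HB.pack_for {linear A -> k^o} h (GRing.isLinear.Build k A k^o _ h hl)) => u.
have uB : u ^+ q \in B by apply/BP; exists u.
have /boolp.choice[d dE] (i : 'I_(\dim B)) : exists d, d ^+ q = coord (vbasis B) i (u ^+ q).
  exact: frob_root (q_gt0 e).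
pose w := \sum_i d i *: b i.
have uw : u ^+ q = w ^+ q.
  rewrite (frob_sum pchar_k) (coord_vbasis uB); apply: eq_bigr => i _.
  by rewrite exprZn dE bE.
have guw : g u = g w.
  apply/eqP; rewrite -subr_eq0 -linearB; apply/eqP/gK.
  have := frobD pchar_k (cA := cA) e (u - w) w; rewrite subrK uw => /eqP.
  by rewrite -subr_eq subrr eq_sym => /eqP.
rewrite guw linear_sum /= /h.
rewrite frob_sum_comm ?(pcharf_prime pchar_k) ?(pcharf0 pchar_k) // => [|i j]; last exact: mulrC.
apply: eq_bigr => i _; rewrite linearZ /= -[_ *: _]/(_ * _) exprMn dE.
by [].
Qed.

(** [shift a u] is [g] applied to the second factor of the comultiplication of [u]. Its [p ^ e]-th
    power is therefore the twist [h] applied to the second factor of the [p ^ e]-th power of that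
    comultiplication, which is zero. *)
Lemma shift_frob_ker (g : {linear A -> k^o}) (a : G) e u :
    (forall v, measure_ev v a = g v) -> (forall v, v ^+ (p ^ e) = 0 -> g v = 0) ->
  u ^+ (p ^ e) = 0 -> (shift a u : A) ^+ (p ^ e) = 0.
Proof.
move=> ga gK u0; have [h hP] := twisted_functional gK.
pose s i (v : A) : A := shift (vbase i) v.
have sM l (v w : A) : s l (v * w) =
    \sum_i \sum_j (comul G (vbase l) : 'M_(_, _)) i j *: (s i v * s j w).
  by rewrite /s shiftM.
have tM i j : (ubase i : A) * ubase j = \sum_l (comul G (vbase l) : 'M_(_, _)) i j *: (ubase l : A).
  rewrite [LHS]measure_expand; apply: eq_bigr => l _.
  by rewrite measure_evM pairing_ubase.
have s0 l : s l 0 = 0 by rewrite /s linear0.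
rewrite -[RHS](comultiplication_frob pchar_k s0 sM tM h u0).
under [RHS]eq_bigr do rewrite hP.
have -> : (shift a u : A) = \sum_i g (ubase i) *: (shift (vbase i) u : A).
  apply: measureP => b; rewrite shiftE coordC -shiftE ga {1}(measure_expand (shift b u)).
  rewrite measure_ev_sum linear_sum; apply: eq_bigr => i _.
  by rewrite linearZ /= measure_evZ !shiftE coordC; apply: mulrC.
by rewrite (frob_sum pchar_k); apply: eq_bigr => i _; rewrite exprZn.
Qed.

End MeasureDerivations.

(** Fitting: the images of the powers of [u] become stationary, and there [u] is surjective, hence
    injective. *)
Lemma image_power_injective (k : fieldType) (A : falgType k) (u : A) :
  exists n (V : {vspace A}), (forall w, w \in V <-> exists z, w = u ^+ n * z) /\
    forall w, w \in V -> u * w = 0 -> w = 0.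
Proof.
pose V n := limg (amull (u ^+ n)).
have VP n w : w \in V n <-> exists z, w = u ^+ n * z.
  split=> [/memv_imgP[z _ ->]|[z ->]]; first by exists z; rewrite lfunE.
  by apply/memv_imgP; exists z; rewrite ?memvf // lfunE.
have VS n : (V n.+1 <= V n)%VS.
  by apply/subvP => w /VP[z ->]; apply/VP; exists (u * z); rewrite mulrA -exprSr.
have [n Vn] : exists n, V n.+1 = V n.
  apply: contrapT => h.
  have dV n : (\dim (V n) + n <= \dim (V 0%N))%N.
    elim: n => [|n IH]; first by rewrite addn0.
    rewrite addnS; apply: leq_trans IH; rewrite ltn_add2r ltn_neqAle dimvS // andbT.
    apply/negP => e; apply: h; exists n; apply/eqP; rewrite eqEdim VS /=.
    by rewrite (eqP e).
  have := dV (\dim (V 0%N)).+1; rewrite leqNgt addnS ltnS.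
  by rewrite leq_addl.
exists n, (V n); split=> [w|w wV uw]; first exact: VP.
have := limg_ker_dim (amull u) (V n).
have -> : (amull u @: V n = V n)%VS.
  rewrite -[RHS]Vn /V -limg_comp; congr (limg _); apply/lfunP => z.
  by rewrite comp_lfunE !lfunE /= exprS mulrA.
move=> /eqP; rewrite -{2}[\dim (V n)]add0n eqn_add2r dimv_eq0 => /eqP K0.
apply/eqP; rewrite -memv0 -K0 memv_cap wV memv_ker lfunE /= uw.
by rewrite eqxx.
Qed.

(** * Measures on an abelian unipotent group scheme *)

Section UnipotentMeasures.
Variables (k : closedFieldType) (p : nat).
Hypothesis pchar_k : p \in [pchar k].
Variable U : finGroupScheme k.
Hypothesis abU : abelian_scheme U.
Hypothesis uniU : unipotent_scheme U.
Local Notation cA := (abelian_measure abU).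
Local Notation A := (com_falg cA).
Implicit Types u v w : A.

Definition com_augmentation : {lrmorphism A -> k^o} :=
  (@augmentation k U : {lrmorphism measure U -> k^o}).
Local Notation eps := com_augmentation.

Lemma epsE u : eps u = measure_ev (u : measure U) 1.
Proof. by []. Qed.

Lemma measure_derivations (g : 'Hom(A, k^o)) :
  g 1 = 0 -> (forall u v, eps u = 0 -> eps v = 0 -> g (u * v) = 0) ->
  exists D : 'End(A), [/\ derivation D, forall u, eps (D u) = g u &
    forall e, (forall u, u ^+ (p ^ e) = 0 -> g u = 0) ->
      forall u, u ^+ (p ^ e) = 0 -> D u ^+ (p ^ e) = 0].
Proof.
move=> g1 g2; pose g' : {linear measure U -> k^o} := fun_of_lfun g.
have [a aE] := measure_dual g'.
have prim : comul U a = tens a 1 + tens 1 a by apply: primitive_of_derivation aE g1 g2.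
have DE u : linfun (shift a) u = shift a u by rewrite lfunE.
exists (linfun (shift a) : 'End(measure U)); split.
- move=> u v; rewrite !DE shiftM prim linearD /= !tlift_tens ?shift1 // => [b|b|b|b] c d e.
    + by rewrite shift_linearl mulrDl -scalerAl.
    + by rewrite shift_linearl mulrDr -scalerAr.
    + by rewrite shift_linearl mulrDl -scalerAl.
    + by rewrite shift_linearl mulrDr -scalerAr.
- by move=> u; rewrite epsE DE shiftE mulr1.
move=> e gK u u0; rewrite DE.
exact: (shift_frob_ker pchar_k (g := g') aE gK u0).
Qed.

(** Otherwise the stable image of the powers of [u] is a nonzero module on which [u] is injective,
    whereas [u] kills the fixed vector that unipotence provides. *)
Lemma augmentation_nilpotent u : eps u = 0 -> exists n, u ^+ n = 0.
Proof.
move=> u0; have [n [V [VP Vinj]]] := image_power_injective (u : measure U).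
have uE m : (u : measure U) ^+ m = (u ^+ m : A).
  by elim: m => [//|m IH]; rewrite !exprS IH.
exists n; apply/eqP; apply: contraT => un; exfalso.
have stab (a w : measure U) : w \in V -> a * w \in V.
  move=> /VP[z ->]; apply/VP; exists (a * z).
  by rewrite [in LHS]mulrA (abelian_measure abU a) mulrA.
pose act0 (a : measure U) : 'End(subvs_of V) :=
  linfun (vsproj V \o amull a \o vsval).
have actE (a : measure U) (w : subvs_of V) : vsval (act0 a w) = a * vsval w.
  by rewrite lfunE /= vsprojK lfunE //= stab ?subvsP.
clearbody act0.
have actl : linear act0.
  move=> c a b; apply/lfunP => w; apply: subvs_inj.
  by rewrite actE add_lfunE scale_lfunE linearP /= !actE mulrDl -scalerAl.
have act01 : act0 1 = \1%VF.
  by apply/lfunP => w; apply: subvs_inj; rewrite actE id_lfunE mul1r.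
have act0M (a b : measure U) : act0 (a * b) = (act0 a \o act0 b)%VF.
  by apply/lfunP => w; apply: subvs_inj; rewrite comp_lfunE !actE mulrA.
pose M : gmod U := @Fdmod k (measure U) (subvs_of V)
  (HB.pack_for {linear measure U -> 'End(subvs_of V)} act0
     (GRing.isLinear.Build k _ _ _ act0 actl)) act01 act0M.
have unV : (u : measure U) ^+ n \in V by apply/VP; exists 1; rewrite mulr1.
have [|m m0 mfix] := uniU (M := M).
  exists (vsproj V ((u : measure U) ^+ n)); apply/negP => /eqP /(congr1 vsval).
  by rewrite (vsprojK unV) linear0 uE => e; rewrite e eqxx in un.
have um : (u : measure U) * vsval (m : subvs_of V) = 0.
  by rewrite -actE (mfix u : act0 u m = _) -epsE u0 scale0r linear0.
case/negP: m0; apply/eqP/subvs_inj; rewrite linear0; apply: Vinj um.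
exact: subvsP.
Qed.

Lemma unipotent_presentation : exists n (x : 'I_n -> A) (f : 'I_n -> nat),
  [/\ forall i, (0 < f i)%N, forall i, x i ^+ (p ^ f i) = 0,
      \prod_i x i ^+ (p ^ f i).-1 != 0 &
      forall V : {vspace A}, 1 \in V ->
        (forall i u, u \in V -> x i * u \in V) -> V = fullv].
Proof.
have := truncated_presentation pchar_k (eps := com_augmentation) augmentation_nilpotent.
by apply; apply: measure_derivations.
Qed.

End UnipotentMeasures.

(** * Freeness over subgroup schemes *)

Lemma endo_eigenvector (k : closedFieldType) (E : vectType k) (f : 'End(E)) (w : E) :
  w != 0 -> exists a v, v != 0 /\ f v = a *: v.
Proof.
move=> w0; have n_gt0 : (0 < dim E)%N.
  rewrite lt0n; apply: contraNneq w0 => d0.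
  rewrite -[w]v2rK -[0](linear0 r2v); apply/eqP; congr r2v.
  by apply/rowP => -[i i_lt]; exfalso; rewrite d0 in i_lt.
have /closed_rootP[a] : size (char_poly (f2mx f)) != 1%N.
  by rewrite size_char_poly eqSS -lt0n.
rewrite -eigenvalue_root_char => /eigenvalueP[v ve v0].
exists a, (r2v v); split; first by apply: contraNneq v0 => /(congr1 v2r); rewrite r2vK linear0 => ->.
by rewrite unlock /= r2vK ve linearZ.
Qed.

Section Characters.
Variables (k : closedFieldType) (C : falgType k).
Hypothesis cC : commutative ( *%R : C -> C -> C).

(** If every element acts on [V] as a scalar, these scalars form the character. Otherwise some
    element has an eigenspace in [V] that is, by commutativity, a smaller nonzero ideal. *)
Lemma ideal_eigenvector (V : {vspace C}) :
    (forall a v : C, v \in V -> a * v \in V) -> V != 0%VS ->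
  exists (chi : {lrmorphism C -> k^o}) (c : C),
    [/\ c \in V, c != 0 & forall a, a * c = chi a *: c].
Proof.
have [n] := ubnP (\dim V); elim: n V => // n IH V dV stab V0.
have cV : vpick V \in V by apply: memv_pick.
have c0 : vpick V != 0 by rewrite vpick0.
case: (pselect (forall a : C, exists x : k, forall v, v \in V -> a * v = x *: v)) => [|h].
  move=> /boolp.choice[chi chiE].
  have inj x y : x *: vpick V = y *: vpick V -> x = y.
    by move=> /eqP; rewrite -subr_eq0 -scalerBl scaler_eq0 (negPf c0) orbF subr_eq0 => /eqP.
  have chil : linear (chi : C -> k^o).
    move=> x a b; apply: inj; rewrite -chiE // mulrDl -scalerAl !chiE //.
    by rewrite scalerA -scalerDl.
  have chim : monoid_morphism (chi : C -> k^o).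
    split=> [|a b]; apply: inj; first by rewrite -chiE // mul1r scale1r.
    by rewrite -chiE // -mulrA (chiE b) // -scalerAr chiE // scalerA mulrC.
  exists (HB.pack_for {lrmorphism C -> k^o} (chi : C -> k^o)
    (GRing.isLinear.Build k C k^o _ _ chil)
    (GRing.isMonoidMorphism.Build C k^o _ chim)), (vpick V).
  by split=> // a /=; apply: chiE.
have [a ha] : exists a : C, forall x : k, exists2 v, v \in V & a * v != x *: v.
  apply: contrapT => h1; apply: h => a; apply: contrapT => h2; apply: h1.
  exists a => x; apply: contrapT => h3; apply: h2; exists x => v vV; apply/eqP.
  by apply: contraT => e; case: h3; exists v.
pose f : 'End(subvs_of V) := linfun (vsproj V \o amull a \o vsval).
have fE (w : subvs_of V) : vsval (f w) = a * vsval w.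
  by rewrite lfunE /= vsprojK lfunE //= stab ?subvsP.
have [|x [v [v0 fv]]] := @endo_eigenvector k _ f (vsproj V (vpick V)).
  by rewrite -(inj_eq subvs_inj) linear0 vsprojK.
have {}fv : a * vsval v = x *: vsval v by rewrite -fE fv linearZ.
pose V' := (V :&: lker (amull a - x *: \1%VF)%R)%VS.
have V'P w : w \in V' = (w \in V) && (a * w == x *: w).
  by rewrite memv_cap memv_ker add_lfunE opp_lfunE scale_lfunE id_lfunE lfunE /= subr_eq0.
have [chi [c [cV' c_neq0 cE]]] : exists (chi : {lrmorphism C -> k^o}) (c : C),
    [/\ c \in V', c != 0 & forall a, a * c = chi a *: c].
  apply: IH.
  - rewrite ltnS in dV; apply: leq_trans dV; have [w wV aw] := ha x.
    rewrite ltn_neqAle dimvS ?capvSl // andbT; apply: contra aw => /eqP dd.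
    have /eqP e : V' == V by rewrite eqEdim capvSl dd leqnn.
    by move: wV; rewrite -{1}e V'P => /andP[].
  - move=> b w; rewrite !V'P => /andP[wV /eqP aw].
    by rewrite stab // mulrA (cC a) -mulrA aw -scalerAr eqxx.
  - apply: contraNneq v0 => e; rewrite -(inj_eq subvs_inj) linear0 -memv0 -e V'P.
    by rewrite subvsP fv eqxx.
by exists chi, c; move: cV'; rewrite V'P => /andP[cV' _].
Qed.

(* A common eigenvector of [C] in a minimal ideal [(1 - j) C] would be killed by
   some [1 - j']. *)
Lemma subalgebra_unital (J : {vspace C}) :
    (forall a b, a \in J -> b \in J -> a * b \in J) ->
    (forall chi : {lrmorphism C -> k^o}, exists2 j, j \in J & chi j != 0) ->
  1 \in J.
Proof.
move=> JM Jchi; pose I s : {vspace C} := limg (amull s).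
have IP s w : w \in I s <-> exists z, w = s * z.
  split=> [/memv_imgP[z _ ->]|[z ->]]; first by exists z; rewrite lfunE.
  by apply/memv_imgP; exists z; rewrite ?memvf // lfunE.
pose P d := `[< exists2 s, 1 - s \in J & \dim (I s) = d >].
have exP : exists d, P d by exists (\dim (I 1)); apply/asboolP; exists 1; rewrite // subrr mem0v.
case: (ex_minnP exP) => d /asboolP[s sJ ds] dmin.
have [Is0|Is0] := eqVneq (I s) 0%VS.
  have : s \in I s by apply/IP; exists 1; rewrite mulr1.
  by rewrite Is0 memv0 => /eqP s0; rewrite s0 subr0 in sJ.
have [a w /IP[z ->]|chi [c [/IP[z cz] c0 cE]]] := @ideal_eigenvector (I s) _ Is0.
  by apply/IP; exists (a * z); rewrite mulrA (cC a) mulrA.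
have [j jJ chij] := Jchi chi.
pose s' : C := 1 - (chi j)^-1 *: j.
have s'c : s' * c = 0.
  by rewrite mulrBl mul1r -scalerAl cE scalerA mulVf // scale1r subrr.
have ss'J : 1 - s' * s \in J.
  have -> : 1 - s' * s = (1 - s) + (chi j)^-1 *: (j - j * (1 - s)).
    by rewrite (mulrBr j) mulr1 subKr /s' mulrBl mul1r -scalerAl opprD opprK addrA.
  by rewrite memvD ?memvZ // memvB // JM.
have : (d <= \dim (I (s' * s)%R))%N by apply: dmin; apply/asboolP; exists (s' * s).
have := limg_ker_dim (amull s') (I s); rewrite ds.
have -> : (amull s' @: I s)%VS = I (s' * s).
  by rewrite /I -limg_comp; congr (limg _); apply/lfunP => u; rewrite comp_lfunE !lfunE /= mulrA.
move=> <-; rewrite -{2}[\dim (I _)]add0n leq_add2r leqn0 dimv_eq0 => /eqP K0.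
case/negP: c0; rewrite -memv0 -K0 memv_cap memv_ker lfunE /= s'c eqxx andbT.
by apply/IP; exists z.
Qed.

End Characters.

Section Coassociativity.
Variables (k : fieldType) (G : finGroupScheme k).

Lemma coassoc_lift (W : vectType k) (H : G -> G -> G -> W) (a : G) :
    (forall c d, linear (fun b => H b c d)) ->
    (forall b d, linear (fun c => H b c d)) -> (forall b c, linear (H b c)) ->
  tlift (fun b e => tlift (H b) (comul G e)) (comul G a) =
  tlift (fun e d => tlift (fun b c => H b c d) (comul G e)) (comul G a).
Proof.
move=> H1 H2 H3; pose M b (s : tensor G G) : W := tlift (H b) s.
have Mr b : linear (M b) by move=> c s t; rewrite /M linearP.
have Ml s : linear (M^~ s).
  move=> c x y; rewrite /M /tlift scaler_sumr -big_split; apply: eq_bigr => i _ /=.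
  rewrite scaler_sumr -big_split; apply: eq_bigr => j _ /=.
  by rewrite H1 scalerDr !scalerA mulrC.
have := congr1 (tlift M) (comulA a); rewrite /tmap /tassoc !tlift_comp => e.
transitivity (tlift (fun x y => tlift M (tens x (comul G y))) (comul G a)).
  by apply: eq_tlift => x y; rewrite tlift_tens.
rewrite -e; apply: eq_tlift => x y.
pose N (t : tensor G G) z : tensor G (tensor G G) :=
  tlift (fun b c => tens b (tens c z)) t.
have Nl z : linear (N^~ z) by move=> c s t; rewrite /N linearP.
have Nr t : linear (N t).
  move=> c z z'; rewrite /N /tlift scaler_sumr -big_split; apply: eq_bigr => i _ /=.
  rewrite scaler_sumr -big_split; apply: eq_bigr => j _ /=.
  by rewrite !tens_linearr scalerDr !scalerA mulrC.
transitivity (tlift M (N (comul G x) y)).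
  apply: (tlift_tens (f := fun t z => tlift M (N t z))) => [z|t] c r r'.
    by rewrite Nl linearP.
  by rewrite Nr linearP.
rewrite /N tlift_comp; apply: eq_tlift => b c.
rewrite [LHS](tlift_tens (f := M)) // /M tlift_tens //.
Qed.

Variables (V : vectType k) (sh : {linear G -> 'End(V)}).
Hypothesis sh1 : forall v, sh 1 v = v.
Hypothesis shM : forall a b v, sh (a * b) v = sh a (sh b v).

(* [twist] is convolution with the action; its inverse is convolution with the
   action precomposed with the antipode. *)
Definition twist (T : 'Hom(G, V)) (a : G) : V :=
  tlift (fun b c => sh b (T c)) (comul G a).

Let sh_linear v : linear (fun b => sh b v).
Proof. by move=> c x y; rewrite linearP add_lfunE scale_lfunE. Qed.

Lemma twist_inj (T : 'Hom(G, V)) : (forall a, twist T a = 0) -> T = 0.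
Proof.
move=> T0; apply/lfunP => a; rewrite zero_lfunE.
pose H b c d := sh (antipode G b * c) (T d).
have := @coassoc_lift V H a.
have -> : tlift (fun b e => tlift (H b) (comul G e)) (comul G a) = 0.
  rewrite {1}/tlift big1 // => i _; rewrite big1 // => j _.
  rewrite [X in _ *: X](_ : _ = 0) ?scaler0 //.
  transitivity (sh (antipode G (vbase i)) (twist T (vbase j))).
    by rewrite /twist tlift_comp; apply: eq_tlift => c d; rewrite /H shM.
  by rewrite T0 linear0.
move=> -> //; first last.
- by move=> b c e x y; rewrite /H !linearP.
- by move=> b d e x y; rewrite /H mulrDr -scalerAr sh_linear.
- by move=> c d e x y; rewrite /H linearP /= mulrDl -scalerAl sh_linear.
rewrite -{1}(counitl a) tlift_comp; apply: eq_tlift => e d; rewrite /H.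
pose shT := HB.pack_for {linear G -> V} (fun b => sh b (T d))
  (GRing.isLinear.Build k G V _ _ (sh_linear (T d))).
rewrite -(tlift_comp shT (fun b c => antipode G b * c)) antipodel linearZ /=.
by rewrite linearZ /= scale_lfunE sh1.
Qed.

Lemma twist_surj (T : 'Hom(G, V)) : exists T' : 'Hom(G, V), forall a, twist T' a = T a.
Proof.
have tl T' : linear (twist T') by move=> c a b; rewrite /twist linearP linearP.
pose tw T' := linfun (HB.pack_for {linear G -> V} (twist T') (GRing.isLinear.Build k G V _ _ (tl T'))).
have twE T' a : tw T' a = twist T' a by rewrite lfunE.
have twl : linear tw.
  move=> c X Y; apply/lfunP => a; rewrite add_lfunE scale_lfunE !twE /twist /tlift.
  rewrite scaler_sumr -big_split; apply: eq_bigr => i _ /=.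
  rewrite scaler_sumr -big_split; apply: eq_bigr => j _ /=.
  by rewrite add_lfunE scale_lfunE linearP scalerDr !scalerA mulrC.
pose Tw := linfun (HB.pack_for {linear 'Hom(G, V) -> 'Hom(G, V)} tw
  (GRing.isLinear.Build k _ _ _ _ twl)).
have K0 : lker Tw == 0%VS.
  rewrite -subv0; apply/subvP => X; rewrite memv_ker lfunE /= => /eqP X0.
  by rewrite memv0; apply/eqP/twist_inj => a; rewrite -twE X0 zero_lfunE.
exists (Tw^-1%VF T) => a; rewrite -twE -[tw _]/(tw _).
by have /lfunP/(_ a) := lker0_lfunVK K0 T; rewrite lfunE.
Qed.

End Coassociativity.

Definition linear_of (k : fieldType) (V W : vectType k) (f : V -> W) (fl : linear f) :
    {linear V -> W} :=
  HB.pack_for {linear V -> W} f (GRing.isLinear.Build k V W _ f fl).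

Section SubgroupMeasures.
Variables (k : closedFieldType) (G : finGroupScheme k) (U : subgroupScheme G).
Implicit Types (u v : measure U) (b c : measure G) (f g : G).

Definition incl u : measure G := measure_incl u.

Lemma inclE u f : measure_ev (incl u) f = measure_ev u (res U f).
Proof. by rewrite /measure_ev comp_lfunE [linfun _ _]lfunE. Qed.

Lemma incl_linear : linear incl.
Proof. by move=> x u v; apply: measureP => f; rewrite !(inclE, measure_evD, measure_evZ). Qed.

Lemma incl_monoid : monoid_morphism incl.
Proof.
split=> [|u v]; apply: measureP => f; rewrite inclE; first by rewrite !measure_ev1 res_counit.
rewrite !measure_evM res_comul [LHS]tlift_comp; apply: eq_tlift => a b.
by rewrite /= pairing_tens !inclE.
Qed.

HB.instance Definition _ :=
  GRing.isLinear.Build k (measure U) (measure G) _ incl incl_linear.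
HB.instance Definition _ :=
  GRing.isMonoidMorphism.Build (measure U) (measure G) incl incl_monoid.

Lemma incl_inj : injective incl.
Proof.
move=> u v e; apply: measureP => a; have [f <-] := res_surj a.
by rewrite -!inclE e.
Qed.

Lemma shift_incl f u : shift f (incl u) = incl (shift (res U f) u).
Proof. by apply: measureP => g; rewrite shiftE !inclE shiftE rmorphM. Qed.

(** The data of [frobenius_form] for kU: an integral [L] and a nondegenerate form [tr] with
    [tr L = 1]. *)
Variables (L : measure U) (tr : {linear measure U -> k^o}).
Hypothesis L_neq0 : L != 0.
Hypothesis trL : forall u, tr (L * u) = augmentation u.
Hypothesis L_integral : forall u, L * u = (augmentation u : k) *: L.
Hypothesis tr_dual : forall h : {linear measure U -> k^o},
  exists z, forall u, tr (u * z) = h u.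
Hypothesis tr_nondegenerate : forall z, (forall u, tr (u * z) = 0) -> z = 0.

Let ev_linear f : linear (fun u : measure G => measure_ev u f : k^o).
Proof. by move=> e w w'; rewrite measure_evD measure_evZ. Qed.

(* The functions on [G] of the form [f_L : b |-> (L b)(f)]. *)
Let invariant f := exists g, forall b, measure_ev b f = measure_ev (incl L * b) g.

Lemma translate b g : exists f, forall c, measure_ev c f = measure_ev (b * c) g.
Proof.
have l : linear (fun c => measure_ev (b * c) g : k^o).
  by move=> e w w'; rewrite mulrDr -scalerAr measure_evD measure_evZ.
exact: (measure_dual (HB.pack_for {linear measure G -> k^o}
  (fun c => measure_ev (b * c) g : k^o) (GRing.isLinear.Build k _ _ _ _ l))).
Qed.

Lemma rtranslate b g : exists f, forall c, measure_ev c f = measure_ev (c * b) g.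
Proof.
have l : linear (fun c => measure_ev (c * b) g : k^o).
  by move=> e w w'; rewrite mulrDl -scalerAl measure_evD measure_evZ.
exact: (measure_dual (HB.pack_for {linear measure G -> k^o}
  (fun c => measure_ev (c * b) g : k^o) (GRing.isLinear.Build k _ _ _ _ l))).
Qed.

Lemma invariant_ev f u b : invariant f ->
  measure_ev (incl u * b) f = (augmentation u : k) * measure_ev b f.
Proof.
move=> [g gE]; rewrite !gE mulrA -rmorphM /= L_integral linearZ /= -scalerAl.
by rewrite measure_evZ.
Qed.

(** An invariant function is constant along [U]-orbits, so multiplying measures by it commutes with
    translation by measures on [U]. *)
Lemma shift_invariant f u b : invariant f ->
  shift f (incl u * b) = incl u * shift f b.
Proof.
move=> fI; apply: measureP => d; rewrite shiftE coordC -shiftE shiftM.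
pose ev := HB.pack_for {linear measure G -> k^o} (fun u : measure G => measure_ev u f : k^o)
  (GRing.isLinear.Build k (measure G) k^o _ _ (ev_linear f)).
rewrite -[LHS]/(ev _) tlift_comp measure_evM /pairing; apply: eq_tlift => d1 d2 /=.
rewrite shift_incl invariant_ev // !shiftE coordC; congr (_ * _).
by rewrite /augmentation shiftE mulr1 -inclE.
Qed.

Lemma invariant_mul f g : invariant f -> invariant g -> invariant (f * g).
Proof.
move=> fI [h hE]; exists (h * f) => b.
by rewrite -shiftE hE -shift_invariant // shiftE coordC.
Qed.

(** A character of k[G] is a point of the group, and the antipode gives its inverse. *)
Lemma character_invertible (chi : {lrmorphism G -> k^o}) :
  exists b c, (forall f, measure_ev b f = chi f) /\ b * c = 1.
Proof.
pose b : measure G := linfun chi.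
have bE f : measure_ev b f = chi f by rewrite /measure_ev lfunE.
pose c : measure G := linfun (chi \o antipode G).
have cE f : measure_ev c f = chi (antipode G f) by rewrite /measure_ev lfunE.
exists b, c; split=> //; apply: measureP => f; rewrite measure_ev1 measure_evM.
have := congr1 chi (antipoder f); rewrite tlift_comp linearZ rmorph1 /= => e.
transitivity (counit G f *: (1 : k^o)); last exact: mulr1.
by rewrite -e; apply: eq_tlift => d d' /=; rewrite bE cE rmorphM.
Qed.

(** By [subalgebra_unital] it is enough that no point kills all invariant functions. As [L != 0],
    one of them is nonzero at the identity, and right translation by the inverse of a point moves it
    to that point. *)
Lemma invariant_one : invariant 1.
Proof.
have [J JP] : exists J : {vspace G}, forall f, f \in J <-> invariant f.
  apply: vspace_of_pred => [|a f g [f' fE] [g' gE]].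
    by exists 0 => b; rewrite !linear0.
  by exists (a *: f' + g') => b; rewrite !linearP /= fE gE.
apply/JP/(subalgebra_unital (@coordC _ G)) => [f g /JP fJ /JP gJ|chi].
  exact/JP/invariant_mul.
apply: contrapT => h.
have h0 f : invariant f -> chi f = 0.
  move=> fI; apply: contrapT => /eqP chif; apply: h; exists f => //; exact/JP.
have [b [c [bE bc]]] := character_invertible chi.
have [g g0] : exists g, measure_ev (incl L) g != 0.
  apply: contrapT => h1; case/negP: L_neq0; apply/eqP/incl_inj/measureP => g.
  rewrite linear0 measure_ev0; apply/eqP; apply: contraT => h2.
  by case: h1; exists g.
have [j jE] := translate (incl L) g.
have [j' j'E] := rtranslate c j; have [g' g'E] := rtranslate c g.
have : chi j' = 0 by apply: h0; exists g' => d; rewrite j'E jE mulrA g'E.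
rewrite -bE j'E bc jE mulr1 => e.
by rewrite e eqxx in g0.
Qed.

(* For [x b = 0], the map [f |-> phi (shift f b)] becomes [x]-torsion after
   untwisting, hence divisible by [x ^+ m]; [b] is recovered from it because [1]
   has the form [g_L]. *)
Lemma exact_incl (m : nat) (x : measure U) :
    (forall u, x * u = 0 -> exists v, u = x ^+ m * v) ->
  forall b, incl x * b = 0 -> exists c, b = incl x ^+ m * c.
Proof.
move=> xex b xb; have [g gE] := invariant_one.
(* [phi] is a kU-linear map from kG to kU; because [1] has the form [g_L], it is compatible with
   augmentations. *)
have /boolp.choice[phi phiE] c : exists z, forall u, tr (u * z) = measure_ev (incl u * c) g.
  have l : linear (fun u => measure_ev (incl u * c) g : k^o).
    by move=> e w w'; rewrite linearP mulrDl -scalerAl measure_evD measure_evZ.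
  exact: (tr_dual (HB.pack_for {linear measure U -> k^o}
    (fun u => measure_ev (incl u * c) g : k^o) (GRing.isLinear.Build k _ _ _ _ l))).
have tr_inj z z' : (forall u, tr (u * z) = tr (u * z')) -> z = z'.
  move=> e; apply/eqP; rewrite -subr_eq0; apply/eqP/tr_nondegenerate => u.
  by rewrite mulrBr linearB e subrr.
have phil : linear phi.
  move=> e w w'; apply: tr_inj => u.
  by rewrite mulrDr -scalerAr linearP !phiE mulrDr -scalerAr measure_evD measure_evZ.
have phiM u c : phi (incl u * c) = u * phi c.
  by apply: tr_inj => v; rewrite mulrA !phiE mulrA -rmorphM.
have phi_eps c : augmentation (phi c) = measure_ev c 1.
  by rewrite -trL phiE gE.
pose T0 f := phi (shift f b).
have T0l : linear T0 by move=> e f f'; rewrite /T0 shift_linearl phil.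
pose T : 'Hom(G, measure U) := linfun (HB.pack_for {linear G -> measure U} T0
  (GRing.isLinear.Build k _ _ _ _ T0l)).
have TE f : T f = phi (shift f b) by rewrite lfunE.
pose sh0 f : 'End(measure U) := linfun (shift (res U f)).
have sh0E f u : sh0 f u = shift (res U f) u by rewrite lfunE.
have sh0l : linear sh0.
  move=> e f f'; apply/lfunP => u.
  by rewrite add_lfunE scale_lfunE !sh0E linearP shift_linearl.
pose sh : {linear G -> 'End(measure U)} := linear_of sh0l.
have shE f u : sh f u = shift (res U f) u by apply: sh0E.
have sh1 u : sh 1 u = u by rewrite shE rmorph1 shift1.
have shM f f' u : sh (f * f') u = sh f (sh f' u) by rewrite !shE rmorphM shift_shift.
clearbody sh T.
have [T' T'E] := twist_surj sh1 shM T.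
(* The twist of [x * T'] at [a] is [phi (shift a (incl x * b))], which is zero, and twisting is
   injective. *)
have xT' f : x * T' f = 0.
  pose T2 : 'Hom(G, measure U) := (amull x \o T')%VF.
  have T2E d : T2 d = x * T' d by rewrite comp_lfunE [amull _ _]lfunE.
  suff e : T2 = 0 by rewrite -T2E e zero_lfunE.
  apply: (twist_inj sh1 shM) => a; pose H e e' d := shift (res U e) x * sh e' (T' d).
  transitivity (tlift (fun y d => tlift (fun e e' => H e e' d) (comul G y)) (comul G a)).
    apply: eq_tlift => y d; rewrite shE T2E shiftM res_comul [LHS]tlift_comp.
    apply: eq_tlift => e e'; rewrite /H shE /=.
    rewrite [LHS](tlift_tens (f := fun y z => shift y x * shift z (T' d) : measure U)) //.
      by move=> v r y3 y4; rewrite shift_linearl mulrDl -scalerAl.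
    by move=> v r y3 y4; rewrite shift_linearl mulrDr -scalerAr.
  rewrite -coassoc_lift; first last.
  - by move=> y1 y2 r y3 y4; rewrite /H !linearP mulrDr -scalerAr.
  - by move=> y1 y2 r y3 y4; rewrite /H linearP add_lfunE scale_lfunE mulrDr -scalerAr.
  - by move=> y1 y2 r y3 y4; rewrite /H linearP shift_linearl mulrDl -scalerAl.
  have <- : linear_of phil (shift a (incl x * b)) = 0 by rewrite xb !linear0.
  rewrite shiftM tlift_comp; apply: eq_tlift => e y; rewrite -[linear_of _ _]/(phi _).
  rewrite shift_incl phiM -TE -T'E /twist.
  pose mu : {linear measure U -> measure U} := fun_of_lfun (amull (shift (res U e) x)).
  have muE v : mu v = shift (res U e) x * v by rewrite [LHS]lfunE.
  by rewrite -muE tlift_comp; apply: eq_tlift => e1 e2; rewrite muE.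
have /boolp.choice[al alE] j : exists al, T' (vbase j) = x ^+ m * al by apply/xex/xT'.
exists (\sum_j incl (al j) * ubase j); rewrite mulr_sumr.
apply: measureP => f; rewrite measure_ev_sum.
have -> : measure_ev b f = tlift (fun y d => measure_ev (T' d) (res U y) : k^o) (comul G f).
  rewrite -[f]mulr1 -shiftE -phi_eps -TE mulr1 -T'E /twist tlift_comp.
  by apply: eq_tlift => y d; rewrite /= /augmentation shE shiftE mulr1.
under [RHS]eq_bigr => j _ do rewrite mulrA -rmorphXn -rmorphM /= -alE measure_evM /pairing.
rewrite /tlift exchange_big; apply: eq_bigr => j _ /=; apply: eq_bigr => i _ /=.
rewrite [RHS](bigD1 j) //= big1 ?addr0 => [|l lj].
  by rewrite ubase_vbase eqxx mulr1 inclE.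
by rewrite ubase_vbase eq_sym (negPf lj) mulr0 scaler0.
Qed.

End SubgroupMeasures.

(** * Modules supported on hypersurfaces *)

(** Associativity of a triple product, read in degree [q], the first degree lost by truncation. *)
Lemma take_poly_cocycle (R : comNzRingType) (q : nat) (P Q S : {poly R}) : S`_0 = 0 ->
  (take_poly q (P * Q) * S)`_q = P`_0 * (Q * S)`_q + (P * take_poly q (Q * S))`_q.
Proof.
move=> S0.
have E (T : {poly R}) : T = take_poly q T + drop_poly q T * 'X^q by rewrite poly_take_drop.
transitivity ((P * (Q * S))`_q).
  rewrite mulrA [in RHS](E (P * Q)) mulrDl coefD -[LHS]addr0; congr (_ + _).
  by rewrite mulrAC coefMXn ltnn subnn coefM big_ord1 S0 mulr0.
rewrite [in LHS](E (Q * S)) mulrDr coefD addrC; congr (_ + _).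
by rewrite mulrA coefMXn ltnn subnn coefM big_ord1 coef_drop_poly add0n.
Qed.

Section ExtensionModule.
Variables (k : fieldType) (p : nat) (A0 : falgType k).
Hypothesis cA : commutative ( *%R : A0 -> A0 -> A0).
Local Notation A := (com_falg cA).
Variables (n : nat) (eps : {lrmorphism A -> k^o}) (q r : 'I_n -> nat).
Variable F : 'I_n -> {linear A -> {poly k}}.
Hypothesis p_gt1 : (1 < p)%N.
Hypothesis r_gt0 : forall i, (0 < r i)%N.
Hypothesis qE : forall i, q i = (p * r i)%N.
Hypothesis F_size : forall i u, (size (F i u) <= q i)%N.
Hypothesis F1 : forall i, F i 1 = 1.
Hypothesis FM : forall i u v, F i (u * v) = take_poly (q i) (F i u * F i v).
Hypothesis F_eps : forall i u, (F i u)`_0 = eps u.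
Variables (N : nat) (C : 'I_n -> 'M[k]_N).

Let I : {vspace A} := lker (linfun eps : 'Hom(A, k^o)).
Let IP u : (u \in I) = (eps u == 0). Proof. by rewrite memv_ker lfunE. Qed.

Definition ext_space : Type := ({ffun 'I_N -> subvs_of I} * 'rV[k]_N)%type.
HB.instance Definition _ := Vector.on ext_space.

(* [F i] presents [A] modulo the other generators as polynomials truncated at
   degree [q i]; the coefficient lost by truncation in degree [q i] defines an
   extension of [I ^ N] by the trivial module [k ^ N]. *)
Definition ext_cocycle (u v : A) : 'M[k]_N := \sum_i (F i u * F i v)`_(q i) *: C i.

Definition ext_act (u : A) (z : ext_space) : ext_space :=
  ([ffun j => vsproj I (u * vsval (z.1 j))],
   eps u *: z.2 + \sum_j row j (ext_cocycle u (vsval (z.1 j)))).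

Let ideal u (b : subvs_of I) : u * vsval b \in I.
Proof. by have := subvsP b; rewrite !IP rmorphM /= => /eqP ->; rewrite mulr0. Qed.

Let ext_act_fst u z j : vsval ((ext_act u z).1 j) = u * vsval (z.1 j).
Proof. by rewrite ffunE vsprojK. Qed.

Lemma cocycle_linearl v : linear (ext_cocycle^~ v).
Proof.
move=> c u u'; rewrite /ext_cocycle scaler_sumr -big_split; apply: eq_bigr => i _ /=.
by rewrite linearP mulrDl -scalerAl coefD coefZ scalerDl scalerA.
Qed.

Lemma cocycle_linearr u : linear (ext_cocycle u).
Proof.
move=> c v v'; rewrite /ext_cocycle scaler_sumr -big_split; apply: eq_bigr => i _ /=.
by rewrite linearP mulrDr -scalerAr coefD coefZ scalerDl scalerA.
Qed.

Lemma cocycleE u u' v : eps v = 0 ->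
  ext_cocycle (u * u') v = eps u *: ext_cocycle u' v + ext_cocycle u (u' * v).
Proof.
move=> v0; rewrite /ext_cocycle scaler_sumr -big_split; apply: eq_bigr => i _ /=.
by rewrite !FM take_poly_cocycle ?F_eps // scalerDl scalerA.
Qed.

Lemma ext_act_linear u : linear (ext_act u).
Proof.
have sE c (b b' : {ffun 'I_N -> subvs_of I}) j :
    vsval ((c *: b + b') j) = c *: vsval (b j) + vsval (b' j).
  by rewrite !ffunE linearP.
move=> c z z'; rewrite [LHS]surjective_pairing [RHS]surjective_pairing; congr pair.
  apply/ffunP => j; apply: subvs_inj.
  by rewrite ext_act_fst !sE !ext_act_fst mulrDr -scalerAr.
rewrite /= scalerDr scalerA [eps u * c]mulrC -scalerA.
rewrite scalerDr addrACA; congr (_ + _); rewrite scaler_sumr -big_split.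
by apply: eq_bigr => j _; rewrite sE /= cocycle_linearr linearP.
Qed.

Definition ext_end u : 'End(ext_space) := linfun (HB.pack_for {linear ext_space -> ext_space}
  (ext_act u) (GRing.isLinear.Build k ext_space ext_space *:%R _ (ext_act_linear u))).

Let ext_endE u z : ext_end u z = ext_act u z. Proof. by rewrite lfunE. Qed.

Lemma ext_end_linear : linear ext_end.
Proof.
move=> c u v; apply/lfunP => z; rewrite add_lfunE scale_lfunE !ext_endE.
rewrite [LHS]surjective_pairing [RHS]surjective_pairing; congr pair.
  apply/ffunP => j; apply: subvs_inj; rewrite ext_act_fst mulrDl -scalerAl.
  by rewrite -!ext_act_fst !ffunE linearP.
rewrite /= linearP scalerDl scalerDr !scalerA addrACA; congr (_ + _).
rewrite scaler_sumr -big_split; apply: eq_bigr => j _ /=.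
by rewrite cocycle_linearl linearP.
Qed.
Definition ext_endL : {linear A -> 'End(ext_space)} := linear_of ext_end_linear.

Lemma ext_end1 : ext_end 1 = \1%VF.
Proof.
apply/lfunP => -[b w]; rewrite id_lfunE ext_endE; congr pair.
  by apply/ffunP => j; apply: subvs_inj; rewrite ext_act_fst mul1r.
rewrite rmorph1 scale1r big1 ?addr0 // => j _; rewrite /ext_cocycle big1 ?linear0 // => i _.
by rewrite F1 mul1r nth_default ?scale0r.
Qed.

Lemma ext_endM u v : ext_end (u * v) = (ext_end u \o ext_end v)%VF.
Proof.
apply/lfunP => z; rewrite comp_lfunE !ext_endE.
rewrite [LHS]surjective_pairing [RHS]surjective_pairing; congr pair.
  by apply/ffunP => j; apply: subvs_inj; rewrite !ext_act_fst mulrA.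
rewrite [LHS]/= [in RHS]/ext_act /= rmorphM scalerDr scalerA -addrA; congr (_ + _).
rewrite scaler_sumr -big_split; apply: eq_bigr => j _ /=.
rewrite (ext_act_fst v z) cocycleE ?linearP //.
by have := subvsP (z.1 j); rewrite IP => /eqP.
Qed.

Definition ext_mod : fdmod A := @Fdmod k A ext_space ext_endL ext_end1 ext_endM.

Variables (x : A) (l : 'I_n -> k).
Hypothesis Fx : forall i, F i x = l i *: 'X^(r i).
Hypothesis xp : x ^+ p = 0.
Hypothesis l_neq0 : exists i, l i != 0.
Hypothesis x_exact : forall u, x * u = 0 -> exists v, u = x ^+ p.-1 * v.

Let p1_gt0 : (0 < p.-1)%N. Proof. by rewrite -ltnS prednK // ltnW. Qed.

Let eps_x : eps x = 0.
Proof.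
have [i _] := l_neq0; rewrite -(F_eps i) Fx coefZ coefXn.
by rewrite eq_sym gtn_eqF ?mulr0.
Qed.

Let eps_xp : eps (x ^+ p.-1) = 0.
Proof. by rewrite rmorphXn /= eps_x expr0n gtn_eqF. Qed.

Let F_xX i m : (m < p)%N -> F i (x ^+ m) = l i ^+ m *: 'X^(r i * m).
Proof.
elim: m => [_|m IH mp]; first by rewrite expr0 F1 muln0 scale1r.
rewrite exprS FM Fx IH ?(ltnW mp) // -scalerAl -scalerAr scalerA -exprS -exprD -mulnS.
by rewrite take_poly_id // (leq_trans (size_scale_leq _ _)) // size_polyXn qE mulnC ltn_mul2r r_gt0.
Qed.

(** The product of the two polynomials starts in degree [q i], with coefficient
    [l i ^+ p * eps v]. *)
Let cocycle_xX m m' v : (0 < m)%N -> (0 < m')%N -> (m + m' = p)%N ->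
  ext_cocycle (x ^+ m) (x ^+ m' * v) = eps v *: \sum_i l i ^+ p *: C i.
Proof.
move=> m0 m'0 mE; rewrite scaler_sumr; apply: eq_bigr => i _; rewrite scalerA.
have mp : (m < p)%N by rewrite -mE -addn1 leq_add2l.
have m'p : (m' < p)%N by rewrite -mE addnC -addn1 leq_add2l.
rewrite FM !F_xX // -!scalerAl linearZ /= -scalerAr scalerA -exprD mE coefZ.
rewrite coefXnM qE -mE mulnC mulnDr ltnNge leq_addr /= addKn coef_take_poly.
rewrite -[X in (X < _)%N]add0n ltn_add2r muln_gt0 r_gt0 m0 coefXnM ltnn subnn F_eps.
by rewrite mulrC.
Qed.

Let eps_of_top v : x ^+ p.-1 * v = 0 -> eps v = 0.
Proof.
move=> v0; have [i li] := l_neq0; have p1p : (p.-1 < p)%N by rewrite prednK // ltnW.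
have := congr1 (fun P : {poly k} => P`_(r i * p.-1)) (congr1 (F i) v0).
rewrite linear0 coef0 FM F_xX // coef_take_poly qE mulnC ltn_pmul2r // p1p.
rewrite -scalerAl coefZ coefXnM ltnn subnn F_eps => /eqP.
by rewrite mulf_eq0 expf_eq0 (negPf li) andbF => /eqP.
Qed.

(** In [I ^ N] the vectors [x ^+ p.-1 s], [s] in [k ^ N], obstruct exactness: [x] kills them, but a
    nonzero one is not [x ^+ p.-1] times a vector of [I ^ N]. The trivial part [k ^ N] is a second
    obstruction. In the extension [x] sends [x ^+ p.-1 s] to [s *m D], and [x ^+ p.-1] sends [x s]
    to [s *m D], so both disappear exactly when [D] is invertible. *)
Lemma ext_mod_exact : exact_at p ext_mod x <-> \sum_i l i ^+ p *: C i \in unitmx.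
Proof.
set D := \sum_i _; have mD (s : 'rV[k]_N) : \sum_j s 0 j *: row j D = s *m D.
  by rewrite mulmx_sum_row.
have actE u z : act ext_mod u z = ext_act u z by apply: ext_endE.
have epsA c : eps c%:A = c by rewrite linearZ rmorph1 /= -[_ *: 1]/(_ * 1) mulr1.
have cD v : ext_cocycle x (x ^+ p.-1 * v) = eps v *: D.
  by rewrite -[x in ext_cocycle x]expr1 cocycle_xX // add1n prednK // ltnW.
have cD' v : ext_cocycle (x ^+ p.-1) (x * v) = eps v *: D.
  by rewrite -[x in x * v]expr1 cocycle_xX // addn1 prednK // ltnW.
split=> [ex|uD z].
  rewrite unitmxE unitfE; apply/negP => /det0P[s s0 sD].
  have xpI : x ^+ p.-1 \in I by rewrite IP eps_xp.
  pose z : ext_space := ([ffun j => s 0 j *: vsproj I (x ^+ p.-1)], 0).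
  have zE j : vsval (z.1 j) = x ^+ p.-1 * (s 0 j)%:A.
    by rewrite ffunE linearZ /= vsprojK // -scalerAr mulr1.
  have [|z' z'E] := ex z.
    rewrite actE [LHS]surjective_pairing; congr pair.
      apply/ffunP => j; apply: subvs_inj; rewrite ext_act_fst zE ffunE linear0.
      by rewrite mulrA -exprS prednK ?xp ?mul0r // ltnW.
    rewrite /= scaler0 add0r -[RHS]sD -mD; apply: eq_bigr => j _.
    by rewrite zE cD epsA linearZ.
  case/negP: s0; apply/eqP/rowP => j; rewrite mxE.
  have := zE j; rewrite {1}z'E actE ext_act_fst => /eqP.
  rewrite eq_sym -subr_eq0 -mulrBr => /eqP/eps_of_top.
  rewrite linearB /= epsA.
  by have := subvsP (z'.1 j); rewrite IP => /eqP ->; rewrite subr0.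
rewrite actE => xz.
have /boolp.choice[v vE] j : exists v, vsval (z.1 j) = x ^+ p.-1 * v.
  apply: x_exact; rewrite -ext_act_fst xz /=.
  by rewrite ffunE linear0.
have v0 j : eps (v j) = 0.
  suff : \row_j eps (v j) = 0 by move=> /rowP/(_ j); rewrite !mxE.
  apply: (can_inj (mulmxK uD)); rewrite mul0mx -mD.
  have := congr1 (fun y : ext_space => y.2) xz; rewrite /= eps_x scale0r add0r => e.
  by rewrite -[RHS]e; apply: eq_bigr => i _; rewrite vE cD mxE linearZ.
(* [x ^+ p.-1] sends [x t] to [t *m D]; this [t] makes the trivial part of the image equal to
   [z.2]. *)
pose t : 'rV[k]_N := (z.2 - \sum_j row j (ext_cocycle (x ^+ p.-1) (v j))) *m invmx D.
have vI j : v j + x * (t 0 j)%:A \in I by rewrite IP linearD rmorphM /= v0 eps_x mul0r addr0.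
exists ([ffun j => vsproj I (v j + x * (t 0 j)%:A)], 0); rewrite actE.
rewrite [LHS]surjective_pairing [RHS]surjective_pairing; congr pair.
  apply/ffunP => j; apply: subvs_inj; rewrite ext_act_fst ffunE vsprojK //.
  by rewrite mulrDr mulrA -exprSr prednK ?xp ?mul0r ?addr0 // ltnW.
rewrite /= scaler0 add0r.
transitivity (\sum_j row j (ext_cocycle (x ^+ p.-1) (v j)) + t *m D).
  by rewrite mulmxKV // addrC subrK.
rewrite -mD -big_split; apply: eq_bigr => j _ /=.
rewrite ffunE vsprojK // -[v j]scale1r cocycle_linearr cD' epsA.
by rewrite !scale1r linearD linearZ.
Qed.

End ExtensionModule.

(** * Homogeneous polynomial functions *)

Section HomogeneousFunctions.
Variables (k : fieldType) (n : nat).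
Implicit Types (f g : 'rV[k]_n -> k) (l : 'rV[k]_n).

(** A way of building the function takes the place of a multivariate polynomial, so that
    constructions such as [homog_pencil] proceed by induction on it. Zero has every degree. *)
Inductive homog : nat -> ('rV[k]_n -> k) -> Prop :=
| homog_const c : homog 0 (fun=> c)
| homog_zero d : homog d (fun=> 0)
| homog_add d f g : homog d f -> homog d g -> homog d (fun l => f l + g l)
| homog_mulX d i f : homog d f -> homog d.+1 (fun l => l 0 i * f l).

Lemma homog_ext d f g : f =1 g -> homog d f -> homog d g.
Proof. by move=> /boolp.funext ->. Qed.

Lemma homog_scale d c f : homog d f -> homog d (fun l => c * f l).
Proof.
elim=> [a|{}d|{}d {}f g _ IHf _ IHg|{}d i {}f _ IH]; first exact: homog_const.
- by apply: homog_ext (homog_zero _) => l; rewrite mulr0.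
- apply: (@homog_ext _ (fun l => c * f l + c * g l)); last exact: homog_add.
  by move=> l; rewrite mulrDr.
- apply: (@homog_ext _ (fun l => l 0 i * (c * f l))); last exact: homog_mulX.
  by move=> l; rewrite mulrCA.
Qed.

Lemma homog_mul d e f g : homog d f -> homog e g -> homog (d + e) (fun l => f l * g l).
Proof.
move=> hf hg; elim: hf => [a|{}d|{}d {}f f' _ IHf _ IHg|{}d i {}f _ IH].
- exact: homog_scale.
- by apply: homog_ext (homog_zero _) => l; rewrite mul0r.
- apply: (@homog_ext _ (fun l => f l * g l + f' l * g l)); last exact: homog_add.
  by move=> l; rewrite mulrDl.
- apply: (@homog_ext _ (fun l => l 0 i * (f l * g l))); last exact: homog_mulX.
  by move=> l; rewrite mulrA.
Qed.

Lemma homog_sum (I : Type) (r : seq I) (P : pred I) d (F : I -> 'rV[k]_n -> k) :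
  (forall i, P i -> homog d (F i)) -> homog d (fun l => \sum_(i <- r | P i) F i l).
Proof.
move=> hF; elim: r => [|i r IH].
  by apply: homog_ext (homog_zero _) => l; rewrite big_nil.
apply: (@homog_ext _ (fun l => (if P i then F i l else 0) + \sum_(i <- r | P i) F i l)).
  by move=> l; rewrite big_cons; case: ifP; rewrite ?add0r.
by apply: homog_add IH; case: (boolP (P i)) => [/hF|_] //; apply: homog_zero.
Qed.

Lemma homog_prod (I : Type) (r : seq I) d (F : I -> 'rV[k]_n -> k) :
  (forall i, homog d (F i)) -> homog (size r * d) (fun l => \prod_(i <- r) F i l).
Proof.
move=> hF; elim: r => [|i r IH].
  rewrite mul0n; apply: (@homog_ext _ (fun=> 1)); last exact: homog_const.
  by move=> l; rewrite big_nil.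
apply: (@homog_ext _ (fun l => F i l * \prod_(i <- r) F i l)); last exact: homog_mul.
by move=> l; rewrite big_cons.
Qed.

Lemma homog_exp d f m : homog d f -> homog (m * d) (fun l => f l ^+ m).
Proof.
move=> hf; elim: m => [|m IH]; first exact: homog_const.
apply: (@homog_ext _ (fun l => f l * f l ^+ m)); last exact: homog_mul.
by move=> l; rewrite exprS.
Qed.

Lemma homog_det N d (M : 'rV[k]_n -> 'M[k]_N) :
  (forall i j, homog d (fun l => M l i j)) -> homog (N * d) (fun l => \det (M l)).
Proof.
move=> hM; rewrite /determinant; apply: homog_sum => s _.
apply: homog_scale.
have := homog_prod (enum 'I_N) (fun i => hM i (perm.fun_of_perm s i)); rewrite size_enum_ord.
by apply: homog_ext => l; rewrite big_enum.
Qed.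

Lemma homog_linear (h : {linear 'rV[k]_n -> k^o}) : homog 1 (h : _ -> k).
Proof.
apply: (@homog_ext _ (fun l => \sum_i l 0 i * h (delta_mx 0 i))).
  move=> l; rewrite [in RHS](row_sum_delta l) linear_sum.
  by apply: eq_bigr => i _; rewrite linearZ.
by apply: homog_sum => i _; apply/homog_mulX/homog_const.
Qed.

Lemma homog_words d f : homog d f -> exists c : d.-tuple 'I_n -> k,
  forall l, f l = \sum_w c w * \prod_(i <- w) l 0 i.
Proof.
elim=> [a|{}d|{}d {}f g _ [c cE] _ [c' c'E]|{}d i {}f _ [c cE]].
- exists (fun=> a) => l; rewrite (bigD1 [tuple]) //= big_nil mulr1 big1 ?addr0 // => w.
  by rewrite tuple0.
- by exists (fun=> 0) => l; rewrite big1 // => w _; rewrite mul0r.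
- exists (fun w => c w + c' w) => l; rewrite cE c'E -big_split.
  by apply: eq_bigr => w _; rewrite mulrDl.
- exists (fun w => if thead w == i then c (behead_tuple w) else 0) => l; rewrite cE mulr_sumr.
  rewrite [RHS](bigID (fun w => thead w == i)) /= [X in _ + X]big1 ?addr0; last first.
    by move=> w /negPf ->; rewrite mul0r.
  rewrite (reindex (fun w : d.-tuple 'I_n => cons_tuple i w)) /=; last first.
    exists (fun w : d.+1.-tuple 'I_n => behead_tuple w : d.-tuple _) => [w _|w]; first exact/val_inj.
    by rewrite inE => /eqP iw; rewrite [RHS]tuple_eta iw; apply/val_inj.
  apply: eq_big => [w|w _]; first by rewrite theadE eqxx.
  rewrite theadE eqxx big_cons mulrCA; congr (c _ * _); exact/val_inj.
Qed.

Definition mono_index d := {a : {ffun 'I_n -> 'I_d.+1} | (\sum_i a i)%N == d}.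

Lemma homog_span d f : homog d f -> exists c : mono_index d -> k,
  forall l, f l = \sum_(a : mono_index d) c a * \prod_i l 0 i ^+ val a i.
Proof.
move=> /homog_words[c cE]; pose cnt (w : d.-tuple 'I_n) : {ffun 'I_n -> 'I_d.+1} :=
  [ffun i => inord (count_mem i w)].
have cntE w i : cnt w i = count_mem i w :> nat.
  by rewrite ffunE inordK // ltnS -{2}(size_tuple w) count_size.
have cntP w : (\sum_i cnt w i)%N == d.
  under eq_bigr do rewrite cntE.
  rewrite -[X in _ == X](size_tuple w); elim: (val w) => [|j s IH] /=; first by rewrite big1.
  by rewrite big_split /= (eqP IH) (bigD1 j) //= eqxx big1 ?addn0 // => i /negPf; rewrite eq_sym => ->.
pose m w : mono_index d := exist _ (cnt w) (cntP w).
exists (fun a => \sum_(w | m w == a) c w) => l; rewrite cE.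
rewrite (partition_big m xpredT) //=; apply: eq_bigr => a _.
rewrite mulr_suml; apply: eq_bigr => w /eqP <-; congr (_ * _) => /=.
under [RHS]eq_bigr do rewrite cntE.
elim: (val w) => [|j s IH] /=; first by rewrite big_nil big1.
under [RHS]eq_bigr do rewrite exprD; rewrite big_split -IH big_cons (bigD1 j) //=.
by congr (_ * _); rewrite eqxx [_ ^+ true]expr1 big1 ?mulr1 // => i /negPf; rewrite eq_sym => ->.
Qed.

(** The exponent at [ord0] is determined by the other exponents and the total degree. *)
Lemma card_mono_index d : (0 < n)%N -> (#|{: mono_index d}| <= d.+1 ^ n.-1)%N.
Proof.
rewrite /mono_index; case: n => // m _.
rewrite -[X in (_ <= X ^ m)%N](card_ord d.+1) -[X in (_ <= _ ^ X)%N](card_ord m) -card_ffun.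
pose h (a : {a : {ffun 'I_m.+1 -> 'I_d.+1} | (\sum_i a i)%N == d}) : {ffun 'I_m -> 'I_d.+1} :=
  [ffun i => val a (lift ord0 i)].
apply: (@leq_card _ _ h) => -[a aP] [b bP] /ffunP e; apply: val_inj; apply/ffunP => i /=.
have e' j : a (lift ord0 j) = b (lift ord0 j) by have := e j; rewrite !ffunE.
case: (unliftP ord0 i) => [j ->|->]; first exact: e'.
apply: val_inj => /=; have : (\sum_i a i = \sum_i b i)%N by rewrite (eqP aP) (eqP bP).
rewrite !big_ord_recl; under eq_bigr do rewrite e'.
exact: addIn.
Qed.

End HomogeneousFunctions.

(** * Determinantal representation of forms by linear pencils *)

Section Pencils.
Variables (k : fieldType) (n : nat).
Implicit Types (f : 'rV[k]_n -> k) (l : 'rV[k]_n).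

Lemma unitmx_colP N (M : 'M[k]_N) :
  M \in unitmx <-> forall s : 'cV[k]_N, M *m s = 0 -> s = 0.
Proof.
split=> [uM s e|h]; first by rewrite -(mulKmx uM s) e mulmx0.
rewrite -unitmx_tr unitmxE unitfE; apply/negP => /det0P[s s0 sM].
case/negP: s0; apply/eqP/trmx_inj; rewrite trmx0; apply: h.
by apply: trmx_inj; rewrite trmx_mul trmxK trmx0.
Qed.

Lemma scalar_mx11_mul (a b : k) : a%:M *m b%:M = (a * b)%:M :> 'M_1.
Proof. by rewrite -scalar_mxM. Qed.

Variable h : {linear 'rV[k]_n -> k^o}.

(* [f / h ^ d.+1] is realised as [u (K l)^-1 v] with [K] linear in [l]. *)
Lemma homog_pencil d f : homog d f ->
  exists N (K : 'rV[k]_n -> 'M[k]_N) (u : 'rV[k]_N) (v : 'cV[k]_N), linear K /\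
    forall l, h l != 0 -> K l \in unitmx /\
      exists s, K l *m s = v /\ u *m s = (f l / h l ^+ d.+1)%:M.
Proof.
have hl : linear (fun l => (h l)%:M : 'M[k]_1).
  by move=> a l l'; apply/matrixP => i j; rewrite !mxE linearP mulrnDl -mulrnAr.
elim=> [c|{}d|{}d f1 f2 _ [N1 [K1 [u1 [v1 [K1l H1]]]]] _ [N2 [K2 [u2 [v2 [K2l H2]]]]]
       |{}d i {}f _ [N [K [u [v [Kl H]]]]]].
- exists 1%N, (fun l => (h l)%:M), c%:M, 1%:M; split=> // l hl0; split.
    by rewrite unitmxE det_scalar1 unitfE.
  by exists (h l)^-1%:M; rewrite !scalar_mx11_mul mulfV // expr1.
- exists 1%N, (fun l => (h l)%:M), 0, 1%:M; split=> // l hl0; split.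
    by rewrite unitmxE det_scalar1 unitfE.
  by exists (h l)^-1%:M; rewrite !scalar_mx11_mul mulfV // mul0mx mul0r raddf0.
- exists (N1 + N2)%N, (fun l => block_mx (K1 l) 0 0 (K2 l)), (row_mx u1 u2), (col_mx v1 v2).
  split=> [a l l'|l hl0]; first by rewrite K1l K2l scale_block_mx add_block_mx !scaler0 !addr0.
  have [U1 [s1 [K1s u1s]]] := H1 l hl0; have [U2 [s2 [K2s u2s]]] := H2 l hl0.
  split; first by move: U1 U2; rewrite !unitmxE det_ublock unitrM => -> ->.
  exists (col_mx s1 s2); rewrite mul_block_col !mul0mx addr0 add0r K1s K2s; split=> //.
  by rewrite mul_row_col u1s u2s mulrDl raddfD.
exists (1 + N)%N, (fun l => block_mx (h l)%:M (- (l 0 i *: u)) 0 (K l)), (row_mx 1%:M 0), (col_mx 0 v).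
split=> [a l l'|l hl0].
  rewrite hl Kl scale_block_mx add_block_mx scaler0 addr0; congr block_mx.
  by rewrite !mxE scalerDl opprD scalerN scalerA.
have [U [s [Ks us]]] := H l hl0.
split; first by move: U; rewrite !unitmxE det_ublock unitrM => ->; rewrite det_scalar1 unitfE hl0.
pose a := l 0 i * f l / h l ^+ d.+2.
exists (col_mx a%:M s); rewrite mul_block_col mul0mx add0r Ks; split.
  congr col_mx; rewrite scalar_mx11_mul mulNmx -scalemxAl us.
  apply/matrixP => i1 i2; rewrite !ord1 !mxE eqxx !mulr1n.
  by rewrite /a (exprS _ d.+1) invfM mulrCA mulVKf // -mulrA subrr.
by rewrite mul_row_col mul1mx mul0mx addr0.
Qed.

(** Border the pencil [K] by [h v] and [h u]. Where [h != 0], the determinant is [\det (K l)] times,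
    up to sign, [h l ^+ 2] times the Schur complement [f l / h l ^+ d.+1]; where [h = 0], the last
    column vanishes. *)
Lemma homog_hypersurface d f : homog d f ->
  exists N (C : 'I_n -> 'M[k]_N), forall l,
    (\sum_i l 0 i *: C i \in unitmx) = (h l * f l != 0).
Proof.
move=> /homog_pencil[N [K [u [v [Kl H]]]]].
pose M l : 'M[k]_(N + 1) := block_mx (K l) (h l *: v) (h l *: u) 0.
have Ml : linear M.
  move=> a l l'; rewrite /M Kl linearP scale_block_mx add_block_mx scaler0 addr0.
  by rewrite !scalerDl !scalerA.
exists (N + 1)%N, (fun i => M (delta_mx 0 i)) => l.
have -> : \sum_i l 0 i *: M (delta_mx 0 i) = M l.
  pose ML := HB.pack_for {linear 'rV[k]_n -> 'M[k]_(N + 1)} M (GRing.isLinear.Build k _ _ _ M Ml).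
  rewrite {2}(row_sum_delta l) -[M _]/(ML _) linear_sum.
  by apply: eq_bigr => i _; rewrite linearZ.
have ker t : M l *m col_mx (0 : 'cV_N) t = col_mx (h l *: v *m t) (0 : 'cV_1).
  by rewrite mul_block_col !mulmx0 mul0mx add0r addr0.
apply/idP/idP => [/unitmx_colP inj|].
  apply/negP => /eqP /eqP; rewrite mulf_eq0; case: (eqVneq (h l) 0) => [h0 _|h0 /= f0].
    have /inj : M l *m col_mx (0 : 'cV_N) (1%:M : 'cV_1) = 0.
      by rewrite ker h0 scale0r mul0mx col_mx0.
    rewrite -[RHS](@col_mx0 _ N 1 1) => /eq_col_mx[_ /matrixP/(_ 0 0)] /eqP.
    by rewrite !mxE oner_eq0.
  have [_ [s [Ks us]]] := H l h0.
  have /inj : M l *m col_mx (- (h l *: s)) (1%:M : 'cV_1) = 0.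
    rewrite mul_block_col mulmx1 mul0mx addr0 !mulmxN -!scalemxAl -!scalemxAr Ks addNr us.
    by rewrite (eqP f0) mul0r raddf0 !scaler0 oppr0 col_mx0.
  rewrite -[RHS](@col_mx0 _ N 1 1) => /eq_col_mx[_ /matrixP/(_ 0 0)] /eqP.
  by rewrite !mxE oner_eq0.
rewrite mulf_eq0 negb_or => /andP[h0 f0]; apply/unitmx_colP => s.
have [U [s0 [Ks us]]] := H l h0.
rewrite -[s]vsubmxK mul_block_col mul0mx addr0 -[RHS](@col_mx0 _ N 1 1) => /eq_col_mx[e1 e2].
set t := dsubmx s in e1 *; set s1 := usubmx s in e1 e2 *.
have t0 : t = 0.
  move: e2 e1; rewrite [t]mx11_scalar; set c := t 0 0 => /eqP.
  rewrite -scalemxAl scaler_eq0 (negPf h0) /= => /eqP us1 /eqP.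
  rewrite -scalemxAl mul_mx_scalar scalerA -Ks scalemxAr -mulmxDr => /eqP/(congr1 (mulmx (invmx (K l)))).
  rewrite mulKmx // mulmx0 => /(congr1 (mulmx u)); rewrite mulmxDr us1 add0r mulmx0 -scalemxAr us.
  move=> /matrixP/(_ 0 0)/eqP; rewrite !mxE eqxx mulr1n !mulf_eq0 (negPf h0) /= (negPf f0) /=.
  by rewrite invr_eq0 expf_eq0 (negPf h0) andbF orbF => /eqP ->; rewrite raddf0.
move: e1; rewrite t0 mulmx0 addr0 => /(congr1 (mulmx (invmx (K l)))).
by rewrite mulKmx // mulmx0 => ->; rewrite col_mx0.
Qed.

End Pencils.

(** * Chains of irreducible closed sets *)

Section HilbertCount.
Variables (k : fieldType) (n : nat).
Implicit Types (f g : 'rV[k]_n -> k) (l : 'rV[k]_n) (Z : 'rV[k]_n -> Prop).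

Definition vanishes Z f := forall l, Z l -> f l = 0.

Definition homog_prime Z := forall d e f g, homog d f -> homog e g ->
  vanishes Z (fun l => f l * g l) -> vanishes Z f \/ vanishes Z g.

Definition independent Z (T : finType) (phi : T -> 'rV[k]_n -> k) :=
  forall c : T -> k, vanishes Z (fun l => \sum_a c a * phi a l) -> forall a, c a = 0.

(* Restrict to [Z'], where [g] vanishes, then divide by [g]. *)
Lemma independent_powers Z' Z D g (T : finType) M E (d : nat -> nat)
    (phi : nat -> T -> 'rV[k]_n -> k) (c : nat -> T -> k) :
    (forall l, Z' l -> Z l) -> homog_prime Z -> homog D g -> vanishes Z' g -> ~ vanishes Z g ->
    (forall m a, (m < M)%N -> homog (d m) (phi m a)) ->
    (forall m, (m < M)%N -> (d m + m * D = E)%N) ->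
    (forall m, (m < M)%N -> independent Z' (phi m)) ->
    vanishes Z (fun l => \sum_(m < M) \sum_a c m a * (g l ^+ m * phi m a l)) ->
  forall m a, (m < M)%N -> c m a = 0.
Proof.
move=> sub pZ hg g0 gZ; elim: M E d phi c => [//|M IH] E d phi c hphi dE ind van.
have split l : \sum_(m < M.+1) \sum_a c m a * (g l ^+ m * phi m a l) =
    \sum_a c 0%N a * phi 0%N a l + g l * \sum_(m < M) \sum_a c m.+1 a * (g l ^+ m * phi m.+1 a l).
  rewrite big_ord_recl; congr (_ + _); first by apply: eq_bigr => a _; rewrite expr0 mul1r.
  rewrite mulr_sumr; apply: eq_bigr => m _; rewrite mulr_sumr; apply: eq_bigr => a _.
  by rewrite [RHS]mulrCA [X in _ = _ * X]mulrA -exprS.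
have c0 a : c 0%N a = 0.
  apply: (ind 0%N isT (c 0%N)) => l Zl; have := van l (sub l Zl); rewrite split g0 // mul0r addr0.
  by [].
have c1 m a : (m < M)%N -> c m.+1 a = 0.
  apply: (IH (E - D)%N (fun m => d m.+1) (fun m => phi m.+1) (fun m => c m.+1)) => //.
  - by move=> m' a' mM; apply: hphi.
  - by move=> m' mM; rewrite -(dE m'.+1) // mulSn addnCA addKn.
  - by move=> m' mM; apply: ind.
  pose P l := \sum_(m < M) \sum_a c m.+1 a * (g l ^+ m * phi m.+1 a l).
  have hP : homog (E - D) P.
    apply: homog_sum => m' _; apply: homog_sum => a' _; apply: homog_scale.
    have mM := ltn_ord m'; rewrite -(dE m'.+1) // mulSn addnCA addKn addnC.
    by apply: homog_mul; [exact: homog_exp | exact: hphi].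
  have vP : vanishes Z (fun l => g l * P l).
    move=> l Zl; have := van l Zl; rewrite split big1 ?add0r // => a' _.
    by rewrite c0 mul0r.
  by have [] := pZ D (E - D)%N g P hg hP vP.
by case=> [|m] a; [rewrite c0 | exact: c1].
Qed.

Lemma card_independent Z (T : finType) d (phi : T -> 'rV[k]_n -> k) : (0 < n)%N ->
  (forall a, homog d (phi a)) -> independent Z phi -> (#|T| <= d.+1 ^ n.-1)%N.
Proof.
move=> n_gt0 hphi ind; apply: leq_trans (card_mono_index d n_gt0).
have /boolp.choice[c cE] a : exists c : mono_index n d -> k,
  forall l, phi a l = \sum_b c b * \prod_i l 0 i ^+ val b i by apply: homog_span.
pose B : 'M[k]_(#|T|, #|{: mono_index n d}|) := \matrix_(i, j) c (enum_val i) (enum_val j).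
rewrite leqNgt; apply/negP => lt.
have K0 : kermx B != 0.
  apply/eqP => K0; have := mxrank_ker B; rewrite K0 mxrank0 => /esym/eqP.
  by rewrite subn_eq0 leqNgt (leq_ltn_trans (rank_leq_col B) lt).
have /rowV0Pn[v /sub_kermxP vB v0] := K0.
case/negP: v0; apply/eqP/rowP => i; rewrite mxE -[i]enum_valK.
apply: (ind (fun a => v 0 (enum_rank a))) => l _.
under eq_bigr do rewrite cE mulr_sumr; rewrite exchange_big big1 // => b _.
under eq_bigr do rewrite mulrA; rewrite -mulr_suml.
have /matrixP/(_ 0 (enum_rank b)) := vB; rewrite !mxE => e.
rewrite (_ : \sum_a _ = 0) ?mul0r // -[RHS]e (reindex (@enum_val T xpredT)) /=; last first.
  by apply: onW_bij; apply: enum_val_bij.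
by apply: eq_bigr => j _; rewrite mxE enum_valK enum_rankK.
Qed.

(** On [Z j.+1], multiply the powers [g j.+1 ^+ m], [m <= s], by functions of degree [(t - m) * D]
    independent on [Z j], and use [independent_powers]. The condition [j * s <= t] leaves enough
    degree for all steps. *)
Lemma prime_chain_independent D s (Z : nat -> 'rV[k]_n -> Prop) (g : nat -> 'rV[k]_n -> k) r :
    (forall j, (j < r)%N -> homog_prime (Z j)) ->
    (forall j l, (j.+1 < r)%N -> Z j l -> Z j.+1 l) ->
    (forall j, (j < r)%N -> homog D (g j)) ->
    (forall j, (j.+1 < r)%N -> vanishes (Z j) (g j.+1)) ->
    (forall j, (j < r)%N -> ~ vanishes (Z j) (g j)) ->
  forall j t, (j < r)%N -> (j * s <= t)%N ->
  exists phi : 'I_(s.+1 ^ j) -> 'rV[k]_n -> k,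
    (forall a, homog (t * D) (phi a)) /\ independent (Z j) phi.
Proof.
move=> pZ sub hg van nvan; elim=> [|j IH] t jr jt.
  exists (fun=> fun l => g 0%N l ^+ t); split=> [a|c h a]; first exact/homog_exp/hg.
  have h' l : Z 0%N l -> c a = 0 \/ g 0%N l = 0.
    move=> /h; rewrite (bigD1 a) //= big1 ?addr0 => [/eqP|b]; last by rewrite (ord1 a) (ord1 b).
    by rewrite mulf_eq0 expf_eq0 => /orP[/eqP|/andP[_ /eqP]]; [left | right].
  by apply: contrapT => ca; apply: (nvan 0%N jr) => l /h'[].
have /boolp.choice[phi phiP] (m : 'I_s.+1) : exists phi : 'I_(s.+1 ^ j) -> 'rV[k]_n -> k,
    (forall a, homog ((t - m) * D) (phi a)) /\ independent (Z j) phi.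
  apply: IH; first exact: ltnW.
  by rewrite leq_subRL; rewrite mulSn in jt; [rewrite (leq_trans _ jt) // leq_add2r -ltnS | 
    apply: leq_trans jt; rewrite (leq_trans _ (leq_addr _ _)) // -ltnS].
pose T : finType := ('I_s.+1 * 'I_(s.+1 ^ j))%type.
have cT : #|T| = (s.+1 ^ j.+1)%N by rewrite card_prod !card_ord expnS.
pose psi (a : T) l := g j.+1 l ^+ a.1 * phi a.1 a.2 l.
suff [hpsi ind] : (forall a, homog (t * D) (psi a)) /\ independent (Z j.+1) psi.
  rewrite -cT; exists (fun i => psi (enum_val i)); split=> [i|c h i]; first exact: hpsi.
  rewrite -[i]enum_valK; apply: (ind (fun a => c (enum_rank a))) => l /h e; rewrite -[RHS]e.
  rewrite (reindex (@enum_val T xpredT)) /=; last by apply: onW_bij; apply: enum_val_bij.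
  by apply: eq_bigr => i' _; rewrite enum_valK.
have ts (m : 'I_s.+1) : (m <= t)%N.
  by apply: leq_trans jt; rewrite mulSn (leq_trans _ (leq_addr _ _)) // -ltnS.
split=> [[m a]|c h [m a]] /=.
  rewrite -[t](subnKC (ts m)) mulnDl; apply: homog_mul; last exact: (phiP m).1.
  exact/homog_exp/hg.
have := @independent_powers (Z j) (Z j.+1) D (g j.+1) 'I_(s.+1 ^ j) s.+1 (t * D)%N
  (fun m => (t - m) * D)%N (fun m => phi (inord m)) (fun m a => c (inord m, a)).
move=> /(_ _ _ _ _ _ _ _ _ _ m a (ltn_ord m)); rewrite inord_val; apply.
- by move=> l; apply: sub.
- exact: pZ.
- exact: hg.
- exact: van.
- exact: nvan.
- by move=> m' a' m's; have := (phiP (inord m')).1 a'; rewrite inordK.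
- by move=> m' m's; rewrite -mulnDl subnK // -(inordK m's) ts.
- by move=> m' m's; exact: (phiP (inord m')).2.
move=> l /h e; rewrite -[RHS]e pair_bigA /=; apply: eq_bigr => -[m' a'] _ /=.
by rewrite inord_val.
Qed.

(* Along a chain of length [r], monomials in the [g j] give [s.+1 ^ r.-1] linearly
   independent functions of degree linear in [s], whereas homogeneous functions of
   degree [d] in [n] variables span a space of dimension at most [d.+1 ^ n.-1]. *)
Lemma prime_chain_length (Z : nat -> 'rV[k]_n -> Prop) r :
    (forall j, (j < r)%N -> homog_prime (Z j)) ->
    (forall j l, (j.+1 < r)%N -> Z j l -> Z j.+1 l) ->
    (forall j l, (j < r)%N -> Z j l -> l != 0) ->
    (forall j, (j < r)%N -> exists l, Z j l) ->
    (forall j, (j.+1 < r)%N -> exists d f,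
       [/\ homog d f, vanishes (Z j) f & ~ vanishes (Z j.+1) f]) ->
  (r <= n)%N.
Proof.
move=> pZ sub Z0 exZ sep.
(* A coordinate nonzero at a point where the form does not vanish is multiplied in, which makes the
   degree positive. *)
have /boolp.choice[df dfP] j : exists df : nat * ('rV[k]_n -> k), (j < r)%N ->
    [/\ (0 < df.1)%N, homog df.1 df.2, (0 < j)%N -> vanishes (Z j.-1) df.2 &
        ~ vanishes (Z j) df.2].
  case: (ltnP j r) => [jr|_]; last by exists (0%N, fun=> 0).
  case: j jr => [|j] jr.
    have [l Zl] := exZ 0%N jr; have /rV0Pn[i li] := (Z0 _ _ jr Zl).
    exists (1%N, fun l => l 0 i * 1) => _; split=> //.
      exact/homog_mulX/homog_const.
    by move=> /(_ l Zl) /eqP; rewrite /= mulr1 (negPf li).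
  have [d [f [hf vf nf]]] := sep j jr.
  have [l [Zl fl]] : exists l, Z j.+1 l /\ f l != 0.
    apply: contrapT => h; apply: nf => l Zl; apply/eqP; apply: contraT => fl.
    by case: h; exists l.
  have /rV0Pn[i li] := (Z0 _ _ jr Zl).
  exists (d.+1, fun l => l 0 i * f l) => _; split=> //; first exact: homog_mulX.
    by move=> _ l' /vf /= ->; rewrite mulr0.
  by move=> /(_ l Zl) /eqP; rewrite /= mulf_eq0 (negPf li) (negPf fl).
(* A common multiple of the degrees, so that suitable powers of the forms all have degree [D]. *)
pose D := (\prod_(i < r) (df i).1)%N.
have D_gt0 : (0 < D)%N by apply: prodn_gt0 => i; have [] := dfP i (ltn_ord i).
have dD j : (j < r)%N -> (D %/ (df j).1 * (df j).1 = D)%N.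
  by move=> jr; rewrite divnK // /D (bigD1 (Ordinal jr)) //= dvdn_mulr.
pose g j l := (df j).2 l ^+ (D %/ (df j).1).
rewrite leqNgt; apply/negP => nr; have r_gt0 : (0 < r)%N by apply: leq_trans nr.
have n_gt0 : (0 < n)%N.
  have [l Zl] := exZ 0%N r_gt0; have /rV0Pn[[i i_lt] _] := (Z0 _ _ r_gt0 Zl).
  exact: leq_trans i_lt.
(* With this [s], functions of degree [r.-1 * s * D] span dimension at most [(C * s.+1) ^ n.-1 = s *
   s.+1 ^ n.-1 < s.+1 ^ n], whereas [n < r] would give [s.+1 ^ r.-1] independent ones. *)
pose C := (r.-1 * D).+1; pose s := (C ^ n.-1)%N.
have [phi [hphi ind]] : exists phi : 'I_(s.+1 ^ r.-1) -> 'rV[k]_n -> k,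
    (forall a, homog (r.-1 * s * D) (phi a)) /\ independent (Z r.-1) phi.
  apply: (@prime_chain_independent D s Z g r) => //; last by rewrite prednK.
  - move=> j jr; have [_ hf _ _] := dfP j jr; rewrite -(dD j jr); exact: homog_exp.
  - move=> j jr l Zl; have [d0 _ /(_ isT l Zl) e _] := dfP j.+1 jr.
    rewrite /g e expr0n gtn_eqF //.
    by have := dD j.+1 jr; case: (D %/ _)%N => // D0; rewrite -D0 mul0n ltnn in D_gt0.
  - move=> j jr; have [_ _ _ nf] := dfP j jr; apply: contra_not nf => v l /v /eqP.
    by rewrite expf_eq0 => /andP[_ /eqP].
have := card_independent n_gt0 hphi ind; rewrite card_ord leqNgt => /negP; apply.
apply: (@leq_ltn_trans ((C * s.+1) ^ n.-1)%N).
  have : ((r.-1 * s * D).+1 <= C * s.+1)%N.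
    rewrite /C mulSn addSn ltnS; apply: leq_trans (leq_addl _ _).
    by rewrite mulnAC leq_mul2l leqnSn orbT.
  by case: (n.-1) => [|m]; rewrite ?expn0 ?leq_exp2r.
apply: (@leq_trans (s.+1 ^ n)%N).
  by rewrite -[X in (_ < _ ^ X)%N](prednK n_gt0) expnS expnMn ltn_mul2r expn_gt0 /= ltnS.
by rewrite leq_pexp2l // -ltnS prednK.
Qed.

End HilbertCount.

(** * Openness of the exact locus *)

Section ExactLocus.
Variables (k : fieldType) (n : nat).

Definition homog_endo (V : vectType k) d (X : 'rV[k]_n -> 'End(V)) :=
  forall (v : V) (phi : {linear V -> k^o}), homog d (fun l => phi (X l v) : k).

Definition vcoord (V : vectType k) i (v : V) : k^o := v2r v 0 i.

Lemma vcoord_linear (V : vectType k) i : linear (@vcoord V i).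
Proof. by move=> c u v; rewrite /vcoord linearP !mxE. Qed.

Lemma homog_endo_comp (V : vectType k) d e (X Y : 'rV[k]_n -> 'End(V)) :
  homog_endo d X -> homog_endo e Y -> homog_endo (d + e) (fun l => X l \o Y l)%VF.
Proof.
move=> hX hY v phi.
apply: (@homog_ext _ _ _ (fun l => \sum_i phi (X l (vbase i)) * vcoord i (Y l v))).
  move=> l; rewrite comp_lfunE [in RHS](vbase_sum (Y l v)) !linear_sum /=.
  by apply: eq_bigr => i _; rewrite !linearZ /= mulrC.
apply: homog_sum => i _; apply: homog_mul; first exact: hX.
exact: (hY v (linear_of (@vcoord_linear V i))).
Qed.

Lemma homog_endo_invertible (V : vectType k) d (X : 'rV[k]_n -> 'End(V)) :
    homog_endo d X ->
  exists e f, homog e f /\ forall l, (f l != 0) = (lker (X l) == 0%VS).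
Proof.
move=> hX; pose M l : 'M[k]_(dim V) := \matrix_(i, j) vcoord j (X l (vbase i)).
exists (dim V * d)%N, (fun l => \det (M l)); split=> [|l].
  apply: homog_det => i j.
  apply: homog_ext (hX (vbase i) (linear_of (@vcoord_linear V j))) => l.
  by rewrite mxE.
have ME v : v2r v *m M l = v2r (X l v).
  apply/rowP => j; rewrite mxE [in RHS](vbase_sum v) !linear_sum summxE.
  by apply: eq_bigr => i _; rewrite !linearZ mxE [RHS]mxE.
apply/idP/idP => [d0|/lker0P inj].
  rewrite -subv0; apply/subvP => v; rewrite memv_ker memv0 => /eqP Xv0.
  apply: contraNT d0 => v0; apply/det0P; exists (v2r v); last by rewrite ME Xv0 linear0.
  by apply: contraNneq v0 => e; rewrite -[v]v2rK e linear0.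
apply/negP => /det0P[w w0]; rewrite -[w]r2vK ME => e.
case/negP: w0; apply/eqP; rewrite -[w]r2vK -[RHS](linear0 v2r); congr v2r; apply: inj.
by rewrite linear0 -[LHS]v2rK e linear0.
Qed.

Variables (A : algType k) (p : nat) (Y : {linear 'rV[k]_n -> A}).
Hypothesis p_gt0 : (0 < p)%N.
Hypothesis Yp : forall l, Y l ^+ p = 0.

(** Fix [h] whose trace is invertible at [l0]. The entries of the trace at [Y l] are homogeneous of
    degree [p.-1] in [l], and its determinant is the required form. *)
Lemma exact_locus (N : fdmod A) l0 : exact_at p N (Y l0) ->
  exists d f, [/\ homog d f, f l0 != 0 & forall l, f l != 0 -> exact_at p N (Y l)].
Proof.
move=> /(homotopy_of_exact p_gt0 (Yp l0))[h hK].
have hact m : homog_endo m (fun l => act N (Y l ^+ m)).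
  elim: m => [|m IH] v phi.
    have -> : (fun l => phi (act N (Y l ^+ 0) v) : k) = (fun=> phi v); last exact: homog_const.
    by apply: boolp.funext => l; rewrite expr0 act1 id_lfunE.
  have -> : (fun l => phi (act N (Y l ^+ m.+1) v) : k) =
      (fun l => phi ((act N (Y l) \o act N (Y l ^+ m))%VF v)).
    by apply: boolp.funext => l; rewrite exprS actM.
  move: v phi; apply: (@homog_endo_comp _ 1 m) IH => v phi.
  have l : linear (fun l => phi (act N (Y l) v) : k^o).
    by move=> c l l'; rewrite !linearP add_lfunE scale_lfunE linearP.
  exact: (homog_linear (linear_of l)).
have hX : homog_endo p.-1 (fun l => homotopy p (Y l) h).
  move=> v phi; apply: (@homog_ext _ _ _ (fun l =>
    \sum_(i < p) phi ((act N (Y l ^+ i) \o (h \o act N (Y l ^+ (p.-1 - i))))%VF v))).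
    by move=> l; rewrite /homotopy sum_lfunE linear_sum.
  apply: homog_sum => i _; have ip : (i <= p.-1)%N by rewrite -ltnS prednK.
  rewrite -{1}(subnKC ip).
  apply: (@homog_endo_comp _ i (p.-1 - i) (fun l => act N (Y l ^+ i))); first exact: hact.
  rewrite -[X in homog_endo X]add0n.
  apply: (@homog_endo_comp _ 0 (p.-1 - i) (fun=> h)); last exact: hact.
  by move=> v' phi'; apply: homog_const.
have [e [f [hf fE]]] := homog_endo_invertible hX.
exists e, f; split=> //; first by rewrite fE.
by move=> l; rewrite fE; apply: exact_of_homotopy.
Qed.

End ExactLocus.

(** * Coordinates on P(U) and modules with prescribed support *)

Section CoordinateElements.
Variables (k : closedFieldType) (p : nat) (A0 : falgType k).
Hypothesis pchar_k : p \in [pchar k].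
Hypothesis cA : commutative ( *%R : A0 -> A0 -> A0).
Local Notation A := (com_falg cA).
Variables (n : nat) (x : 'I_n -> A) (f : 'I_n -> nat).
Hypothesis f_gt0 : forall i, (0 < f i)%N.
Hypothesis xq : forall i, x i ^+ (p ^ f i) = 0.
Hypothesis top_neq0 : \prod_i x i ^+ (p ^ f i).-1 != 0.
Hypothesis generated : forall V : {vspace A}, 1 \in V ->
  (forall i u, u \in V -> x i * u \in V) -> V = fullv.
Variable eps : {lrmorphism A -> k^o}.
Hypothesis nilp : forall u : A, eps u = 0 -> exists n, u ^+ n = 0.
Local Notation Y := (ypoint p x f).
Local Notation y := (ygen p x f).

Lemma ypoint_linear : linear Y.
Proof.
move=> c l l'; rewrite /ypoint scaler_sumr -big_split; apply: eq_bigr => i _ /=.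
by rewrite !mxE scalerDl scalerA.
Qed.

(** Each coefficient [w i] is a scalar plus a nilpotent [v i]. The terms [y i * v i] are added one
    by one with [exact_perturbed]; the converse adds [y i * (- v i)]. *)
Lemma exact_ypoint (u : A) : u ^+ p = 0 ->
  exists l, forall N : fdmod A, exact_at p N u <-> exact_at p N (Y l).
Proof.
move=> up; have [w uE] := frob_kernel_generated pchar_k f_gt0 xq top_neq0 generated up.
have y_p i : y i ^+ p = 0 by apply: ygen_p f_gt0 xq i.
exists (\row_i eps (w i)) => N; pose v i : A := w i - (eps (w i) : k)%:A.
have /boolp.choice[K vK] i : exists K, v i ^+ K = 0.
  by apply: nilp; rewrite linearB linearZ rmorph1 /= -[_ *: 1]/(_ * 1) mulr1 subrr.
have YE : u = Y (\row_i eps (w i)) + \sum_i y i * v i.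
  rewrite uE /ypoint -big_split; apply: eq_bigr => i _ /=.
  by rewrite mxE /v mulrBr -scalerAr mulr1 addrC subrK mulrC.
have pA (a b : A) : (a + b) ^+ p = a ^+ p + b ^+ p.
  by have := frobD pchar_k (cA := cA) 1 a b; rewrite expn1.
have sumP (z : A) (r : seq 'I_n) : z ^+ p = 0 ->
    (z + \sum_(i <- r) y i * v i) ^+ p = 0 /\
    (exact_at p N z <-> exact_at p N (z + \sum_(i <- r) y i * v i)).
  move=> zp; elim: r => [|i r [IHp IH]]; first by rewrite big_nil addr0.
  rewrite big_cons addrCA addrC; split.
    by rewrite pA IHp exprMn y_p mul0r addr0.
  rewrite IH; split=> [|h].
    exact: (exact_perturbed pchar_k cA IHp (y_p i) (vK i)).
  have zi : (z + \sum_(j <- r) y j * v j + y i * v i) ^+ p = 0.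
    by rewrite pA IHp exprMn y_p mul0r addr0.
  have vN : (- v i) ^+ K i = 0 by rewrite exprNn vK mulr0.
  have := exact_perturbed pchar_k cA zi (y_p i) vN h.
  by rewrite mulrN addrK.
have Yp := ypoint_p pchar_k f_gt0 xq (\row_i eps (w i)).
by rewrite YE; have [_ ->] := sumP _ (index_enum _) Yp.
Qed.

(** [ext_mod_exact] involves the powers [l 0 i ^+ p], so the pencil is twisted by Frobenius: the sum
    becomes the twist of [\sum_i l 0 i *: C i], invertible at the same [l]. *)
Lemma hypersurface_module (h : {linear 'rV[k]_n -> k^o}) d (g : 'rV[k]_n -> k) : homog d g ->
  exists N : fdmod A, forall l, l != 0 -> (exact_at p N (Y l) <-> h l * g l != 0).
Proof.
move=> /(homog_hypersurface h)[N [C CE]].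
have /boolp.choice[F FP] i := truncation_exists pchar_k f_gt0 xq top_neq0 generated eps i.
have p_gt1 : (1 < p)%N := prime_gt1 (pcharf_prime pchar_k).
have r_gt0 i : (0 < p ^ (f i).-1)%N by rewrite expn_gt0 (ltnW p_gt1).
have qE i : (p ^ f i = p * p ^ (f i).-1)%N by rewrite -expnS prednK.
have F_size i u : (size (F i u) <= p ^ f i)%N by have [] := FP i.
have F1 i : F i 1 = 1 by have [] := FP i.
have FM i u v : F i (u * v) = take_poly (p ^ f i) (F i u * F i v) by have [] := FP i.
have F_eps i u : (F i u)`_0 = eps u by have [] := FP i.
pose frob := pFrobenius_aut pchar_k.
exists (ext_mod F_size F1 FM F_eps (fun i => map_mx frob (C i))) => l l0.
have E : \sum_i l 0 i ^+ p *: map_mx frob (C i) = map_mx frob (\sum_i l 0 i *: C i).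
  by rewrite raddf_sum; apply: eq_bigr => i _; rewrite /= map_mxZ.
rewrite -CE (ext_mod_exact p_gt1 r_gt0 qE F_size F1 FM F_eps _ (l := fun i => l 0 i)).
- by rewrite E map_unitmx.
- move=> i; rewrite /ypoint linear_sum (bigD1 i) //= big1 ?addr0 => [|j ji].
    by rewrite linearZ; have [_ _ _ _ ->] := FP i; rewrite eqxx.
  by rewrite linearZ; have [_ _ _ _ ->] := FP i; rewrite eq_sym (negPf ji) /= scaler0.
- exact: (ypoint_p pchar_k f_gt0 xq l).
- exact/rV0Pn.
exact: (ypoint_exact pchar_k f_gt0 xq top_neq0 generated l0).
Qed.

End CoordinateElements.

Section UnipotentCoordinates.
Variables (k : closedFieldType) (p : nat).
Hypothesis pchar_k : p \in [pchar k].
Variable U : finGroupScheme k.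
Hypothesis abU : abelian_scheme U.
Hypothesis uniU : unipotent_scheme U.

Lemma unipotent_coordinates : exists n (Y : {linear 'rV[k]_n -> measure U}),
  [/\ forall l, Y l ^+ p = 0,
      forall l u, l != 0 -> Y l * u = 0 -> exists v, u = Y l ^+ p.-1 * v,
      forall u : measure U, u ^+ p = 0 ->
        exists l, forall N : gmod U, exact_at p N u <-> exact_at p N (Y l),
      forall (h : {linear 'rV[k]_n -> k^o}) d g, homog d g ->
        exists N : gmod U, forall l, l != 0 -> (exact_at p N (Y l) <-> h l * g l != 0) &
      exists (L : measure U) (tr : {linear measure U -> k^o}),
        [/\ L != 0, forall u, tr (L * u) = augmentation u,
            forall u, L * u = (augmentation u : k) *: L,
            forall h : {linear measure U -> k^o}, exists z, forall u, tr (u * z) = h u &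
            forall z, (forall u, tr (u * z) = 0) -> z = 0]].
Proof.
have [n [x [f [f_gt0 xq top gen]]]] := unipotent_presentation pchar_k abU uniU.
pose cA := abelian_measure abU.
pose Y : {linear 'rV[k]_n -> com_falg cA} := linear_of (ypoint_linear p x f).
have nilp (u : com_falg cA) : com_augmentation abU u = 0 -> exists m, u ^+ m = 0.
  exact: augmentation_nilpotent uniU u.
exists n, Y; split.
- exact: (ypoint_p pchar_k f_gt0 xq).
- by move=> l u l0; apply: (ypoint_exact pchar_k f_gt0 xq top gen l0).
- exact: (exact_ypoint pchar_k f_gt0 xq top gen nilp).
- exact: (hypersurface_module pchar_k f_gt0 xq top gen (com_augmentation abU)).
have [L [tr [L0 trL LI dual nondeg]]] := frobenius_form pchar_k xq top gen (com_augmentation abU).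
exists L, tr; split=> //.
move=> u; rewrite (abelian_measure abU L u); exact: LI.
Qed.

End UnipotentCoordinates.

(** * From p-points to exactness at an element *)

Section PPointExactness.
Variables (k : closedFieldType) (p : nat).
Hypothesis pchar_k : p \in [pchar k].
Let p_gt1 : (1 < p)%N := prime_gt1 (pcharf_prime pchar_k).

Lemma ppoint_exact (G : finGroupScheme k) (a : ppoint p G) (N : gmod G) :
  proj_fdmod (pullback a N) <-> exact_at p N (a (trunc_t k p)).
Proof. by split=> [/(exact_of_projective p_gt1)|/(projective_of_exact p_gt1)]. Qed.

Lemma ppoint_exists (G : finGroupScheme k) (U : subgroupScheme G) (u : measure U) :
    is_au_subgroup U -> u ^+ p = 0 -> exact_at p (regmod (measure G)) (incl u) ->
  exists a : ppoint p G, a (trunc_t k p) = incl u.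
Proof.
move=> auU up ex; have xp : incl u ^+ p = 0 by rewrite -rmorphXn up rmorph0.
pose f := trunc_eval_morph p_gt1 xp.
have ft : f (trunc_t k p) = incl u by apply: trunc_eval_t.
have fproj : proj_fdmod (pullback f (regmod (measure G))).
  by apply: (projective_of_exact p_gt1); rewrite ft.
have inclA c : incl (c%:A : measure U) = c%:A by rewrite linearZ rmorph1.
have fA c : f c%:A = c%:A by rewrite linearZ rmorph1.
have ffac : exists V : subgroupScheme G, is_au_subgroup V /\
    forall r, exists v : measure V, f r = measure_incl v.
  exists U; split=> //; elim/trunc_poly_ind => [c|r c [v vE]].
    by exists c%:A; rewrite -[RHS]/(incl _) !linearZ !rmorph1.
  exists (v * u + c%:A).
  have -> : f (r * trunc_t k p + c%:A) = incl v * incl u + c%:A.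
    rewrite rmorphD rmorphM; congr (_ * _ + _); [exact: vE | exact: ft | exact: fA].
  by rewrite -[RHS]/(incl _) rmorphD rmorphM /= inclA.
by exists (PPoint fproj ffac).
Qed.

Lemma tmap_id (G : finGroupScheme k) (t : tensor G G) : t = tmap idfun idfun t.
Proof. exact: tens_ext. Qed.

Definition whole_subgroup (G : finGroupScheme k) : subgroupScheme G :=
  @SubgroupScheme k G G idfun (fun b => ex_intro _ b erefl) (fun a => tmap_id (comul G a))
    (fun a => erefl).

Lemma incl_whole (G : finGroupScheme k) (u : measure G) :
  incl (U := whole_subgroup G) u = u.
Proof. by apply: measureP => a; rewrite inclE. Qed.

Variable G : finGroupScheme k.
Local Notation t := (trunc_t k p).

Definition ppclass (a : ppoint p G) : Pspace p G :=
  exist _ (ppoint_class a) (ex_intro _ a erefl).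

Lemma ppclass_surj (c : Pspace p G) : exists a, c = ppclass a.
Proof. by case: c => c [a e]; exists a; subst c. Qed.

Lemma Psupp_ppclass (N : gmod G) a : Psupp N (ppclass a) <-> ~ exact_at p N (a t).
Proof.
split=> [[b [/= ab nb]]|na]; last by exists a; split=> // /ppoint_exact.
have : ppoint_class a b by rewrite ab; split.
by move=> /(_ N) e; rewrite -ppoint_exact e.
Qed.

End PPointExactness.

Lemma natmaxP (S : set nat) : natmax S = 0%N \/ S (natmax S).
Proof. by rewrite /natmax; case: xgetP => [m _ [Sm _]|_]; [right | left]. Qed.

(** Either one coordinate is nonzero at both points, or the sum of two coordinates is, each
    vanishing at the point where the other does not. *)
Lemma common_nonvanishing (k : fieldType) n (z1 z2 : 'rV[k]_n) : z1 != 0 -> z2 != 0 ->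
  exists h : {linear 'rV[k]_n -> k^o}, h z1 != 0 /\ h z2 != 0.
Proof.
have coord_linear i : linear (fun l : 'rV[k]_n => l 0 i : k^o).
  by move=> c l l'; rewrite !mxE.
move=> /rV0Pn[i zi] /rV0Pn[j zj].
have [zi2|z2i] := boolP (z2 0 i != 0); first by exists (linear_of (coord_linear i)).
have [zj1|z1j] := boolP (z1 0 j != 0); first by exists (linear_of (coord_linear j)).
have l : linear (fun l : 'rV[k]_n => l 0 i + l 0 j : k^o).
  by move=> c l l'; rewrite !mxE scalerDr addrACA.
exists (linear_of l); rewrite /= (eqP (negbNE z2i)) (eqP (negbNE z1j)).
by rewrite addr0 add0r.
Qed.

(** * The length of chains of irreducible closed sets *)

Section ChainBound.
Variables (k : closedFieldType) (p : nat).
Hypothesis pchar_k : p \in [pchar k].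
Variable U : finGroupScheme k.
Hypothesis abU : abelian_scheme U.
Hypothesis uniU : unipotent_scheme U.
Variables (n : nat) (Y : {linear 'rV[k]_n -> measure U}).
Hypothesis Yp : forall l, Y l ^+ p = 0.
Hypothesis Y_exact : forall l u, l != 0 -> Y l * u = 0 -> exists v, u = Y l ^+ p.-1 * v.
Hypothesis Y_points : forall u : measure U, u ^+ p = 0 ->
  exists l, forall N : gmod U, exact_at p N u <-> exact_at p N (Y l).
Hypothesis Y_modules : forall (h : {linear 'rV[k]_n -> k^o}) d g, homog d g ->
  exists N : gmod U, forall l, l != 0 -> (exact_at p N (Y l) <-> h l * g l != 0).
Local Notation t := (trunc_t k p).

Let p_gt1 : (1 < p)%N := prime_gt1 (pcharf_prime pchar_k).

Lemma ppoint_of_coordinates l : l != 0 -> exists a : ppoint p U, a t = Y l.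
Proof.
move=> l0; have := @ppoint_exists k p pchar_k U (whole_subgroup U) (Y l).
rewrite incl_whole; apply=> //.
move=> u; rewrite lfunE /= => /(Y_exact l0)[v ->]; exists v.
by rewrite lfunE.
Qed.

Lemma ppclass_coordinates (c : Pspace p U) : exists l, l != 0 /\
  forall N : gmod U, Psupp N c <-> ~ exact_at p N (Y l).
Proof.
have [a ->] := ppclass_surj c; have [l lP] := Y_points (lrmorph_tp p_gt1 a).
exists l; split; last by move=> N; rewrite (Psupp_ppclass pchar_k) lP.
(* [Y 0 = 0] is not exact on the regular module, since [p.-1 > 0], whereas a p-point is. *)
apply/eqP => l0.
have /(ppoint_exact pchar_k)/lP ex : proj_fdmod (pullback a (regmod (measure U))).
  exact: (@ppoint_proj k p U a).
have [|m] := ex (1 : measure U); first by rewrite l0 linear0 linear0 zero_lfunE.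
rewrite l0 linear0 expr0n -subn1 subn_eq0 leqNgt p_gt1 linear0 zero_lfunE => /eqP.
by rewrite oner_eq0.
Qed.

(** The sets [Z j] are the coordinate vectors of [c j]. If [f g] vanishes on [Z j] and neither
    factor does, the supports cut out by [h f] and [h g] cover [c j]; by irreducibility one of them
    contains it, against a point where neither [h] nor that factor vanishes. Strict inclusions give
    separating forms through [exact_locus]. *)
Lemma irr_chain_length r (c : 'I_r -> set (Pspace p U)) :
  irr_chain (@Pclosed k p U) c -> (r <= n)%N.
Proof.
move=> [cP c_sub].
have closedP j : exists N : gmod U, c j = Psupp N by have [[N cN] _] := cP j; exists N.
(* All [N] with support [c j] are allowed here; [ZP] shows that any one of them decides
   membership. *)
pose Z (j : nat) (l : 'rV[k]_n) := exists jr : (j < r)%N, l != 0 /\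
  forall N : gmod U, c (Ordinal jr) = Psupp N -> ~ exact_at p N (Y l).
have ZP j (jr : (j < r)%N) N l : c (Ordinal jr) = Psupp N ->
    Z j l <-> l != 0 /\ ~ exact_at p N (Y l).
  move=> cN; split=> [[jr' [l0 h]]|[l0 h]].
    by split=> //; apply: h; rewrite -cN; congr c; apply: val_inj.
  exists jr; split=> // N' cN'; have [a aE] := ppoint_of_coordinates l0.
  have : Psupp N (ppclass a) by rewrite (Psupp_ppclass pchar_k) aE.
  by rewrite -cN cN' (Psupp_ppclass pchar_k) aE.
have member j (jr : (j < r)%N) (z : Pspace p U) : c (Ordinal jr) z ->
    exists l, Z j l /\ forall N : gmod U, Psupp N z <-> ~ exact_at p N (Y l).
  move=> cz; have [l [l0 lP]] := ppclass_coordinates z; have [N cN] := closedP (Ordinal jr).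
  exists l; split=> //; apply/(ZP j jr N) => //; split=> //.
  by rewrite -lP -cN.
have realize j (jr : (j < r)%N) l : Z j l ->
    exists2 z, c (Ordinal jr) z & forall N : gmod U, Psupp N z <-> ~ exact_at p N (Y l).
  move=> Zl; have [N cN] := closedP (Ordinal jr).
  have /(ZP j jr N l cN) [l0 nex] := Zl; have [a aE] := ppoint_of_coordinates l0.
  exists (ppclass a); first by rewrite cN (Psupp_ppclass pchar_k) aE.
  by move=> N'; rewrite (Psupp_ppclass pchar_k) aE.
apply: (@prime_chain_length k n Z r).
- move=> j jr d e f g hf hg fg; apply: contrapT => /not_orP[nf ng].
  have wit F : ~ vanishes (Z j) F -> exists l, Z j l /\ F l != 0.
    move=> nF; apply: contrapT => h; apply: nF => l Zl; apply/eqP.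
    by apply: contraT => Fl; case: h; exists l.
  have [z1 [Z1 fz1]] := wit f nf; have [z2 [Z2 gz2]] := wit g ng.
  have [h [hz1 hz2]] : exists h : {linear 'rV[k]_n -> k^o}, h z1 != 0 /\ h z2 != 0.
    by apply: common_nonvanishing; [case: Z1 => ? [] | case: Z2 => ? []].
  have [N1 N1P] := Y_modules h hf; have [N2 N2P] := Y_modules h hg.
  have [_ [_ irr]] := cP (Ordinal jr).
  have sub : (c (Ordinal jr) `<=` Psupp N1 `|` Psupp N2)%classic.
    move=> z /member[l [Zl lP]]; have l0 : l != 0 by case: Zl => ? [].
    have := fg l Zl => /eqP; rewrite mulf_eq0 => /orP[/eqP f0|/eqP g0]; [left|right];
      by apply/lP; rewrite ?N1P ?N2P // ?f0 ?g0 mulr0 eqxx.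
  case: (irr _ _ (ex_intro _ N1 erefl) (ex_intro _ N2 erefl) sub) => s.
    have [z /s zN zP] := realize j jr z1 Z1; move/zP: zN; apply; apply/N1P.
      by case: Z1 => ? [].
    by rewrite mulf_neq0.
  have [z /s zN zP] := realize j jr z2 Z2; move/zP: zN; apply; apply/N2P.
    by case: Z2 => ? [].
  by rewrite mulf_neq0.
- move=> j l jr Zl; have jr' : (j < r)%N by apply: ltnW.
  have [z cz zP] := realize j jr' l Zl; have [N cN] := closedP (Ordinal jr).
  apply/(ZP j.+1 jr N) => //; split; first by case: Zl => ? [].
  apply/zP; rewrite -cN; have [s _] := c_sub (Ordinal jr') (Ordinal jr) (ltnSn j).
  exact: s.
- by move=> j l jr [? []].
- move=> j jr; have [_ [[z cz] _]] := cP (Ordinal jr).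
  by have [l [Zl _]] := member j jr z cz; exists l.
move=> j jr; have jr' : (j < r)%N by apply: ltnW.
have [_ ns] := c_sub (Ordinal jr') (Ordinal jr) (ltnSn j).
have [z [cz ncz]] : exists z, c (Ordinal jr) z /\ ~ c (Ordinal jr') z.
  apply: contrapT => h; apply: ns => z cz; apply: contrapT => ncz; apply: h.
  by exists z.
have [l [Zl lP]] := member _ jr z cz; have [N cN] := closedP (Ordinal jr').
have exl : exact_at p N (Y l) by apply: contrapT => nex; apply: ncz; rewrite cN; apply/lP.
have [d [f [hf fl fP]]] := exact_locus (ltnW p_gt1) Yp exl.
exists d, f; split=> // [l' /(ZP j jr' N l' cN)[_ nex]|/(_ l Zl) e].
  by apply/eqP; apply: contraT => /fP.
by rewrite e eqxx in fl.
Qed.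

End ChainBound.

Theorem corollary6p1p3 (k : closedFieldType) (p : nat) (hp : p \in [pchar k])
    (G : finGroupScheme k) (M : gmod G) (hM : constant_rank p M) :
  (\dim {: M} <= rk_au p G)%N -> rk p M = 0%N.
Proof.
(* Defaults of [natmax] are settled first: a default in [rk] is the claim, and a default in [rk_au]
   or in the chain length forces [dim M = 0], which bounds the rank by [0]. *)
move=> dM; have [//|[a _ aE]] := natmaxP (range (@oprank k p G M)).
have [R0|[U [[abU uniU] /eqP]]] := natmaxP [set n | exists U : subgroupScheme G,
    is_au_subgroup U /\ n%:Z = dimP p U + 1].
  apply/eqP; rewrite -leqn0 /rk -aE /oprank; apply: leq_trans (dimvS (subvf _)) _.
  by rewrite -R0.
rewrite -/(rk_au p G) /dimP /topdim subrK eqz_nat => /eqP rE.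
have [c0|[c cP]] := natmaxP [set n | exists c : 'I_n -> set (Pspace p U), irr_chain (@Pclosed k p U) c].
  apply/eqP; rewrite -leqn0 /rk -aE /oprank; apply: leq_trans (dimvS (subvf _)) _.
  by rewrite -c0 -rE.
have [n [Y [Yp Y_exact Y_points Y_modules [L [tr [L0 trL LI dual nondeg]]]]]] :=
  unipotent_coordinates hp abU uniU.
have := irr_chain_length hp abU uniU Yp Y_exact Y_points Y_modules cP.
rewrite -rE => rn; have {rn}dMn := leq_trans dM rn.
have Al : linear (fun l => act M (incl (Y l))) by move=> e l l'; rewrite !linearP.
pose A := linfun (linear_of Al).
have AE l : A l = act M (incl (Y l)) by rewrite lfunE.
(* By [exact_incl], [Y l] stays exact on kG, hence gives a p-point of [G], where the rank is the
   constant one. *)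
have rank_A l : l != 0 -> \dim (limg (A l)) = rk p M.
  move=> l0; have [|b bE] := @ppoint_exists k p hp G U (Y l) (conj abU uniU) (Yp l).
    move=> u; rewrite lfunE /= => /(exact_incl L0 trL LI dual nondeg (fun u => Y_exact l u l0))[v ->].
    by exists v; rewrite lfunE.
  by rewrite AE -bE -[LHS]/(oprank M b) hM.
have A0 l : A l = 0.
  apply: (constant_rank_commuting_nilpotent (A := A) _ _ _ rank_A) => [l1 l2 m|l1|].
  - by rewrite !AE -!comp_lfunE -!actM -!rmorphM (abelian_measure abU).
  - exists p => m; have E j : iter j (A l1) m = act M (incl (Y l1) ^+ j) m.
      elim: j => [|j IH]; first by rewrite expr0 act1 id_lfunE.
      by rewrite iterS IH AE exprS actM comp_lfunE.
    by rewrite E -rmorphXn /= Yp !linear0 zero_lfunE.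
  by rewrite [X in (_ <= X)%N]dimvf /dim /= mul1n.
have [n0|n_gt0] := posnP n.
  apply/eqP; rewrite -leqn0 /rk -aE /oprank; apply: leq_trans (dimvS (subvf _)) _.
  by rewrite -n0.
have l0 : (const_mx 1 : 'rV[k]_n) != 0.
  apply/eqP => /matrixP/(_ 0 (Ordinal n_gt0))/eqP.
  by rewrite !mxE oner_eq0.
by rewrite -(rank_A _ l0) A0 lim0g dimv0.
Qed.
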